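(* Suppose the following. (1) There is a constant $\kappa>0$ such that for all $x\in\mathbb R^d$, $2\langle x,b(x)\rangle+|\sigma(x)|^2+\int_U|c(x,u)|^2\,\nu(du)\le\kappa(|x|^2+1)$. (2) There exist $\delta_0>0$ and a nondecreasing concave function $\varrho:[0,\infty)\to[0,\infty)$ with $0<\varrho(r)\le(1+r)^2\varrho\big(\tfrac r{1+r}\big)$ for all $r>0$ and $\int_{0+}\frac{dr}{\varrho(r)}=\infty$ such that for every $R>0$ there is a constant $\kappa_R>0$ such that for all $x,z\in\mathbb R^d$ with $|x|\vee|z|\le R$ and $|x-z|\le\delta_0$, $$2\langle x-z,b(x)-b(z)\rangle+|\sigma(x)-\sigma(z)|^2+\int_U|c(x,u)-c(z,u)|^2\,\nu(du)\le\kappa_R\,\varrho(|x-z|^2).$$ (3) There exists a constant $\lambda_0>0$ such that $\langle y,a(x)y\rangle\ge\lambda_0|y|^2$ for all $x,y\in\mathbb R^d$, where $a(x)=\sigma(x)\sigma(x)^T$. Then the semigroup $P_t$ associated with the stochastic differential equation $$dX(t)=b(X(t))\,dt+\sigma(X(t))\,dW(t)+\int_U c(X(t-),u)\,\widetilde N(dt,du)$$ is irreducible.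
   Context: Let $d\ge2$, $(U,\mathfrak U)$ a measurable space, $\nu$ a $\sigma$-finite measure on $U$. The functions $b:\mathbb R^d\to\mathbb R^d$, $\sigma:\mathbb R^d\to\mathbb R^{d\times d}$, $c:\mathbb R^d\times U\to\mathbb R^d$ are Borel measurable; $b$, $\sigma$ and $c(\cdot,u)$ (for each $u\in U$) are continuous, and $x\mapsto\int_U|c(x,u)|^2\nu(du)$ is continuous. For a matrix or vector $A$, $|A|=\sqrt{\mathrm{tr}(AA^T)}$. $W$ is a standard $d$-dimensional Brownian motion, $N$ a Poisson random measure on $[0,\infty)\times U$ with intensity $dt\,\nu(du)$ independent of $W$, and $\widetilde N$ its compensated measure, on a filtered probability space satisfying the usual hypotheses. Under (1) and (2) the equation has, for each $x\in\mathbb R^d$, a unique non-explosive strong solution $X^x$ with $X^x(0)=x$. Put $P_tf(x)=\mathbb E[f(X^x(t))]$ for bounded measurable $f$, and $P_t(x,B)=\mathbb P\{X^x(t)\in B\}$. The semigroup is irreducible if for any $t>0$ and $x\in\mathbb R^d$, $P_t(x,B)>0$ for all non-empty open $B\subset\mathbb R^d$. *)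

(* Defs.v *)
From HB Require Import structures.
From mathcomp Require Import all_boot all_order all_algebra.
From mathcomp Require Import all_classical all_reals all_analysis.
From mathcomp Require Import measurable_realfun.
Set Implicit Arguments.
Unset Strict Implicit.
Unset Printing Implicit Defensive.
Import Order.TTheory GRing.Theory Num.Theory.
Import numFieldNormedType.Exports.
Local Open Scope classical_set_scope.
Local Open Scope ring_scope.

(* The library norm of a matrix is the sup norm; it induces the same topology. *)
Definition enorm (R : realType) (m n : nat) (A : 'M[R]_(m, n)) : R :=
  Num.sqrt (\tr (A *m A^T)).

Definition dotv (R : realType) (d : nat) (x y : 'cV[R]_d) : R :=
  \sum_(i < d) x i 0 * y i 0.

Notation borel T := (g_sigma_algebraType (@open T)).

Definition concave_on_nonneg (R : realType) (f : R -> R) : Prop :=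
  forall x y t : R, 0 <= x -> 0 <= y -> 0 <= t <= 1 ->
    t * f x + (1 - t) * f y <= f (t * x + (1 - t) * y).

(* Processes are maps R -> Omega -> V of which only the times t >= 0 matter. *)
Section filtered_probability_space.
Context (R : realType) (dO : measure_display) (Omega : measurableType dO).
Variables (P : probability Omega R) (F : R -> set (set Omega)).

Definition usual_filtration : Prop :=
  [/\ forall t, 0 <= t ->
        sigma_algebra setT (F t) /\ F t `<=` measurable,
      forall s t, 0 <= s -> s <= t -> F s `<=` F t,
      forall t, 0 <= t -> \bigcap_(s in [set s | t < s]) F s `<=` F t
    & forall E, P.-negligible E -> F 0 E].

Definition sigma_rv (m n : nat) (Y : Omega -> 'M[R]_(m, n)) :
    set (set Omega) :=
  [set E | exists2 B : set (borel 'M[R]_(m, n)),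
     measurable B & E = Y @^-1` B].

Definition adapted (m n : nat) (Y : R -> Omega -> 'M[R]_(m, n)) : Prop :=
  forall t, 0 <= t -> sigma_rv (Y t) `<=` F t.

Definition indep (G H : set (set Omega)) : Prop :=
  forall A B, G A -> H B -> (P (A `&` B) = P A * P B)%E.

(* Measurability is required since P is unconstrained on other sets. *)
Definition cvg_in_prob0 (Y : nat -> Omega -> \bar R) : Prop :=
  forall e : R, 0 < e ->
    (forall n, measurable [set w | (e%:E < Y n w)%E]) /\
    P [set w | (e%:E < Y n w)%E] @[n --> \oo] --> (0 : \bar R).

(* Convergence to J in probability, uniformly on [0, t]. *)
Definition cvg_ucp (m n : nat) (t : R) (I : nat -> R -> Omega -> 'M[R]_(m, n))
    (J : R -> Omega -> 'M[R]_(m, n)) : Prop :=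
  cvg_in_prob0 (fun k w =>
    ereal_sup [set (enorm (I k s w - J s w))%:E | s in `[0, t]]).

Definition cadlag (m n : nat) (f : R -> 'M[R]_(m, n)) : Prop :=
  (forall t, 0 <= t -> f s @[s --> t^'+] --> f t) /\
  (forall t, 0 < t -> cvg (f s @[s --> t^'-])).

Definition left_lim (m n : nat) (f : R -> 'M[R]_(m, n)) (t : R) :
    'M[R]_(m, n) := lim (f s @[s --> t^'-]).

Section brownian.
Variables (d : nat) (W : R -> Omega -> 'cV[R]_d).

Definition brownian_motion : Prop :=
  [/\ adapted W,
      {ae P, forall w, W 0 w = 0},
      {ae P, forall w, {within `[0, +oo[, continuous (fun t => W t w)}},
      forall s t, 0 <= s -> s < t ->
        indep (F s) (sigma_rv (fun w => W t w - W s w))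
    & forall s t, 0 <= s -> s < t ->
        forall B : 'I_d -> set (measurableTypeR R),
          (forall i, measurable (B i)) ->
          P [set w | forall i, B i ((W t w - W s w) i 0)] =
          (\prod_(i < d) normal_prob 0 (Num.sqrt (t - s)) (B i))%E].

Definition sigma_brownian : set (set Omega) :=
  <<s [set E | exists2 t, 0 <= t & sigma_rv (W t) E] >>.

(* H = sum_i xi_i 1_(l_i, r_i] *)
Record bm_simple := BMSimple {
  bms_size : nat;
  bms_l : 'I_bms_size -> R;
  bms_r : 'I_bms_size -> R;
  bms_coef : 'I_bms_size -> Omega -> 'M[R]_d }.

Definition bm_simple_ok (S : bm_simple) : Prop :=
  forall i, [/\ 0 <= bms_l i, bms_l i <= bms_r i,
    sigma_rv (bms_coef (b := S) i) `<=` F (bms_l i)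
  & exists M : R, forall w, enorm (bms_coef i w) <= M].

Definition bm_simple_fun (S : bm_simple) (s : R) (w : Omega) : 'M[R]_d :=
  \sum_(i < bms_size S)
    (\1_(`]bms_l i, bms_r i] : set R) s : R) *: bms_coef i w.

Definition bm_simple_int (S : bm_simple) (t : R) (w : Omega) : 'cV[R]_d :=
  \sum_(i < bms_size S) bms_coef i w *m
    (W (Num.min (bms_r i) t) w - W (Num.min (bms_l i) t) w).

(* int_0^t H dW, as the limit (uniform on compacts, in probability) of the
   integrals of simple integrands S n with int_0^t |S n - H|^2 ds -> 0 in
   probability; the limit does not depend on the approximating sequence and
   determines I up to indistinguishability. *)
Definition ito_integral (H : R -> Omega -> 'M[R]_d)
    (I : R -> Omega -> 'cV[R]_d) : Prop :=
  exists S : nat -> bm_simple,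
    (forall n, bm_simple_ok (S n)) /\
    forall t, 0 <= t ->
      cvg_in_prob0 (fun n w => \int[lebesgue_measure]_(s in `[0%R, t])
        (enorm (bm_simple_fun (S n) s w - H s w) ^+ 2)%:E)%E /\
      cvg_ucp t (fun n => bm_simple_int (S n)) I.

End brownian.

Section poisson.
Context (dU : measure_display) (U : measurableType dU).
Variables (nu : {sigma_finite_measure set U -> \bar R})
  (N : Omega -> {measure set (measurableTypeR R * U) -> \bar R}).

Definition intensity : set (measurableTypeR R * U) -> \bar R :=
  (@lebesgue_measure R \x nu)%E.

(* Generated by the restriction of N to D. *)
Definition sigma_prm (D : set (measurableTypeR R * U)) : set (set Omega) :=
  <<s [set E | exists A (B : set (\bar R)),
    [/\ measurable A, A `<=` D, measurable B & E = (N ^~ A) @^-1` B]] >>.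

(* The second argument of poisson_prob is a dummy; rate 0 gives a Dirac mass. *)
Definition poisson_random_measure : Prop :=
  [/\ forall t, 0 <= t -> sigma_prm (`[0, t] `*` setT) `<=` F t,
      forall t, 0 <= t -> indep (F t) (sigma_prm (`]t, +oo[ `*` setT)),
      forall A : set (measurableTypeR R * U),
        measurable A -> A `<=` `[0, +oo[ `*` setT ->
        (intensity A < +oo)%E ->
        forall k : nat, P [set w | N w A = (k%:R)%:E] =
          poisson_prob (fine (intensity A)) 0 [set k]
    & forall (n : nat) (A : 'I_n -> set (measurableTypeR R * U))
        (B : 'I_n -> set (\bar R)),
        (forall i, measurable (A i) /\ A i `<=` `[0, +oo[ `*` setT) ->
        trivIset setT A -> (forall i, measurable (B i)) ->
        P [set w | forall i, B i (N w (A i))] =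
        (\prod_(i < n) P [set w | B i (N w (A i))])%E].

(* Only used on sets of finite intensity, where N w A is finite almost surely. *)
Definition compensated (w : Omega) (A : set (measurableTypeR R * U)) : R :=
  fine (N w A) - fine (intensity A).

(* H = sum_i xi_i 1_((l_i, r_i] x A_i) *)
Record prm_simple (d : nat) := PRMSimple {
  prms_size : nat;
  prms_l : 'I_prms_size -> R;
  prms_r : 'I_prms_size -> R;
  prms_mark : 'I_prms_size -> set U;
  prms_coef : 'I_prms_size -> Omega -> 'cV[R]_d }.

Definition prm_simple_ok (d : nat) (S : prm_simple d) : Prop :=
  forall i, [/\ 0 <= prms_l i /\ prms_l i <= prms_r i,
    measurable (prms_mark i), (nu (prms_mark i) < +oo)%E,
    sigma_rv (prms_coef (p := S) i) `<=` F (prms_l i)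
  & exists M : R, forall w, enorm (prms_coef i w) <= M].

Definition prm_simple_fun (d : nat) (S : prm_simple d)
    (s : R) (u : U) (w : Omega) : 'cV[R]_d :=
  \sum_(i < prms_size S)
    ((\1_(`]prms_l i, prms_r i] : set R) s : R) * (\1_(prms_mark i) u : R))
      *: prms_coef i w.

Definition prm_simple_int (d : nat) (S : prm_simple d)
    (t : R) (w : Omega) : 'cV[R]_d :=
  \sum_(i < prms_size S)
    compensated w (`]Num.min (prms_l i) t, Num.min (prms_r i) t]
                   `*` prms_mark i) *: prms_coef i w.

(* The integral of H over (0, t] x U with respect to the compensated measure,
   obtained from simple integrands as in ito_integral. *)
Definition compensated_integral (d : nat) (H : R -> U -> Omega -> 'cV[R]_d)
    (J : R -> Omega -> 'cV[R]_d) : Prop :=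
  exists S : nat -> prm_simple d,
    (forall n, prm_simple_ok (S n)) /\
    forall t, 0 <= t ->
      cvg_in_prob0 (fun n w => \int[intensity]_(z in `[0%R, t] `*` setT)
        (enorm (prm_simple_fun (S n) z.1 z.2 w - H z.1 z.2 w) ^+ 2)%:E)%E /\
      cvg_ucp t (fun n => prm_simple_int (S n)) J.

End poisson.

Section equation.
Context (dU : measure_display) (U : measurableType dU) (d : nat).
Variables (nu : {sigma_finite_measure set U -> \bar R})
  (W : R -> Omega -> 'cV[R]_d)
  (N : Omega -> {measure set (measurableTypeR R * U) -> \bar R})
  (b : 'cV[R]_d -> 'cV[R]_d) (sigma : 'cV[R]_d -> 'M[R]_d)
  (c : 'cV[R]_d -> U -> 'cV[R]_d).

Definition driving_noises : Prop :=
  [/\ brownian_motion W, poisson_random_measure nu N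
    & indep (sigma_brownian W) (sigma_prm N (`[0, +oo[ `*` setT))].

Definition sde_solution (x : 'cV[R]_d) (X : R -> Omega -> 'cV[R]_d) : Prop :=
  [/\ adapted X,
      {ae P, forall w, cadlag (fun t => X t w)}
    & exists I J : R -> Omega -> 'cV[R]_d,
      [/\ ito_integral W (fun s w => sigma (X s w)) I,
          compensated_integral nu N
            (fun s u w => c (left_lim (X ^~ w) s) u) J
        & {ae P, forall w, forall t, 0 <= t ->
            X t w = x
              + (\col_i \int[lebesgue_measure]_(s in `[0, t]) (b (X s w) i 0))
              + I t w + J t w}]].

End equation.

(* P_t(x, B), for a family X such that X x is the process started at x. *)
Definition transition (d : nat) (X : 'cV[R]_d -> R -> Omega -> 'cV[R]_d)
    (t : R) (x : 'cV[R]_d) (B : set 'cV[R]_d) : \bar R :=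
  P [set w | B (X x t w)].

End filtered_probability_space.

Definition irreducible (R : realType) (d : nat)
    (Pt : R -> 'cV[R]_d -> set 'cV[R]_d -> \bar R) : Prop :=
  forall (t : R) (x : 'cV[R]_d), 0 < t ->
    forall B : set 'cV[R]_d, open B -> B !=set0 -> (0 < Pt t x B)%E.

(* Main.v *)
(** Only the path regularity, local boundedness of the coefficients and ellipticity matter,
    so no change of measure and no truncation of the jumps is needed.  Let [v = (y - x) / T]
    and follow [z(t) = X(t) - x - t v], which starts at 0; the claim is that [z(T)] lies in a
    ball of radius [r] with positive probability.  The barrier [F(z) = (r^2 - |z|^2)_+^3] is a
    subsolution: with [s = r^2 - |z|^2], a step of length [h] changes its conditional
    expectation by [h] times
      [- 6 s^2 z.(b - v) - 3 s^2 (|sigma|^2 + int |c|^2) + 12 s |sigma^T z|^2]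
    up to errors that vanish with the mesh.  Jumps of any size are harmless because
    [a |-> a_+^3] is convex, which bounds their effect from below by the tangent.  Near the
    boundary the last term is at least of order [s] by ellipticity and dominates the others,
    which are [O(s^2)]; away from it everything is [O(s^3)], so the expression is
    [>= - kappa s^3], and [E F(z(T)) >= exp (- kappa T) r^6 > 0] by a discrete Gronwall argument.

    The stochastic integrals are only limits in probability of integrals of simple processes,
    so the argument runs on the grid process [tube] built from one such simple process.  Its
    integrands are close to [sigma(X)] and [c(X-, u)] with large probability only; [deficit]
    measures by how much the lower bound [- kappa s^3] fails at a step, and [alive] is the
    event that the accumulated deficit has remained below a threshold. *)
Require Import Defs.
From HB Require Import structures.
From mathcomp Require Import all_boot all_order all_algebra.
From mathcomp Require Import all_classical all_reals all_analysis.
From mathcomp Require Import measurable_realfun.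
From mathcomp Require Import ring lra.

Set Implicit Arguments.
Unset Strict Implicit.
Unset Printing Implicit Defensive.
Import Order.TTheory GRing.Theory Num.Theory.
Import numFieldNormedType.Exports.
Local Open Scope classical_set_scope.
Local Open Scope ring_scope.

(** The constants close because of the order in which they are chosen. The rate [kap] and the factor
    in front of the squared distance between the integrands of the tube and the coefficients
    ([bracket_lb]) depend only on bounds for the coefficients on one fixed ball, so the thresholds
    can be fixed first, then a single index of the approximating simple integrands, and only then
    the grid. The constant of the one-step error does depend on these simple integrands, through
    their sup norms; hence that error has to vanish relative to the step length. It is brought to
    the form [C * (h / B)], where the level [B] at which the drift is truncated tends to infinity
    while the mesh satisfies [h * B ^+ 4 <= 1]. How fine a grid must be for a small deficit depends
    on the path, through its large jumps, while an estimate in expectation needs one grid for all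
    paths; [eventually_prob_ge] passes from one to the other at the price of a small probability.
    The conclusion is by contradiction: if [X T] almost surely avoided a ball around [y], the
    barrier would vanish at time [T] outside a small event. *)

Ltac nonneg := repeat first [assumption | exact: sqr_ge0 | exact: normr_ge0
  | exact: ler0n | exact: ler01 | exact: sqrtr_ge0 | by apply: ltW | apply: addr_ge0 | apply: mulr_ge0
  | apply: exprn_ge0].

Ltac goal_lra := repeat match goal with H : ?T |- _ =>
  lazymatch type of T with Prop => clear H end end; lra.

(** * Expectations and independence *)

Section expectation.
Context (R : realType) (d : measure_display) (T : measurableType d).
Variable P : probability T R.
Implicit Types (X Y U : T -> R).

(** The value is 0 when the integral is not finite, so linearity and comparison below carry [L1]
    hypotheses. *)
Definition Ex (X : T -> R) : R := (\int[P]_w X w)%R.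
Definition L1 (X : T -> R) : Prop := P.-integrable setT (EFin \o X).

Lemma L1_meas X : L1 X -> measurable_fun setT X.
Proof. by move=> /integrableP[/measurable_EFinP]. Qed.

Lemma ExE X : L1 X -> (Ex X)%:E = (\int[P]_w (X w)%:E)%E.
Proof. by move=> iX; rewrite /Ex /Rintegral fineK//; exact: integrable_fin_num. Qed.

Lemma L1_lty X : measurable_fun setT X ->
  (\int[P]_w `|X w|%:E < +oo)%E -> L1 X.
Proof. by move=> mX oo; apply/integrableP; split=> //; exact/measurable_EFinP. Qed.

Lemma L1_le X Y : measurable_fun setT X -> L1 Y ->
  (forall w, `|X w| <= Y w) -> L1 X.
Proof.
move=> mX iY XY; apply: (le_integrable _ _ _ iY) => //; first exact/measurable_EFinP.
by move=> w _; rewrite /= lee_fin (le_trans (XY w))// ler_norm.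
Qed.

Lemma L1_bounded X (M : R) : measurable_fun setT X ->
  (forall w, `|X w| <= M) -> L1 X.
Proof.
move=> mX XM; apply: (@L1_le _ (cst M)) => //.
exact: finite_measure_integrable_cst.
Qed.

Lemma L1_cst (k : R) : L1 (cst k).
Proof. exact: finite_measure_integrable_cst. Qed.

Lemma L1D X Y : L1 X -> L1 Y -> L1 (fun w => X w + Y w).
Proof. by move=> iX iY; apply: (integrableD _ iX iY). Qed.

Lemma L1N X : L1 X -> L1 (fun w => - X w).
Proof. by move=> iX; apply: (integrableN iX). Qed.

Lemma L1B X Y : L1 X -> L1 Y -> L1 (fun w => X w - Y w).
Proof. by move=> iX iY; apply: L1D => //; exact: L1N. Qed.

Lemma L1Z k X : L1 X -> L1 (fun w => k * X w).
Proof. by move=> iX; apply: (integrableZl _ _ iX). Qed.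

Lemma L1_sum I (s : seq I) (Q : pred I) (X : I -> T -> R) :
  (forall i, Q i -> L1 (X i)) -> L1 (fun w => \sum_(i <- s | Q i) X i w).
Proof.
move=> iX; have := @integrable_sum _ T R P setT measurableT _ s Q
  (fun i => EFin \o X i) iX.
by apply: eq_integrable => // w _ /=; rewrite sumEFin.
Qed.

Lemma L1_norm X : L1 X -> L1 (fun w => `|X w|).
Proof. exact: integrable_norm. Qed.

Lemma L1_bounded_mul U (M : R) X : measurable_fun setT U ->
  (forall w, `|U w| <= M) -> L1 X -> L1 (fun w => U w * X w).
Proof.
move=> mU UM iX.
apply: (@L1_le _ (fun w => M * `|X w|)).
- by apply: measurable_funM => //; exact: L1_meas.
- by apply/L1Z/L1_norm.
- by move=> w; rewrite normrM ler_wpM2r.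
Qed.

Lemma ExD X Y : L1 X -> L1 Y -> Ex (fun w => X w + Y w) = Ex X + Ex Y.
Proof. by move=> iX iY; exact: RintegralD. Qed.

Lemma ExB X Y : L1 X -> L1 Y -> Ex (fun w => X w - Y w) = Ex X - Ex Y.
Proof. by move=> iX iY; exact: RintegralB. Qed.

Lemma ExZ k X : L1 X -> Ex (fun w => k * X w) = k * Ex X.
Proof. by move=> iX; exact: RintegralZl. Qed.

Lemma Ex_cst k : Ex (cst k) = k.
Proof. by rewrite /Ex Rintegral_cst//= probability_setT mulr1. Qed.

Lemma eq_Ex X Y : X =1 Y -> Ex X = Ex Y.
Proof. by move=> XY; congr Ex; exact/funext. Qed.

Lemma Ex_sum I (s : seq I) (Q : pred I) (X : I -> T -> R) :
  (forall i, Q i -> L1 (X i)) ->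
  Ex (fun w => \sum_(i <- s | Q i) X i w) = \sum_(i <- s | Q i) Ex (X i).
Proof.
move=> iX; elim: s => [|i s IH].
  by rewrite big_nil -[RHS](Ex_cst 0); apply: eq_Ex => w; rewrite big_nil.
rewrite big_cons; under eq_Ex do rewrite big_cons.
by case: ifP => // Qi; rewrite ExD ?IH//; [exact: iX|exact: L1_sum].
Qed.

Lemma Ex_le X Y : L1 X -> L1 Y -> (forall w, X w <= Y w) -> Ex X <= Ex Y.
Proof. by move=> iX iY XY; apply: le_Rintegral => // w _; exact: XY. Qed.

Lemma Ex_ge0 X : (forall w, 0 <= X w) -> 0 <= Ex X.
Proof. by move=> X0; apply: Rintegral_ge0. Qed.

Lemma Ex_ae_eq X Y : L1 X -> L1 Y -> {ae P, forall w, X w = Y w} -> Ex X = Ex Y.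
Proof.
move=> iX iY XY; apply: EFin_inj; rewrite !ExE//.
apply: ae_eq_integral => //.
- by case/integrableP: iX.
- by case/integrableP: iY.
by apply: filterS XY => w XY _ /=; rewrite XY.
Qed.

Lemma Ex_ae_le X Y : L1 X -> L1 Y -> {ae P, forall w, X w <= Y w} -> Ex X <= Ex Y.
Proof.
move=> iX iY XY.
(* The maximum equals [Y] almost everywhere and dominates [X] everywhere, which reduces the claim to
   the pointwise comparison [Ex_le]. *)
have iM : L1 (fun w => Num.max (X w) (Y w)).
  apply: (@L1_le _ (fun w => `|X w| + `|Y w|)).
  - by apply: measurable_maxr; exact: L1_meas.
  - by apply: L1D; exact: L1_norm.
  - move=> w; rewrite /Num.max; case: ifP => _.
      by rewrite lerDr.
    by rewrite lerDl.
rewrite (@Ex_ae_eq Y (fun w => Num.max (X w) (Y w)))//.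
  by apply: Ex_le => // w; rewrite le_max lexx.
by apply: filterS XY => w /max_r ->.
Qed.

Lemma Ex_indic (A : set T) : measurable A -> Ex (\1_A : T -> R) = fine (P A).
Proof. by move=> mA; rewrite /Ex /Rintegral integral_indic// setIT. Qed.

Lemma L1_indic (A : set T) : measurable A -> L1 (\1_A : T -> R).
Proof. by move=> mA; exact: integrable_indic. Qed.

Definition indep_rv (U V : T -> R) : Prop := forall A B : set (R),
  measurable A -> measurable B ->
  P (U @^-1` A `&` V @^-1` B) = (P (U @^-1` A) * P (V @^-1` B))%E.

Section product.
Variables U V : T -> R.
Hypotheses (mU : measurable_fun setT U) (mV : measurable_fun setT V).
Hypothesis UV : indep_rv U V.

Let UU : {mfun T >-> R} :=
  HB.pack (U : T -> R) (isMeasurableFun.Build _ _ _ _ _ mU).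
Let VV : {mfun T >-> R} :=
  HB.pack (V : T -> R) (isMeasurableFun.Build _ _ _ _ _ mV).
Let UVf (w : T) : R * R := (U w, V w).
Let mUV : measurable_fun setT UVf.
Proof. exact: measurable_fun_pair. Qed.
Let UUVV : {mfun T >-> (R * R)%type} :=
  HB.pack UVf (isMeasurableFun.Build _ _ _ _ _ mUV).

(** Independence is agreement of the two laws on measurable rectangles, and these determine the
    product measure. Expectations of products then follow from the theorems of Tonelli and
    Fubini. *)
Let jointE (A : set (R * R)) : measurable A ->
  (distribution P UU \x distribution P VV)%E A = distribution P UUVV A.
Proof.
move=> mA; apply: product_measure_unique => // B C mB mC; exact: UV.
Qed.

Let mprod : measurable_fun [set: R * R]
  (fun z => (z.1 * z.2)%:E).
Proof. by apply/measurable_EFinP; exact: measurable_funM. Qed.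

Lemma indep_rv_L1 : L1 U -> L1 V -> L1 (fun w => U w * V w).
Proof.
move=> iU iV; apply: L1_lty; first exact: measurable_funM.
have -> : (\int[P]_w `|U w * V w|%:E =
   \int[distribution P UUVV]_z `|(z.1 * z.2)%:E|)%E.
  by rewrite ge0_integral_pushforward//; exact: measurableT_comp.
rewrite (_ : (\int[_]_z _)%E =
  (\int[distribution P UU \x distribution P VV]_z `|(z.1 * z.2)%:E|)%E); last first.
  by apply: eq_measure_integral => A mA _; first [exact: jointE|exact/esym/jointE].
rewrite fubini_tonelli1//; last exact: measurableT_comp.
rewrite /fubini_F.
have iVE : (\int[distribution P VV]_y `|y%:E| = \int[P]_w `|(V w)%:E|)%E.
  by rewrite ge0_integral_pushforward//; apply: measurableT_comp.
have iUE : (\int[distribution P UU]_y `|y%:E| = \int[P]_w `|(U w)%:E|)%E.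
  by rewrite ge0_integral_pushforward//; apply: measurableT_comp.
have /integrableP[_ iV'] := iV; have /integrableP[_ iU'] := iU.
have fV : (\int[P]_w `|(V w)%:E|)%E \is a fin_num.
  by rewrite ge0_fin_numE//; exact: integral_ge0.
have HF x : (\int[distribution P VV]_y `|(x * y)%:E| =
    `|x|%:E * \int[P]_w `|(V w)%:E|)%E.
  rewrite -iVE -ge0_integralZl//.
    by apply: eq_integral => y _; rewrite /= normrM EFinM.
  by apply: measurableT_comp.
rewrite (eq_integral (fun x : R => `|x|%:E * \int[P]_w `|(V w)%:E|)%E); last first.
  by move=> x _; exact: HF.
rewrite ge0_integralZr//; first last.
- exact: integral_ge0.
- by apply/measurable_EFinP; exact: normr_measurable.
rewrite [X in (X * _)%E]iUE lte_mul_pinfty//; first exact: integral_ge0.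
by rewrite ge0_fin_numE//; exact: integral_ge0.
Qed.

Lemma indep_rv_Ex : L1 U -> L1 V -> Ex (fun w => U w * V w) = Ex U * Ex V.
Proof.
move=> iU iV.
have iUV := indep_rv_L1 iU iV.
have iP : (distribution P UUVV).-integrable setT (fun z => (z.1 * z.2)%:E).
  by apply: integrable_pushforward => //.
apply: EFin_inj; rewrite EFinM !ExE//.
transitivity (\int[distribution P UUVV]_z (z.1 * z.2)%:E)%E.
  by rewrite integral_pushforward.
rewrite (_ : (\int[_]_z _)%E =
  (\int[distribution P UU \x distribution P VV]_z (z.1 * z.2)%:E)%E); last first.
  by apply: eq_measure_integral => A mA _; first [exact: jointE|exact/esym/jointE].
have iPP : (distribution P UU \x distribution P VV)%E.-integrable setT
   (fun z => (z.1 * z.2)%:E).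
  apply/integrableP; split => //.
  case/integrableP : iP => _; apply: le_lt_trans.
  rewrite le_eqVlt; apply/orP; left; apply/eqP.
  by apply: eq_measure_integral => A mA _; first [exact: jointE|exact/esym/jointE].
rewrite -integral12_prod_meas1//.
have iVE : (\int[distribution P VV]_y y%:E = \int[P]_w (V w)%:E)%E.
  by rewrite integral_pushforward//; exact/measurable_EFinP.
have iUE : (\int[distribution P UU]_y y%:E = \int[P]_w (U w)%:E)%E.
  by rewrite integral_pushforward//; exact/measurable_EFinP.
have iVi : (distribution P VV).-integrable setT (fun y => y%:E).
  by apply: integrable_pushforward => //; exact/measurable_EFinP.
have iUi : (distribution P UU).-integrable setT (fun y => y%:E).
  by apply: integrable_pushforward => //; exact/measurable_EFinP.
rewrite /fubini_F.
have HF x : (\int[distribution P VV]_y (x * y)%:E = x%:E * \int[P]_w (V w)%:E)%E.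
  rewrite -iVE -integralZl//.
rewrite (eq_integral (fun x : R => x%:E * \int[P]_w (V w)%:E)%E); last first.
  by move=> x _; exact: HF.
by rewrite -ExE// integralZr// [X in (X * _)%E]iUE ExE.
Qed.
End product.

End expectation.

(** * The barrier function *)

Section vectors.
Context (R : realType).

Lemma dotvC d (x y : 'cV[R]_d) : dotv x y = dotv y x.
Proof. by apply: eq_bigr => i _; rewrite mulrC. Qed.

Lemma dotvDl d (x y z : 'cV[R]_d) : dotv (x + y) z = dotv x z + dotv y z.
Proof. by rewrite -big_split; apply: eq_bigr => i _; rewrite mxE mulrDl. Qed.

Lemma dotvDr d (x y z : 'cV[R]_d) : dotv z (x + y) = dotv z x + dotv z y.
Proof. by rewrite dotvC dotvDl !(dotvC z). Qed.

Lemma dotv_sqrD d (x y : 'cV[R]_d) :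
  dotv (x + y) (x + y) = dotv x x + 2 * dotv x y + dotv y y.
Proof. by rewrite dotvDl !dotvDr (dotvC y x); ring. Qed.

Lemma dotvZl d a (x z : 'cV[R]_d) : dotv (a *: x) z = a * dotv x z.
Proof. by rewrite mulr_sumr; apply: eq_bigr => i _; rewrite mxE mulrA. Qed.

Lemma dotvZr d a (x z : 'cV[R]_d) : dotv z (a *: x) = a * dotv z x.
Proof. by rewrite dotvC dotvZl dotvC. Qed.

Lemma dotv0l d (x : 'cV[R]_d) : dotv 0 x = 0.
Proof. by apply: big1 => i _; rewrite mxE mul0r. Qed.

Lemma dotv_suml d I (s : seq I) (Q : pred I) (f : I -> 'cV[R]_d) z :
  dotv (\sum_(i <- s | Q i) f i) z = \sum_(i <- s | Q i) dotv (f i) z.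
Proof.
by elim/big_rec2: _ => [|i x y _ <-]; rewrite ?dotv0l// dotvDl.
Qed.

Lemma dotv_sumr d I (s : seq I) (Q : pred I) (f : I -> 'cV[R]_d) z :
  dotv z (\sum_(i <- s | Q i) f i) = \sum_(i <- s | Q i) dotv z (f i).
Proof. by rewrite dotvC dotv_suml; apply: eq_bigr => i _; rewrite dotvC. Qed.

Lemma dotv_mulmx d (A : 'M[R]_d) (z y : 'cV[R]_d) :
  dotv z (A *m y) = dotv (A^T *m z) y.
Proof.
rewrite /dotv; under eq_bigr do rewrite mxE mulr_sumr.
rewrite exchange_big; apply: eq_bigr => i _; rewrite mxE mulr_suml.
by apply: eq_bigr => j _; rewrite mxE mulrCA mulrA.
Qed.

Lemma enorm_ge0 m n (A : 'M[R]_(m, n)) : 0 <= enorm A.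
Proof. exact: sqrtr_ge0. Qed.

Lemma enorm_sqr m n (A : 'M[R]_(m, n)) :
  enorm A ^+ 2 = \sum_i \sum_j A i j ^+ 2.
Proof.
rewrite sqr_sqrtr; last first.
  rewrite /mxtrace sumr_ge0// => i _; rewrite mxE sumr_ge0// => j _.
  by rewrite mxE -expr2 sqr_ge0.
by apply: eq_bigr => i _; rewrite mxE; apply: eq_bigr => j _; rewrite mxE.
Qed.

Lemma enorm_dotv d (x : 'cV[R]_d) : enorm x ^+ 2 = dotv x x.
Proof. by rewrite enorm_sqr; apply: eq_bigr => i _; rewrite big_ord1 expr2. Qed.

Lemma dotv_ge0 d (x : 'cV[R]_d) : 0 <= dotv x x.
Proof. by rewrite -enorm_dotv sqr_ge0. Qed.

Lemma sum_CauchySchwarz (I : finType) (a b : I -> R) :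
  (\sum_i a i * b i) ^+ 2 <= (\sum_i a i ^+ 2) * (\sum_i b i ^+ 2).
Proof.
have [a0|a0] := eqVneq (\sum_i a i ^+ 2) 0.
  rewrite a0 mul0r le_eqVlt; apply/orP; left.
  rewrite sqrf_eq0 big1// => i _.
  have /eqP := a0; rewrite psumr_eq0 => [|j _]; last exact: sqr_ge0.
  by move=> /allP/(_ i); rewrite mem_index_enum sqrf_eq0 => /(_ isT) /eqP ->; rewrite mul0r.
have A0 : 0 < \sum_i a i ^+ 2.
  by rewrite lt_def a0 sumr_ge0// => i _; exact: sqr_ge0.
set A := \sum_i a i ^+ 2 in A0 *; set B := \sum_i b i ^+ 2.
set c := \sum_i a i * b i.
(* This sum of squares expands to [A * (A * B - c ^+ 2)], and the positive factor [A] cancels. *)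
have : 0 <= \sum_i (a i * c - b i * A) ^+ 2.
  by rewrite sumr_ge0// => i _; exact: sqr_ge0.
rewrite (_ : \sum_i _ = A * (A * B - c ^+ 2)).
  by rewrite pmulr_rge0// subr_ge0.
transitivity (A * c ^+ 2 - 2 * (c * A * c) + B * A ^+ 2); last ring.
have -> : A * c ^+ 2 - 2 * (c * A * c) + B * A ^+ 2 =
    \sum_i (a i ^+ 2 * c ^+ 2 - 2 * (a i * b i * (A * c)) + b i ^+ 2 * A ^+ 2).
  by rewrite big_split sumrB /= -!mulr_suml -mulr_sumr -mulr_suml -/A -/B -/c; ring.
by apply: eq_bigr => i _; ring.
Qed.

Lemma dotv_le d (x y : 'cV[R]_d) : `|dotv x y| <= enorm x * enorm y.
Proof.
rewrite -(@ler_pXn2r _ 2)// ?nnegrE ?mulr_ge0 ?enorm_ge0//.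
rewrite real_normK ?num_real// exprMn !enorm_dotv.
apply: le_trans (sum_CauchySchwarz _ _) _.
by rewrite le_eqVlt; apply/orP; left; apply/eqP; congr (_ * _);
  apply: eq_bigr => i _; rewrite expr2.
Qed.

Lemma enormD m n (A B : 'M[R]_(m, n)) : enorm (A + B) <= enorm A + enorm B.
Proof.
rewrite -(@ler_pXn2r _ 2)// ?nnegrE ?addr_ge0 ?enorm_ge0//.
have AB : \sum_i \sum_j A i j * B i j <= enorm A * enorm B.
  apply: le_trans (ler_norm _) _.
  rewrite -(@ler_pXn2r _ 2)// ?nnegrE ?mulr_ge0 ?enorm_ge0// real_normK ?num_real//.
  rewrite exprMn !enorm_sqr !pair_big/=; exact: sum_CauchySchwarz.
suff -> : enorm (A + B) ^+ 2 = enorm A ^+ 2 + 2 * (\sum_i \sum_j A i j * B i j) + enorm B ^+ 2.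
  by rewrite sqrrD; lra.
rewrite !enorm_sqr mulr_sumr -!big_split; apply: eq_bigr => i _ /=.
rewrite mulr_sumr -!big_split; apply: eq_bigr => j _ /=; rewrite mxE; ring.
Qed.

Lemma enormZ m n a (A : 'M[R]_(m, n)) : enorm (a *: A) = `|a| * enorm A.
Proof.
apply/eqP; rewrite -(@eqrXn2 _ 2)// ?mulr_ge0 ?enorm_ge0//; apply/eqP.
rewrite exprMn real_normK ?num_real// !enorm_sqr mulr_sumr; apply: eq_bigr => i _.
by rewrite mulr_sumr; apply: eq_bigr => j _; rewrite mxE exprMn.
Qed.

Lemma enormN m n (A : 'M[R]_(m, n)) : enorm (- A) = enorm A.
Proof. by rewrite -scaleN1r enormZ normrN1 mul1r. Qed.

Lemma enorm0 m n : enorm (0 : 'M[R]_(m, n)) = 0.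
Proof. by rewrite -(scale0r 0) enormZ normr0 mul0r. Qed.

Lemma enorm_entry m n (A : 'M[R]_(m, n)) i j : `|A i j| <= enorm A.
Proof.
rewrite -(@ler_pXn2r _ 2)// ?nnegrE ?enorm_ge0// real_normK ?num_real// enorm_sqr.
rewrite (bigD1 i)//= (bigD1 j)//= -addrA lerDl addr_ge0//.
  by rewrite sumr_ge0// => k _; exact: sqr_ge0.
by rewrite sumr_ge0// => k _; rewrite sumr_ge0// => l _; exact: sqr_ge0.
Qed.

Lemma enorm_sqrD m n (A B : 'M[R]_(m, n)) :
  enorm (A + B) ^+ 2 <= 2 * enorm A ^+ 2 + 2 * enorm B ^+ 2.
Proof.
rewrite !enorm_sqr !mulr_sumr -big_split; apply: ler_sum => i _ /=.
rewrite !mulr_sumr -big_split; apply: ler_sum => j _ /=.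
rewrite mxE; have := sqr_ge0 (A i j - B i j); rewrite !expr2; lra.
Qed.

Lemma enorm_mulmx m n (A : 'M[R]_(m, n)) (x : 'cV[R]_n) :
  enorm (A *m x) <= enorm A * enorm x.
Proof.
rewrite -(@ler_pXn2r _ 2)// ?nnegrE ?mulr_ge0 ?enorm_ge0//.
rewrite exprMn !enorm_sqr mulr_suml; apply: ler_sum => i _.
rewrite big_ord1 mxE; apply: le_trans (sum_CauchySchwarz _ _) _.
rewrite ler_wpM2l ?sumr_ge0// => [j _|]; first exact: sqr_ge0.
by apply: ler_sum => j _; rewrite big_ord1.
Qed.

Lemma enorm_tr m n (A : 'M[R]_(m, n)) : enorm A^T = enorm A.
Proof.
apply/eqP; rewrite -(@eqrXn2 _ 2)// ?enorm_ge0//; apply/eqP.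
rewrite !enorm_sqr exchange_big; apply: eq_bigr => i _.
by apply: eq_bigr => j _; rewrite mxE.
Qed.

End vectors.

Section barrier.
Context (R : realType).

Definition posp (x : R) : R := Num.max x 0.
(** The third power makes the function twice continuously differentiable across the sphere of radius
    [r], so that a second-order expansion keeps a cubic remainder there. *)
Definition barrier d (r : R) (z : 'cV[R]_d) : R := posp (r ^+ 2 - dotv z z) ^+ 3.

Lemma posp_ge0 x : 0 <= posp x.
Proof. by rewrite /posp le_max lexx orbT. Qed.

Lemma pospE x : 0 <= x -> posp x = x.
Proof. by move=> x0; rewrite /posp max_l. Qed.

Lemma posp0 x : x <= 0 -> posp x = 0.
Proof. by move=> x0; rewrite /posp max_r. Qed.

Lemma posp_le x M : 0 <= M -> x <= M -> posp x <= M.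
Proof. by move=> M0 xM; rewrite /posp ge_max xM. Qed.

(** The difference of the two sides is [x ^+ 2 * (2 * x - 3 * y)] if [y <= 0 < x] and
    [(y - x) ^+ 2 * (y + 2 * x)] if both are positive. No smallness of [y - x] is involved, which
    makes the bound fit for jumps. *)
Lemma posp_tangent (x y : R) :
  posp x ^+ 3 + 3 * posp x ^+ 2 * (y - x) <= posp y ^+ 3.
Proof.
have [x0|x0] := leP x 0.
  by rewrite (posp0 x0) !expr0n/= mulr0 mul0r addr0 exprn_ge0// posp_ge0.
rewrite (pospE (ltW x0)); have [y0|y0] := leP y 0.
  rewrite (posp0 y0) expr0n/=.
  have : 0 <= x ^+ 2 * (2 * x - 3 * y) by rewrite mulr_ge0 ?sqr_ge0//; lra.
  rewrite !exprS; lra.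
rewrite (pospE (ltW y0)).
have : 0 <= (y - x) ^+ 2 * (y + 2 * x) by rewrite mulr_ge0 ?sqr_ge0//; lra.
rewrite !exprS; lra.
Qed.

(** In the exact expansion of [y ^+ 3] around [x] the last term is [(y - x) ^+ 3]; with minus its
    absolute value instead, the left side is at most [y ^+ 3] for either sign of [y - x]. Unlike the
    tangent bound, this one keeps the positive second-order term, the source of the gain from
    ellipticity. *)
Lemma posp_taylor (x y : R) : 0 <= x ->
  x ^+ 3 + 3 * x ^+ 2 * (y - x) + 3 * x * (y - x) ^+ 2 - `|y - x| ^+ 3
    <= posp y ^+ 3.
Proof.
move=> x0; have [xy|yx] := lerP x y.
  have y0 : 0 <= y by lra.
  rewrite (pospE y0).
  have : 0 <= (y - x) ^+ 3 by rewrite exprn_ge0// subr_ge0.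
  rewrite !exprS; lra.
have [y0|y0] := leP y 0.
  rewrite (posp0 y0) expr0n/=.
  have : 0 <= (- y) ^+ 3 by rewrite exprn_ge0// oppr_ge0.
  rewrite !exprS; lra.
rewrite (pospE (ltW y0)) !exprS; lra.
Qed.

Lemma barrier_ge0 d r (z : 'cV[R]_d) : 0 <= barrier r z.
Proof. by rewrite exprn_ge0// posp_ge0. Qed.

Lemma barrier_le d r (z : 'cV[R]_d) : barrier r z <= r ^+ 6.
Proof.
rewrite (_ : 6 = 2 * 3)%N// exprM lerXn2r ?nnegrE ?posp_ge0 ?sqr_ge0//.
by rewrite posp_le ?sqr_ge0// gerBl dotv_ge0.
Qed.

(** For [v <= 1] this is a Lipschitz bound; for [v > 1] both quantities lie between 0 and [r ^+ 2].
    The cap at 1 is used in [step_error_bound], where the factor multiplies the square of a jump. *)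
Lemma barrier_pos_part d (r : R) (z w J : 'cV[R]_d) (v : R) : 0 < r ->
  0 < r ^+ 2 - dotv z z -> enorm w <= v ->
  let s := r ^+ 2 - dotv z z in
  let s' := r ^+ 2 - dotv (z + w) (z + w) in
  `|posp s' - s| <= (2 * r + 1 + r ^+ 2) * Num.min v 1.
Proof.
move=> r0 s0 wv /=; set s := r ^+ 2 - dotv z z in s0 *.
set s' := r ^+ 2 - dotv (z + w) (z + w).
have zr : enorm z <= r.
  rewrite -(@ler_pXn2r _ 2)// ?nnegrE ?enorm_ge0 ?(ltW r0)// enorm_dotv.
  by rewrite /s in s0; lra.
have v0 : 0 <= v by rewrite (le_trans _ wv)// enorm_ge0.
have sr : s <= r ^+ 2 by rewrite gerBl dotv_ge0.
have sr' : s' <= r ^+ 2 by rewrite gerBl dotv_ge0.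
have [v1|v1] := leP v 1.
  apply: (@le_trans _ _ `|s' - s|).
    have [s'0|s'0] := leP s' 0; last by rewrite pospE// ltW.
    by rewrite posp0// sub0r normrN gtr0_norm// ltr0_norm; lra.
  have -> : s' - s = - (2 * dotv z w + dotv w w).
    by rewrite /s /s' (dotv_sqrD z w); ring.
  rewrite normrN (le_trans (ler_normD _ _))// normrM ger0_norm//.
  rewrite (ger0_norm (dotv_ge0 _)) -enorm_dotv.
  have h1 : `|dotv z w| <= r * v.
    by rewrite (le_trans (dotv_le _ _))// ler_pM ?enorm_ge0.
  have h2 : enorm w ^+ 2 <= v.
    rewrite expr2 (le_trans (_ : _ <= v * 1))//; last by rewrite mulr1.
    by rewrite ler_pM ?enorm_ge0// (le_trans wv).
  have h3 : 0 <= r ^+ 2 * v by rewrite mulr_ge0 ?sqr_ge0.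
  lra.
have h1 : 0 <= posp s' <= r ^+ 2 by rewrite posp_ge0 posp_le// sqr_ge0.
rewrite mulr1 ler_norml; apply/andP; split; lra.
Qed.

(** Here [u], [g], [J] are the drift, Brownian and jump parts of one step. The tangent bound at
    [z + u + g] treats [J], the Taylor bound at [z] treats [u + g]. The derivative met in the
    tangent bound is taken at [z + u + g]; moving it back to [z] produces the mixed errors in
    [enorm J] and [enorm J ^+ 2]. *)
Lemma barrier_step d (r : R) : 0 < r -> exists2 C : R, 0 <= C &
  forall (z u g J : 'cV[R]_d) (A G : R),
  let s := r ^+ 2 - dotv z z in
  0 < s -> enorm u <= A -> enorm g <= G ->
  s ^+ 3 - 6 * s ^+ 2 * (dotv z u + dotv z g + dotv z J)
    - 3 * s ^+ 2 * dotv g g - 3 * s ^+ 2 * dotv J J + 12 * s * dotv z g ^+ 2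
    - C * (A * G + A ^+ 2 + (A + G) ^+ 3 + (A + G) ^+ 6 + (A + G) * enorm J
           + Num.min (A + G) 1 * enorm J ^+ 2)
  <= barrier r (z + u + g + J).
Proof.
move=> r0; set Cm := 2 * r + 1 + r ^+ 2.
have Cm0 : 0 <= Cm by rewrite /Cm; have := sqr_ge0 r; lra.
set C := 33 * r ^+ 4 + 44 * r ^+ 3 + 4 + 12 * r ^+ 3 * Cm + 6 * r ^+ 4 + 6 * r ^+ 2 * Cm.
have [r2 r3 r4] : [/\ 0 <= r ^+ 2, 0 <= r ^+ 3 & 0 <= r ^+ 4].
  by split; rewrite exprn_ge0// ltW.
have [rc3 rc2] : 0 <= r ^+ 3 * Cm /\ 0 <= r ^+ 2 * Cm by split; rewrite mulr_ge0.
have C0 : 0 <= C by rewrite /C; lra.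
exists C => // z u g J A G s s0 uA gG.
set w := u + g; set v := A + G; set j := enorm J.
have wv : enorm w <= v by rewrite (le_trans (enormD _ _))// lerD.
have A0 : 0 <= A by rewrite (le_trans _ uA)// enorm_ge0.
have G0 : 0 <= G by rewrite (le_trans _ gG)// enorm_ge0.
have v0 : 0 <= v by rewrite addr_ge0.
have j0 : 0 <= j by exact: enorm_ge0.
have zr : enorm z <= r.
  rewrite -(@ler_pXn2r _ 2)// ?nnegrE ?enorm_ge0 ?(ltW r0)// enorm_dotv.
  by rewrite /s in s0; lra.
have sr : s <= r ^+ 2 by rewrite gerBl dotv_ge0.
have s2r : s ^+ 2 <= r ^+ 4.
  by rewrite (_ : 4 = 2 * 2)%N// exprM lerXn2r ?nnegrE// ltW.
set s' := r ^+ 2 - dotv (z + w) (z + w).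
have sr' : s' <= r ^+ 2 by rewrite gerBl dotv_ge0.
set a := posp s'.
have a0 : 0 <= a by exact: posp_ge0.
have ar : a <= r ^+ 2 by rewrite posp_le// sqr_ge0.
have a2r : a ^+ 2 <= r ^+ 4.
  by rewrite (_ : 4 = 2 * 2)%N// exprM lerXn2r ?nnegrE// ltW.
have a20 : 0 <= a ^+ 2 by exact: sqr_ge0.
have s20 : 0 <= s ^+ 2 by exact: sqr_ge0.
set m := Num.min v 1.
have m0 : 0 <= m by rewrite /m le_min v0 ler01.
have mv : m <= v by rewrite /m ge_min lexx.
have as_ : `|a - s| <= Cm * m by exact: (@barrier_pos_part _ r z w J v).
have as2 : `|a ^+ 2 - s ^+ 2| <= 2 * r ^+ 2 * (Cm * m).
  rewrite subr_sqr normrM mulrC ler_pM// ger0_norm; move: a0 s0 ar sr; goal_lra.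
have zJ : `|dotv z J| <= r * j by rewrite (le_trans (dotv_le _ _))// ler_pM ?enorm_ge0.
have wJ : `|dotv w J| <= v * j by rewrite (le_trans (dotv_le _ _))// ler_pM ?enorm_ge0.
have JJ : dotv J J = j ^+ 2 by rewrite -enorm_dotv.
have e1 : (a ^+ 2 - s ^+ 2) * dotv z J <= 2 * r ^+ 3 * Cm * (v * j).
  apply: le_trans (ler_norm _) _; rewrite normrM.
  apply: (@le_trans _ _ (2 * r ^+ 2 * (Cm * m) * (r * j))); first by rewrite ler_pM.
  have : r ^+ 3 * Cm * (m * j) <= r ^+ 3 * Cm * (v * j).
    by rewrite ler_wpM2l// ler_wpM2r.
  rewrite !exprS; lra.
have e2 : a ^+ 2 * dotv w J <= r ^+ 4 * (v * j).
  apply: le_trans (ler_norm _) _; rewrite normrM ger0_norm//.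
  by rewrite ler_pM.
have e3 : (a ^+ 2 - s ^+ 2) * j ^+ 2 <= 2 * r ^+ 2 * Cm * (m * j ^+ 2).
  rewrite [leRHS]mulrA ler_wpM2r ?sqr_ge0//; apply: le_trans (ler_norm _) _.
  by rewrite (le_trans as2)//; lra.
have step1 : posp s' ^+ 3 + 3 * a ^+ 2 * (- 2 * dotv (z + w) J - dotv J J)
    <= barrier r (z + u + g + J).
  have := posp_tangent s' (r ^+ 2 - dotv (z + u + g + J) (z + u + g + J)).
  rewrite -/a; apply: le_trans; rewrite le_eqVlt; apply/orP; left; apply/eqP.
  congr (_ + _ * _).
  rewrite /s' -(addrA z u g) -/w (dotvDl (z + w)) !(dotvDr _ J) (dotvC J (z + w)).
  ring.
have ww : dotv w w <= dotv g g + 2 * (A * G) + A ^+ 2.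
  rewrite /w dotvDl !dotvDr (dotvC g u) -(enorm_dotv u).
  have h1 : dotv u g <= A * G.
    by rewrite (le_trans (ler_norm _))// (le_trans (dotv_le _ _))// ler_pM ?enorm_ge0.
  have h2 : enorm u ^+ 2 <= A ^+ 2 by rewrite lerXn2r ?nnegrE ?enorm_ge0.
  lra.
have zg : `|dotv z g| <= r * G by rewrite (le_trans (dotv_le _ _))// ler_pM ?enorm_ge0.
have zu : `|dotv z u| <= r * A by rewrite (le_trans (dotv_le _ _))// ler_pM ?enorm_ge0.
have zw : `|dotv z w| <= r * v by rewrite (le_trans (dotv_le _ _))// ler_pM ?enorm_ge0.
have wv2 : 0 <= dotv w w <= v ^+ 2.
  by rewrite dotv_ge0 -enorm_dotv lerXn2r ?nnegrE ?enorm_ge0.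
have sE : s' - s = - 2 * dotv z w - dotv w w.
  by rewrite /s /s' (dotv_sqrD z w); ring.
have f1 : `|s' - s| ^+ 3 <= 32 * r ^+ 3 * v ^+ 3 + 4 * v ^+ 6.
  apply: (@le_trans _ _ ((2 * (r * v) + v ^+ 2) ^+ 3)).
    rewrite lerXn2r ?nnegrE ?normr_ge0//.
      by rewrite addr_ge0 ?mulr_ge0 ?sqr_ge0// ltW.
    have /andP[w0 w1] := wv2; move: zw; rewrite ler_norml => /andP[z1 z2].
    by rewrite sE ler_norml; apply/andP; split; move: w0 w1 z1 z2; goal_lra.
  have x0 : 0 <= 2 * (r * v) by rewrite !mulr_ge0// ltW.
  have y0 : 0 <= v ^+ 2 by exact: sqr_ge0.
  (* The factors come from [(x + y) ^+ 3 <= 4 * (x ^+ 3 + y ^+ 3)] for nonnegative numbers, with 32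
     equal to 4 times the cube of 2. *)
  have -> : 32 * r ^+ 3 * v ^+ 3 + 4 * v ^+ 6 = 4 * ((2 * (r * v)) ^+ 3 + (v ^+ 2) ^+ 3).
    by ring.
  set x := 2 * (r * v) in x0 *; set y := v ^+ 2 in y0 *.
  have : 0 <= 3 * ((x + y) * (x - y) ^+ 2).
    by nonneg.
  by rewrite !exprS; goal_lra.
(* The square of [s' - s] is at least [4 (z.w)^2 + 4 (z.w)(w.w)]. With [z.w = z.u + z.g] only
   [(z.g)^2] is kept: the cross term is at most of order [A * G], and [(z.w)(w.w)] of order
   [v ^+ 3]. *)
have f2 : 12 * s * dotv z g ^+ 2 - 24 * r ^+ 4 * (A * G) - 12 * r ^+ 3 * v ^+ 3
    <= 3 * s * (s' - s) ^+ 2.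
  have h1 : - (r ^+ 2 * (A * G)) <= dotv z u * dotv z g.
    rewrite lerNl (le_trans (ler_norm _))// normrN normrM.
    rewrite (le_trans (ler_pM _ _ zu zg))// le_eqVlt; apply/orP; left; apply/eqP; ring.
  have h2 : - (r * v * v ^+ 2) <= dotv z w * dotv w w.
    rewrite lerNl (le_trans (ler_norm _))// normrN normrM.
    have /andP[w0 w1] := wv2.
    by rewrite (ger0_norm w0) ler_pM.
  have h3 : dotv z w = dotv z u + dotv z g by rewrite dotvDr.
  have h4 : 4 * dotv z g ^+ 2 - 8 * (r ^+ 2 * (A * G)) - 4 * (r * v * v ^+ 2)
     <= (s' - s) ^+ 2.
    rewrite sE h3 in h2 *.
    have := sqr_ge0 (dotv w w); have := sqr_ge0 (dotv z u).
    by move: h1 h2; rewrite !exprS; goal_lra.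
  have h5 := ler_wpM2l (mulr_ge0 (ler0n R 3) (ltW s0)) h4.
  have h6 : s * (r ^+ 2 * (A * G)) <= r ^+ 2 * (r ^+ 2 * (A * G)).
    by apply: ler_wpM2r => //; nonneg.
  have h7 : s * (r * v * v ^+ 2) <= r ^+ 2 * (r * v * v ^+ 2).
    by apply: ler_wpM2r => //; nonneg.
  by move: h5 h6 h7; rewrite !exprS; goal_lra.
have f3 : - 6 * s ^+ 2 * dotv z w - 3 * s ^+ 2 * dotv g g - 6 * r ^+ 4 * (A * G) - 3 * r ^+ 4 * A ^+ 2
   <= 3 * s ^+ 2 * (s' - s).
  have h1 := ler_wpM2l s20 ww.
  have h2 : s ^+ 2 * (2 * (A * G) + A ^+ 2) <= r ^+ 4 * (2 * (A * G) + A ^+ 2).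
    by apply: ler_wpM2r => //; nonneg.
  rewrite sE; lra.
have step2 := posp_taylor s' (ltW s0).
apply: le_trans step1.
rewrite dotvDl.
have E1 : 0 <= A * G by rewrite mulr_ge0.
have E2 : 0 <= A ^+ 2 by exact: sqr_ge0.
have E3 : 0 <= v ^+ 3 by rewrite exprn_ge0.
have E4 : 0 <= v ^+ 6 by rewrite exprn_ge0.
have E5 : 0 <= v * j by rewrite mulr_ge0.
have E6 : 0 <= m * j ^+ 2 by rewrite mulr_ge0// sqr_ge0.
have k1 : 30 * r ^+ 4 * (A * G) <= C * (A * G) by rewrite ler_wpM2r// /C; move: r2 r3 r4 rc3 rc2; goal_lra.
have k2 : 3 * r ^+ 4 * A ^+ 2 <= C * A ^+ 2 by rewrite ler_wpM2r// /C; move: r2 r3 r4 rc3 rc2; goal_lra.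
have k3 : 44 * r ^+ 3 * v ^+ 3 <= C * v ^+ 3 by rewrite ler_wpM2r// /C; move: r2 r3 r4 rc3 rc2; goal_lra.
have k4 : 4 * v ^+ 6 <= C * v ^+ 6 by rewrite ler_wpM2r// /C; move: r2 r3 r4 rc3 rc2; goal_lra.
have k5 : (12 * r ^+ 3 * Cm + 6 * r ^+ 4) * (v * j) <= C * (v * j).
  by rewrite ler_wpM2r// /C; move: r2 r3 r4 rc3 rc2; goal_lra.
have k6 : 6 * r ^+ 2 * Cm * (m * j ^+ 2) <= C * (m * j ^+ 2).
  by rewrite ler_wpM2r// /C; move: r2 r3 r4 rc3 rc2; goal_lra.
have h3 : dotv z w = dotv z u + dotv z g by rewrite dotvDr.
rewrite JJ h3 in f3 *.
move: k1 k2 k3 k4 k5 k6 e1 e2 e3 f1 f2 f3 step2.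
clearbody C Cm m j v a s s'.
clear; lra.
Qed.

(** [xi] is a simple integrand and [sg] the diffusion coefficient it approximates; [e], [c2] and
    [e'] stand for the squared norms in [L^2(nu)] of the simple jump integrand, of the jump
    coefficient and of their difference. After replacement of [xi] by [sg], what remains is [s]
    times a quadratic polynomial in [s], which a large [kap] makes nonnegative. Neither constant
    depends on [xi]. *)
Lemma bracket_lb d (r L la m2 : R) : 0 < r -> 0 <= L -> 0 < la -> 0 < m2 ->
  exists kap C : R, [/\ 0 <= kap, 0 <= C &
  forall (z be : 'cV[R]_d) (xi sg : 'M[R]_d) (e e' c2 : R),
  let s := r ^+ 2 - dotv z z in
  0 < s -> enorm be <= L -> enorm sg ^+ 2 <= L ->
  la * enorm z ^+ 2 <= enorm (sg^T *m z) ^+ 2 ->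
  e <= 2 * c2 + 2 * e' -> c2 <= L -> 0 <= e' ->
  - C * (enorm (xi - sg) ^+ 2 + e') <=
  - 6 * s ^+ 2 * dotv z be - 3 * s ^+ 2 * (m2 * enorm xi ^+ 2 + e)
   + 12 * m2 * s * enorm (xi^T *m z) ^+ 2 + kap * s ^+ 3].
Proof.
move=> r0 L0 la0 m0.
(* The coefficient of [- s ^+ 2]: drift, Brownian bracket, jump bracket, and the part of the
   ellipticity gain [6 * m2 * la * s * (r ^+ 2 - s)] that is lost because [|z|^2] is [r ^+ 2 - s]
   and not [r ^+ 2]. *)
set D := 6 * r * L + 6 * m2 * L + 6 * L + 6 * m2 * la.
exists (D ^+ 2 / (24 * m2 * la * r ^+ 2)), (18 * m2 * r ^+ 4 + 6 * r ^+ 4); split.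
- by rewrite divr_ge0 ?sqr_ge0// !mulr_ge0 ?sqr_ge0// ltW.
- by rewrite addr_ge0 ?mulr_ge0 ?exprn_ge0// ltW.
move=> z be xi sg e e' c2 s s0 beL sgL ell ee' c2L e'0.
set dd := enorm (xi - sg) ^+ 2.
have dd0 : 0 <= dd by exact: sqr_ge0.
have zr : enorm z <= r.
  rewrite -(@ler_pXn2r _ 2)// ?nnegrE ?enorm_ge0 ?(ltW r0)// enorm_dotv.
  by rewrite /s in s0; lra.
have sr : s <= r ^+ 2 by rewrite gerBl dotv_ge0.
have h1 : dotv z be <= r * L.
  by rewrite (le_trans (ler_norm _))// (le_trans (dotv_le _ _))// ler_pM ?enorm_ge0.
have h2 : enorm xi ^+ 2 <= 2 * L + 2 * dd.
  have := enorm_sqrD (xi - sg) sg; rewrite subrK -/dd; lra.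
have h3 : la / 2 * (r ^+ 2 - s) - r ^+ 2 * dd <= enorm (xi^T *m z) ^+ 2.
  have := enorm_sqrD ((sg - xi)^T *m z) (xi^T *m z).
  rewrite -mulmxDl -linearD/= subrK => h.
  have : enorm ((sg - xi)^T *m z) ^+ 2 <= r ^+ 2 * dd.
    rewrite mulrC /dd -exprMn lerXn2r ?nnegrE ?mulr_ge0 ?enorm_ge0 ?(ltW r0)//.
    rewrite (le_trans (enorm_mulmx _ _))// enorm_tr -enormN opprB.
    by rewrite ler_wpM2l ?enorm_ge0.
  have -> : r ^+ 2 - s = enorm z ^+ 2 by rewrite /s enorm_dotv; ring.
  lra.
have s2 : 0 <= s ^+ 2 by exact: sqr_ge0.
have g1 := ler_wpM2l s2 h1.
have g2 := ler_wpM2l s2 (ler_wpM2l (ltW m0) h2).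
have g3 := ler_wpM2l (mulr_ge0 (ltW m0) (ltW s0)) h3.
have ee : e <= 2 * L + 2 * e' by lra.
have g4 := ler_wpM2l s2 ee.
set kap := D ^+ 2 / _.
(* The value of [kap] makes the discriminant vanish: multiplied by [24 * m2 * la * r ^+ 2], the
   polynomial is a perfect square. *)
have Q : 0 <= 6 * m2 * la * r ^+ 2 - D * s + kap * s ^+ 2.
  have q0 : 0 < 24 * m2 * la * r ^+ 2 by rewrite !mulr_gt0// exprn_gt0.
  rewrite -(pmulr_rge0 _ q0).
  have -> : 24 * m2 * la * r ^+ 2 * (6 * m2 * la * r ^+ 2 - D * s + kap * s ^+ 2)
     = (12 * m2 * la * r ^+ 2 - D * s) ^+ 2.
    rewrite /kap; field; rewrite ?gt_eqF//.
  exact: sqr_ge0.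
have g5 := mulr_ge0 (ltW s0) Q.
have s4 : s ^+ 2 <= r ^+ 4.
  by rewrite (_ : 4 = 2 * 2)%N// exprM lerXn2r ?nnegrE ?sqr_ge0// ltW.
have k1 : s ^+ 2 * (6 * m2 * dd + 6 * e') <= r ^+ 4 * (6 * m2 * dd + 6 * e').
  rewrite ler_wpM2r//; apply: addr_ge0; last by apply: mulr_ge0.
  by apply: mulr_ge0 => //; apply: mulr_ge0 => //; exact: ltW.
have k2 : s * (12 * m2 * r ^+ 2 * dd) <= r ^+ 2 * (12 * m2 * r ^+ 2 * dd).
  by apply: ler_wpM2r => //; nonneg.
have k3 : 0 <= r ^+ 4 * m2 * e' by nonneg.
have k4 : 0 <= r ^+ 4 * dd by nonneg.
have -> : kap * s ^+ 3 = s * (kap * s ^+ 2) by rewrite !exprS; ring.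
rewrite /D in g5.
move: g1 g2 g3 g4 g5 k1 k2 k3 k4; clear.
rewrite !exprS !expr0; lra.
Qed.

End barrier.

(** * Moments of the normal and Poisson laws *)

Section density.
Context (R : realType) (d : measure_display) (T : measurableType d).
Variables (mu nu : {measure set T -> \bar R}) (g : T -> R).
Hypotheses (g0 : forall x, 0 <= g x) (mg : measurable_fun setT g).
Hypothesis nuE : forall A, measurable A -> nu A = (\int[mu]_(x in A) (g x)%:E)%E.

Import HBNNSimple.

(** True for indicators by the hypothesis on [nu], for simple functions by linearity, and in general
    by monotone convergence. *)
Lemma ge0_integral_density (f : T -> R) : measurable_fun setT f ->
  (forall x, 0 <= f x) ->
  (\int[nu]_x (f x)%:E = \int[mu]_x (f x * g x)%:E)%E.
Proof.
move=> mf f0.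
have mF : measurable_fun setT (EFin \o f) by exact/measurable_EFinP.
have F0 x : setT x -> (0 <= (EFin \o f) x)%E by rewrite lee_fin.
pose f_ := nnsfun_approx measurableT mF.
transitivity (limn (fun n => \int[nu]_x (f_ n x)%:E)%E).
  rewrite -monotone_convergence//.
  - apply: eq_integral => y _; apply/esym/cvg_lim => //.
    exact: (cvg_nnsfun_approx measurableT mF F0).
  - by move=> n; exact/measurable_EFinP.
  - by move=> n y _; rewrite lee_fin.
  - by move=> y _ m n mn; rewrite lee_fin; exact/lefP/nd_nnsfun_approx.
rewrite [X in limn X](_ : _ = (fun n => \int[mu]_x (f_ n x * g x)%:E)%E).
  rewrite -monotone_convergence//.
  - apply: eq_integral => y _; apply/cvg_lim => //.
    under eq_fun do rewrite EFinM muleC.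
    rewrite mulrC EFinM; apply: cvgeZl => //.
    exact: (cvg_nnsfun_approx measurableT mF F0).
  - by move=> n; apply/measurable_EFinP/measurable_funM.
  - by move=> n y _; rewrite lee_fin mulr_ge0.
  - move=> y _ m n mn; rewrite lee_fin ler_wpM2r//.
    by exact/lefP/nd_nnsfun_approx.
apply/funext => n.
transitivity (\sum_(k \in range (f_ n)) k%:E * \int[mu]_x (\1_(f_ n @^-1` [set k]) x * g x)%:E)%E.
  rewrite integralT_nnsfun sintegralE.
  apply: eq_fsbigr => k _; congr (_ * _)%E.
  rewrite nuE// integral_mkcond; apply: eq_integral => x _.
  by rewrite patchE indicE; case: (x \in _); rewrite ?mul1r ?mul0r.
transitivity (\sum_(k \in range (f_ n)) \int[mu]_x (k * (\1_(f_ n @^-1` [set k]) x * g x))%:E)%E.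
  apply: eq_fsbigr => k; rewrite inE => -[x _ <-].
  under [RHS]eq_integral do rewrite EFinM.
  rewrite ge0_integralZl//.
  - by apply/measurable_EFinP/measurable_funM.
  - by move=> y _; rewrite lee_fin mulr_ge0.
  - by rewrite lee_fin.
rewrite -ge0_integral_fsum//.
- apply: eq_integral => x _.
  transitivity ((\sum_(k \in range (f_ n)) (k * \1_(f_ n @^-1` [set k]) x)%:E) * (g x)%:E)%E.
    rewrite ge0_mule_fsuml; first by apply: eq_fsbigr => k _; rewrite -EFinM mulrA.
    by move=> k; have := nnfun_muleindic_ge0 (f_ n) k x; rewrite -EFinM.
  by rewrite fsumEFin// -fimfunE -EFinM.
- by move=> k; apply/measurable_EFinP/measurable_funM => //; apply: measurable_funM.
- move=> k x _; rewrite lee_fin mulrA mulr_ge0//.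
  by have := nnfun_muleindic_ge0 (f_ n) k x; rewrite -EFinM lee_fin.
Qed.

End density.

Section normal_moments.
Context (R : realType).
Local Notation mu := (@lebesgue_measure R).

Lemma normal_pdf0E (q x : R) : 0 < q ->
  normal_pdf 0 q x = (Num.sqrt (q ^+ 2 * pi *+ 2))^-1 * expR (- x ^+ 2 / (q ^+ 2 *+ 2)).
Proof. by move=> q0; rewrite /normal_pdf gt_eqF// /normal_fun subr0. Qed.

(** Lebesgue measure is [q] times its image under multiplication by [q], as is checked on intervals.
    Moments of every normal increment thereby reduce to those of the standard law. *)
Lemma normal_prob_scale (q : R) (B : set (measurableTypeR R)) : 0 < q ->
  measurable B -> normal_prob 0 q B = normal_prob 0 1 [set x | B (q * x)].
Proof.
move=> q0 mB.
have mq : measurable_fun setT (fun x : measurableTypeR R => q * x : measurableTypeR R).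
  by apply: measurable_funM.
pose qn : {nonneg R} := NngNum (ltW q0).
pose phi (x : measurableTypeR R) : measurableTypeR R := q * x.
pose pm : {measure set (measurableTypeR R) -> \bar R} :=
  measure_function_pushforward__canonical__measure_function_Measure mu mq.
pose m' := mscale qn pm.
have m'E A : measurable A -> mu A = m' A.
  move=> mA; apply: lebesgue_measure_unique => // _ [[a b]] _ <-.
  have pmE : pm `]a, b]%classic = mu `](a / q), (b / q)]%classic.
    rewrite /pm/= /pushforward; congr mu.
    apply/seteqP; split => x /=; rewrite !in_itv/=;
      by rewrite ltr_pdivrMr// ler_pdivlMr// (mulrC x).
  transitivity (q%:E * pm `]a, b]%classic)%E; last by [].
  rewrite pmE.
  rewrite !lebesgue_measure_itv/= !lte_fin ltr_pM2r ?invr_gt0//.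
  case: ifPn => _; last by rewrite mule0.
  by rewrite -!EFinD -EFinM; congr EFin; field; rewrite gt_eqF.
rewrite /normal_prob.
rewrite (eq_measure_integral m'); last by move=> A mA _; exact: m'E.
rewrite ge0_integral_mscale//; last 2 first.
- by apply/measurable_EFinP/measurable_funTS; exact: measurable_normal_pdf.
- by move=> x _; rewrite lee_fin normal_pdf_ge0.
rewrite (ge0_integral_pushforward mq)//; last 2 first.
- by apply/measurable_EFinP/measurable_funTS; exact: measurable_normal_pdf.
- by move=> x _; rewrite lee_fin normal_pdf_ge0.
rewrite -ge0_integralZl//; first last.
- by move=> x _; rewrite lee_fin normal_pdf_ge0.
- apply/measurable_EFinP; apply: measurable_funTS.
  by apply: measurableT_comp => //; exact: measurable_normal_pdf.
- by rewrite -[X in measurable X]setTI; exact (mq measurableT _ mB).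
apply: eq_integral => x _ /=; rewrite -EFinM; congr EFin.
rewrite !normal_pdf0E// mulrA; congr (_ * expR _); last first.
  by field; rewrite gt_eqF.
rewrite expr1n mul1r -(mulrnAr (q ^+ 2)) sqrtrM ?sqr_ge0// sqrtr_sqr gtr0_norm//.
by rewrite invfM mulrA divff ?mul1r// gt_eqF.
Qed.

Lemma normal_prob_opp (B : set (measurableTypeR R)) :
  measurable B -> normal_prob 0 1 B = normal_prob 0 1 [set x : R | B (- x)].
Proof.
move=> mB; rewrite /normal_prob.
have mo : measurable_fun setT (-%R : measurableTypeR R -> measurableTypeR R) by [].
rewrite (eq_measure_integral (pushforward mu (-%R : _ -> measurableTypeR R))); last first.
  by move=> A mA _; exact/esym/lebesgue_measureN.
rewrite ge0_integral_pushforward//; last 2 first.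
- by apply/measurable_EFinP/measurable_funTS; exact: measurable_normal_pdf.
- by move=> x _; rewrite lee_fin normal_pdf_ge0.
by apply: eq_integral => x _ /=; rewrite !normal_pdf0E// sqrrN.
Qed.

Definition normal_mom (k : nat) : \bar R :=
  (\int[normal_prob 0 1]_(x in [set: measurableTypeR R]) (x ^+ (2 * k))%:E)%E.

(** The inequality [u / k <= expR (u / k)], raised to the power [k]. *)
Lemma expR_ge_pow (k : nat) (u : R) : 0 <= u -> u ^+ k <= k%:R ^+ k * expR u.
Proof.
case: k => [|k] u0; first by rewrite !expr0 mul1r (le_trans _ (expR_ge1Dx _))// lerDl.
have -> : expR u = expR (u / k.+1%:R) ^+ k.+1.
  by rewrite -expRM_natl; congr expR; field.
rewrite -exprMn lerXn2r ?nnegrE ?mulr_ge0 ?expR_ge0//.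
rewrite -[leLHS](@divfK _ k.+1%:R)// mulrC ler_wpM2l//.
by rewrite (le_trans _ (expR_ge1Dx _))// lerDr.
Qed.

Lemma normal_mom_lty k : (normal_mom k < +oo)%E.
Proof.
rewrite /normal_mom (@ge0_integral_density _ _ _ mu _ (normal_pdf 0 1))//; last 3 first.
- exact: normal_pdf_ge0.
- exact: measurable_normal_pdf.
- by move=> x; rewrite exprM exprn_ge0// sqr_ge0.
set s2 : R := Num.sqrt 2.
have s20 : 0 < s2 by rewrite sqrtr_gt0.
have s2E : s2 ^+ 2 = 2 by rewrite sqr_sqrtr.
(* The weight [exp (- x^2 / 2)] is split into two factors [exp (- x^2 / 4)]. One absorbs the power
   of [x]; the other is, up to a constant, the normal density of standard deviation [s2]. *)
pose C := 4 ^+ k * k%:R ^+ k * s2.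
apply: (@le_lt_trans _ _ (\int[mu]_x (C%:E * (normal_pdf 0 s2 x)%:E))%E); last first.
  rewrite ge0_integralZl//.
  - by rewrite integral_normal_pdf mule1 ltry.
  - by apply/measurable_EFinP; exact: measurable_normal_pdf.
  - by move=> x _; rewrite lee_fin normal_pdf_ge0.
  - by rewrite lee_fin /C !mulr_ge0 ?exprn_ge0// ltW.
apply: ge0_le_integral => //.
- by move=> x _; rewrite lee_fin mulr_ge0 ?normal_pdf_ge0// exprM exprn_ge0// sqr_ge0.
- apply/measurable_EFinP/measurable_funM; last exact: measurable_normal_pdf.
  exact: measurable_funX.
- apply: emeasurable_funM => //; apply/measurable_EFinP; exact: measurable_normal_pdf.
move=> x _; rewrite -EFinM lee_fin !normal_pdf0E// s2E expr1n mul1r.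
set p := Num.sqrt (pi *+ 2).
have p0 : 0 < p by rewrite sqrtr_gt0 pmulrn_lgt0// pi_gt0.
have -> : Num.sqrt (2 * pi *+ 2) = s2 * p by rewrite -mulrnAr sqrtrM.
have -> : expR (- x ^+ 2 / (1 *+ 2)) = expR (- (x ^+ 2 / 4)) * expR (- x ^+ 2 / (2 *+ 2)) :> R.
  by rewrite -expRD; congr expR; rewrite -mulr_natr; field.
have h : x ^+ (2 * k) * expR (- (x ^+ 2 / 4)) <= 4 ^+ k * k%:R ^+ k.
  rewrite expRN ler_pdivrMr ?expR_gt0//.
  have u0 : 0 <= x ^+ 2 / 4 by rewrite divr_ge0// sqr_ge0.
  have := expR_ge_pow k u0.
  rewrite exprMn exprVn ler_pdivrMr ?exprn_gt0// -exprM => /le_trans; apply.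
  by rewrite le_eqVlt; apply/orP; left; apply/eqP; ring.
have -> : C * ((s2 * p)^-1 * expR (- x ^+ 2 / (2 *+ 2))) =
  (4 ^+ k * k%:R ^+ k) * (p^-1 * expR (- x ^+ 2 / (2 *+ 2))).
  by rewrite /C; field; rewrite !gt_eqF.
have -> : x ^+ (2 * k) * (p^-1 * (expR (- (x ^+ 2 / 4)) * expR (- x ^+ 2 / (2 *+ 2)))) =
  (x ^+ (2 * k) * expR (- (x ^+ 2 / 4))) * (p^-1 * expR (- x ^+ 2 / (2 *+ 2))) by ring.
by rewrite ler_wpM2r// mulr_ge0 ?expR_ge0// invr_ge0 ltW.
Qed.

(* The values of these moments are never used, only finiteness and [0 < nmom 1]. *)
Definition nmom k : R := fine (normal_mom k).

Lemma normal_mom_ge0 k : (0 <= normal_mom k)%E.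
Proof.
by apply: integral_ge0 => x _; rewrite lee_fin exprM exprn_ge0// sqr_ge0.
Qed.

Lemma nmom_ge0 k : 0 <= nmom k.
Proof. by rewrite fine_ge0// normal_mom_ge0. Qed.

(** A vanishing second moment would concentrate the law at the point 0, which is null for a law with
    a density. *)
Lemma nmom1_gt0 : 0 < nmom 1.
Proof.
rewrite lt_def nmom_ge0 andbT; apply/eqP => m0.
have i0 : normal_mom 1 = 0%E.
  by rewrite -[LHS]fineK ?[fine _]m0// ge0_fin_numE ?normal_mom_lty ?normal_mom_ge0.
have mX : measurable_fun [set: measurableTypeR R] (fun x : measurableTypeR R => (x ^+ (2 * 1))%:E).
  by apply/measurable_EFinP/measurable_funX.
have /(ae_eq_integral_abs (normal_prob 0 1) measurableT mX) :
    (\int[normal_prob 0 1]_(x in [set: measurableTypeR R]) `|(x ^+ (2 * 1))%:E| = 0)%E.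
  rewrite -[RHS]i0; apply: eq_integral => x _ /=.
  by rewrite ger0_norm// exprM exprn_ge0// sqr_ge0.
move=> [B [mB B0 sB]].
have B1 : normal_prob (0 : R) 1 (~` B) = 0%E.
  apply/eqP; rewrite eq_le measure_ge0 andbT.
  apply: (@le_trans _ _ (normal_prob (0 : R) 1 [set 0])).
    rewrite le_measure ?inE//; first exact: measurableC.
    move=> x /= Bx; apply/eqP; apply: contraPT Bx => x0 Bx; apply: Bx.
    apply: sB => /= /(_ I) /eqP; rewrite eqe muln1 sqrf_eq0; exact/negP.
  by rewrite /normal_prob integral_set1.
have := probability_setT (normal_prob (0 : R) 1).
rewrite -(setUv B) measureU ?setICr//; last exact: measurableC.
move=> /esym/eqP; rewrite (_ : (_ + _)%E = 0%E) ?eqe ?oner_eq0//.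
by rewrite -[RHS]adde0; congr (_ + _)%E; [exact: B0|exact: B1].
Qed.

End normal_moments.

Section laws.
Context (R : realType) (d : measure_display) (T : measurableType d).
Variable P : probability T R.
Implicit Types X Y Z : T -> R.

Lemma Ex_law X Y : L1 P X -> L1 P Y ->
  (forall B : set R, measurable B -> P (X @^-1` B) = P (Y @^-1` B)) ->
  Ex P X = Ex P Y.
Proof.
move=> iX iY XY; apply: EFin_inj; rewrite !ExE//.
have mid : measurable_fun setT (EFin : R -> \bar R) by exact/measurable_EFinP.
have mX := L1_meas iX; have mY := L1_meas iY.
transitivity (\int[pushforward P X]_x x%:E)%E.
  by rewrite integral_pushforward.
transitivity (\int[pushforward P Y]_x x%:E)%E.
  by apply: eq_measure_integral => B mB _; exact: XY.
by rewrite integral_pushforward.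
Qed.

Definition normal_law X (q : R) : Prop := forall B : set (measurableTypeR R),
  measurable B -> P (X @^-1` B) = normal_prob 0 q B.

Lemma normal_law_integral X q k : 0 < q -> measurable_fun setT X ->
  normal_law X q ->
  (\int[P]_w (X w ^+ (2 * k))%:E = (q ^+ (2 * k) * nmom R k)%:E)%E.
Proof.
move=> q0 mX lX.
have f0 (x : R) : (0 <= (x ^+ (2 * k))%:E)%E.
  by rewrite lee_fin exprM exprn_ge0// sqr_ge0.
have mF : measurable_fun [set: measurableTypeR R]
    (fun x : measurableTypeR R => (x ^+ (2 * k))%:E).
  by apply/measurable_EFinP/measurable_funX.
have mq : measurable_fun setT (fun x : measurableTypeR R => q * x : measurableTypeR R).
  by apply: measurable_funM.
transitivity (\int[pushforward P (X : T -> measurableTypeR R)]_(x in [set: measurableTypeR R]) (x ^+ (2 * k))%:E)%E.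
  by rewrite ge0_integral_pushforward.
pose phi (x : measurableTypeR R) : measurableTypeR R := (q : R) * x.
transitivity (\int[pushforward (normal_prob (0 : R) 1) phi]_(x in [set: measurableTypeR R]) (x ^+ (2 * k))%:E)%E.
  apply: eq_measure_integral => B mB _.
  exact: (etrans (lX B mB) (normal_prob_scale q0 mB)).
rewrite ge0_integral_pushforward//.
rewrite EFinM /nmom fineK; last first.
  by rewrite ge0_fin_numE ?normal_mom_lty// normal_mom_ge0.
rewrite /normal_mom -ge0_integralZl//.
by apply: eq_integral => x _; rewrite /= exprMn EFinM.
Qed.

Lemma normal_law_L1X X q k : 0 < q -> measurable_fun setT X ->
  normal_law X q -> L1 P (fun w => X w ^+ (2 * k)).
Proof.
move=> q0 mX lX; apply: L1_lty; first exact: measurable_funX.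
have := normal_law_integral k q0 mX lX.
rewrite (eq_integral (fun w => `|X w ^+ (2 * k)|%:E)) => [->|w _].
  exact: ltry.
by rewrite ger0_norm// exprM exprn_ge0// sqr_ge0.
Qed.

Lemma normal_law_ExX X q k : 0 < q -> measurable_fun setT X ->
  normal_law X q -> Ex P (fun w => X w ^+ (2 * k)) = q ^+ (2 * k) * nmom R k.
Proof.
move=> q0 mX lX; apply: EFin_inj; rewrite ExE; last exact: normal_law_L1X lX.
exact: normal_law_integral.
Qed.

Lemma normal_law_L1 X q : 0 < q -> measurable_fun setT X ->
  normal_law X q -> L1 P X.
Proof.
move=> q0 mX lX; apply: (@L1_le _ _ _ _ _ (fun w => 1 + X w ^+ (2 * 1))) => //.
  by apply: L1D; [exact: L1_cst|exact: normal_law_L1X lX].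
move=> w; rewrite muln1 -(real_normK (num_real (X w))).
have := sqr_ge0 (`|X w| - 1); have := normr_ge0 (X w); rewrite !expr2; lra.
Qed.

(** By symmetry: [X] and [- X] have the same law, hence the same expectation. *)
Lemma normal_law_Ex0 X q : 0 < q -> measurable_fun setT X ->
  normal_law X q -> Ex P X = 0.
Proof.
move=> q0 mX lX.
have iX := normal_law_L1 q0 mX lX.
have : Ex P X = Ex P (fun w => - X w).
  apply: Ex_law => //; first exact: L1N.
  move=> B mB; rewrite [LHS]lX//.
  have mNB : measurable (-%R @^-1` B).
    rewrite -[X in measurable X]setTI.
    by apply: (_ : measurable_fun setT (-%R : measurableTypeR R -> measurableTypeR R)).
  have -> : (fun w => - X w) @^-1` B = X @^-1` (-%R @^-1` B) by [].
  rewrite [RHS]lX// (normal_prob_scale q0 mB) (normal_prob_scale q0 mNB).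
  have mqB : measurable [set x : measurableTypeR R | B (q * x)].
    rewrite -[X in measurable X]setTI.
    apply: (_ : measurable_fun setT (fun x : measurableTypeR R => q * x : measurableTypeR R)) => //.
    exact: measurable_funM.
  by rewrite [LHS](normal_prob_opp mqB); congr normal_prob; apply/funext => x /=; rewrite mulrN.
have -> : Ex P (fun w => - X w) = - Ex P X.
  by rewrite -mulN1r -ExZ//; apply: eq_Ex => w; rewrite mulN1r.
lra.
Qed.

Section poisson.
Variables (Z : T -> R) (lam : R).
Hypotheses (mZ : measurable_fun setT Z) (lam0 : 0 <= lam).
Hypothesis lZ : forall k : nat, P (Z @^-1` [set k%:R]) = poisson_prob lam 0 [set k].

Let pp (k : nat) : R := lam ^+ k / k`!%:R * expR (- lam).

Let pp_ge0 k : 0 <= pp k.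
Proof. by rewrite !mulr_ge0 ?expR_ge0// exprn_ge0. Qed.

Let ZE k : P (Z @^-1` [set k%:R]) = (pp k)%:E.
Proof.
rewrite lZ /poisson_prob /pp; case: ifPn => [l0|].
  by rewrite esum_set1 ?lee_fin ?poisson_pmf_ge0// /poisson_pmf l0.
rewrite -leNgt => l0; have -> : lam = 0 by apply/eqP; rewrite eq_le l0.
rewrite oppr0 expR0 mulr1 diracE expr0n; case: k => [|k] /=.
  by rewrite mem_set// fact0 divr1.
by rewrite memNset ?mul0r.
Qed.

Let sum_pp : (\sum_(k <oo) (pp k)%:E = 1)%E.
Proof.
have := probability_setT (poisson_prob lam 0).
rewrite /= /poisson_prob; case: ifPn => [l0 <-|].
  rewrite nneseries_esumT//.
  by apply: eq_esum => k _; rewrite /poisson_pmf l0.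
rewrite -leNgt => l0 _; have l00 : lam = 0 by apply/eqP; rewrite eq_le l0.
rewrite nneseries_recl//; last by move=> k _; rewrite lee_fin.
rewrite eseries0 => [|[|k]// _ _]; last by rewrite /pp l00 expr0n/= !mul0r.
by rewrite /pp l00 oppr0 expR0 mulr1 expr0 fact0 divr1 adde0.
Qed.

Let Dk k := Z @^-1` [set k%:R].
Let D := \bigcup_k Dk k.
Let mDk k : measurable (Dk k).
Proof. by rewrite -[X in measurable X]setTI; exact: mZ. Qed.
Let mD : measurable D.
Proof. exact: bigcup_measurable. Qed.
Let tDk : trivIset setT Dk.
Proof.
apply/trivIsetP => i j _ _ ij; apply/seteqP; split => // w /= [zi zj].
by move: ij; rewrite -(eqr_nat R) -zi -zj eqxx.
Qed.

Let PD : P D = 1%E.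
Proof.
rewrite /D measure_bigcup//.
transitivity (\sum_(k <oo) P (Dk k))%E.
  by apply: eq_eseriesl => k; rewrite in_setT.
by rewrite -[RHS]sum_pp; apply: eq_eseriesr => k _; exact: ZE.
Qed.

Let PDC : P (~` D) = 0%E.
Proof. by rewrite probability_setC// PD subee. Qed.

(** A priori [Z] is a real variable known only through its masses at the natural numbers; these
    masses add up to 1, so nothing is left elsewhere. *)
Lemma poisson_ae_nat : {ae P, forall w, exists k : nat, Z w = k%:R}.
Proof.
exists (~` D); split; first exact: measurableC.
  exact: PDC.
by move=> w /= Zw [k _ Dkw]; apply: Zw; exists k.
Qed.

Let ge0_int (f : R -> R) : measurable_fun setT f -> (forall x, 0 <= f x) ->
  (\int[P]_w (f (Z w))%:E = \sum_(k <oo) (f k%:R * pp k)%:E)%E.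
Proof.
move=> mf f0.
have mfZ : measurable_fun setT (fun w => (f (Z w))%:E).
  by apply/measurable_EFinP/measurableT_comp.
rewrite (@ge0_negligible_integral _ _ _ P setT (~` D))//; last 2 first.
- exact: measurableC.
- by move=> w _; rewrite lee_fin.
rewrite setTD setCK ge0_integral_bigcup//; last 2 first.
- exact: measurable_funTS.
- by move=> w _; rewrite lee_fin.
apply: eq_eseriesr => k _.
rewrite (eq_integral (cst (f k%:R)%:E)); last first.
  by move=> w; rewrite inE => ->.
by rewrite [LHS]integral_cst// [X in (_ * X)%E]ZE.
Qed.

Let ser_shift (a : nat -> R) : (forall k, 0 <= a k) -> a 0%N = 0 ->
  (\sum_(k <oo) (a k)%:E = \sum_(k <oo) (a k.+1)%:E)%E.
Proof.
move=> a0 a00; rewrite (nneseries_recl (fun k _ => _))//; last by move=> k _; rewrite lee_fin.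
rewrite a00 add0e -nneseries_addn; last by move=> k; rewrite lee_fin.
by apply: eq_eseriesr => k _; rewrite addn1.
Qed.

Let ppS k : k.+1%:R * pp k.+1 = lam * pp k.
Proof.
rewrite /pp exprS factS natrM; field.
by rewrite nat1r !pnatr_eq0 -lt0n fact_gt0.
Qed.

Let sum1 : (\sum_(k <oo) (k%:R * pp k)%:E = lam%:E)%E.
Proof.
rewrite ser_shift ?mul0r// => [|k]; last by rewrite mulr_ge0.
under eq_eseriesr do rewrite ppS EFinM.
by rewrite nneseriesZl ?sum_pp ?mule1// => k _; rewrite lee_fin.
Qed.

Let sum2 : (\sum_(k <oo) (k%:R ^+ 2 * pp k)%:E = (lam ^+ 2 + lam)%:E)%E.
Proof.
rewrite ser_shift ?expr0n ?mul0r// => [|k]; last by rewrite mulr_ge0// sqr_ge0.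
have E k : (k.+1%:R ^+ 2 * pp k.+1 = lam * (k%:R * pp k + pp k)).
  by rewrite expr2 -mulrA ppS -natr1; ring.
under eq_eseriesr do rewrite E EFinM.
rewrite nneseriesZl//; last by move=> k _; rewrite lee_fin addr_ge0// mulr_ge0.
under eq_eseriesr do rewrite EFinD.
rewrite nneseriesD//; last 2 first.
- by move=> k _; rewrite lee_fin mulr_ge0.
- by move=> k _; rewrite lee_fin.
by rewrite sum1 sum_pp -EFinD -EFinM mulrDr mulr1 expr2.
Qed.

Lemma poisson_int1 : (\int[P]_w `|Z w|%:E = lam%:E)%E.
Proof.
rewrite (ge0_int (@normr_measurable R setT)) => [|x]; last exact: normr_ge0.
by rewrite -sum1; apply: eq_eseriesr => k _; rewrite ger0_norm.
Qed.

Lemma poisson_int2 : (\int[P]_w (Z w ^+ 2)%:E = (lam ^+ 2 + lam)%:E)%E.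
Proof.
rewrite (ge0_int (f := fun x => x ^+ 2))//.
by move=> x; exact: sqr_ge0.
Qed.

Lemma poisson_L1 : L1 P Z.
Proof. by apply: L1_lty => //; rewrite poisson_int1 ltry. Qed.

Lemma poisson_L1X2 : L1 P (fun w => Z w ^+ 2).
Proof.
apply: L1_lty; first exact: measurable_funX.
under eq_integral do rewrite ger0_norm ?sqr_ge0//.
by rewrite poisson_int2 ltry.
Qed.

Lemma poisson_Ex : Ex P Z = lam.
Proof.
rewrite (@Ex_ae_eq _ _ _ _ _ (fun w => `|Z w|))//.
- apply: EFin_inj; rewrite ExE ?poisson_int1//.
  exact/L1_norm/poisson_L1.
- exact: poisson_L1.
- exact/L1_norm/poisson_L1.
by apply: filterS poisson_ae_nat => w [k ->]; rewrite ger0_norm.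
Qed.

Lemma poisson_ExX2 : Ex P (fun w => Z w ^+ 2) = lam ^+ 2 + lam.
Proof. by apply: EFin_inj; rewrite ExE ?poisson_int2//; exact: poisson_L1X2. Qed.

End poisson.

End laws.

(** * Random variables measurable with respect to a sub-sigma-algebra *)

Section sub_sigma_algebra.
Context (R : realType) (d : measure_display) (T : measurableType d).
Variable P : probability T R.

(** Generating a measurable type from [G] makes the closure properties of [measurable_fun]
    available; when [G] is already a sigma-algebra nothing is added ([GmP]). *)
Definition Gm (G : set (set T)) (U : T -> R) : Prop :=
  measurable_fun [set: g_sigma_algebraType G] (U : g_sigma_algebraType G -> R).

Definition bGm (G : set (set T)) (U : T -> R) : Prop :=
  Gm G U /\ exists K, forall w, `|U w| <= K.

Definition sub_sigma (G : set (set T)) : Prop :=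
  sigma_algebra setT G /\ G `<=` measurable.

Variable G : set (set T).
Hypothesis sG : sub_sigma G.

Lemma GmP (U : T -> R) : (forall B : set R, measurable B -> G (U @^-1` B)) <-> Gm G U.
Proof.
split=> [h _ B mB|h B mB].
  rewrite setTI; apply: sub_sigma_algebra; exact: h.
have := h measurableT B mB; rewrite setTI /measurable/=.
by rewrite /Measurable.sort /= (sigma_algebra_id sG.1).
Qed.

Lemma Gm_meas U : Gm G U -> measurable_fun setT U.
Proof. by move=> /GmP h _ B mB; rewrite setTI; apply: sG.2; exact: h. Qed.

Lemma Gm_sub (H : set (set T)) U : G `<=` H -> Gm G U -> Gm H U.
Proof.
move=> GH /GmP h _ B mB; rewrite setTI; apply: sub_sigma_algebra.
by apply: GH; exact: h.
Qed.

Lemma bGm_cst k : bGm G (fun=> k).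
Proof. by split; [exact: measurable_cst|exists `|k|]. Qed.

Lemma bGmD U V : bGm G U -> bGm G V -> bGm G (fun w => U w + V w).
Proof.
move=> [mU [K UK]] [mV [L VL]]; split; first exact: measurable_funD.
by exists (K + L) => w; rewrite (le_trans (ler_normD _ _))// lerD.
Qed.

Lemma bGmM U V : bGm G U -> bGm G V -> bGm G (fun w => U w * V w).
Proof.
move=> [mU [K UK]] [mV [L VL]]; split; first exact: measurable_funM.
by exists (K * L) => w; rewrite normrM ler_pM.
Qed.

Lemma bGmN U : bGm G U -> bGm G (fun w => - U w).
Proof.
move=> [mU [K UK]]; split; first exact: measurableT_comp.
by exists K => w; rewrite normrN.
Qed.

Lemma bGmB U V : bGm G U -> bGm G V -> bGm G (fun w => U w - V w).
Proof. by move=> bU bV; apply: bGmD => //; exact: bGmN. Qed.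

Lemma bGmX U k : bGm G U -> bGm G (fun w => U w ^+ k).
Proof.
move=> bU; elim: k => [|k IH]; first exact: bGm_cst.
by under eq_fun do rewrite exprS; exact: bGmM.
Qed.

Lemma bGm_sum I (s : seq I) (U : I -> T -> R) :
  (forall i, bGm G (U i)) -> bGm G (fun w => \sum_(i <- s) U i w).
Proof.
move=> bU; elim: s => [|i s IH].
  by under eq_fun do rewrite big_nil; exact: bGm_cst.
by under eq_fun do rewrite big_cons; exact: bGmD.
Qed.

Lemma bGm_L1 U : bGm G U -> L1 P U.
Proof. by move=> [/Gm_meas mU [K UK]]; exact: L1_bounded UK. Qed.

Lemma bGm_L1M U X : bGm G U -> L1 P X -> L1 P (fun w => U w * X w).
Proof. by move=> [/Gm_meas mU [K UK]] iX; exact: L1_bounded_mul UK iX. Qed.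

(** This replaces conditional expectation given [G]: instead of computing it, identities are tested
    against bounded [G]-measurable factors [U]. *)
Lemma indep_Ex (H : set (set T)) U V : indep P G H ->
  bGm G U -> L1 P V -> (forall B : set R, measurable B -> H (V @^-1` B)) ->
  Ex P (fun w => U w * V w) = Ex P U * Ex P V.
Proof.
move=> GH bU iV HV; apply: indep_rv_Ex => //.
- by apply: Gm_meas; case: bU.
- exact: L1_meas iV.
- move=> A B mA mB; apply: GH; last exact: HV.
  by apply/(GmP U).2: mA; case: bU.
- exact: bGm_L1.
Qed.

End sub_sigma_algebra.

(** * The one-step estimate *)

Section step_error.
Context (R : realType).

(** Either [x <= t] or [x <= x ^+ 2 / t]. *)
Lemma amgm2 (x t : R) : 0 < t -> 0 <= x -> x <= t + x ^+ 2 / t.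
Proof.
move=> t0 x0; rewrite -(ler_pM2r t0) mulrDl divfK ?gt_eqF//.
have := sqr_ge0 (x - t); have := mulr_ge0 x0 (ltW t0); rewrite !expr2; nra.
Qed.

(** [x] is the size of the Brownian increment, [n] a Poisson count and [j] the jump displacement.
    Mixed products are split into pure powers of [x] and of [n], with weights in [B]. Since
    [x ^+ (2 * k)] has expectation of order [h ^+ k], [n] of order [h] and [n ^+ 2 - n] of order
    [h ^+ 2], the choice [t = B^-2] together with [h * B ^+ 4 <= 1] gives every term on the right an
    expectation of order [h / B]. *)
Lemma step_error_bound (L : R) : 1 <= L -> exists2 C, 0 <= C &
  forall (h B x n j : R), 0 < h -> 1 <= B -> h * B ^+ 4 <= 1 ->
  0 <= x -> 0 <= n -> n <= n ^+ 2 -> 0 <= j -> j <= L * (n + h * L) ->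
  let A := h * B in let t := (B ^+ 2)^-1 in let v := A + L * x in
  A * (L * x) + A ^+ 2 + v ^+ 3 + v ^+ 6 + v * j + Num.min v 1 * j ^+ 2 <=
  C * (h / B + (A / t + t + h / t) * x ^+ 2 + (B / t + 1) * x ^+ 4 + x ^+ 8
       + (A + B^-1) * n + B * t * n ^+ 2 + (n ^+ 2 - n)).
Proof.
move=> L1.
have L0 : 0 <= L by lra.
exists (200 * L ^+ 6); first by rewrite mulr_ge0// exprn_ge0.
move=> h B x n j h0 B1 hB x0 n0 nn j0 jL; cbv zeta; set A := h * B; set t := (B ^+ 2)^-1.
set v := A + L * x.
have B0 : 0 < B by lra.
have t0 : 0 < t by rewrite invr_gt0 exprn_gt0.
have BB : 0 < B^-1 by rewrite invr_gt0.
have Bi1 : B^-1 <= 1 by rewrite invf_le1.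
have tE : t = B^-1 ^+ 2 by rewrite exprVn.
have tB : t <= B^-1 by rewrite tE expr2 -[leRHS]mulr1 ler_wpM2l// ltW.
have A0 : 0 <= A by rewrite mulr_ge0// ltW.
have AB : A <= B^-1 ^+ 3.
  rewrite -(@ler_pM2r _ (B ^+ 3)) ?exprn_gt0// -exprMn mulVf ?gt_eqF// expr1n.
  by rewrite /A -mulrA -exprS.
have hB' : h <= B^-1 ^+ 4.
  by rewrite -(@ler_pM2r _ (B ^+ 4)) ?exprn_gt0// -exprMn mulVf ?gt_eqF// expr1n.
have b3 : B^-1 ^+ 3 <= 1 by rewrite exprn_ile1// ltW.
have b4 : B^-1 ^+ 4 <= 1 by rewrite exprn_ile1// ltW.
have A1 : A <= 1 by lra.
have h1 : h <= 1 by lra.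
have v0 : 0 <= v by rewrite addr_ge0// mulr_ge0.
set S := h / B + _ + _ + _ + _ + _ + _.
pose s1 := h / B. pose s2 := A / t * x ^+ 2. pose s3 := t * x ^+ 2.
pose s4 := h / t * x ^+ 2. pose s5 := B / t * x ^+ 4. pose s6 := x ^+ 4.
pose s7 := x ^+ 8. pose s8 := A * n. pose s9 := B^-1 * n.
pose s10 := B * t * n ^+ 2. pose s11 := n ^+ 2 - n.
have SE : S = s1 + s2 + s3 + s4 + s5 + s6 + s7 + s8 + s9 + s10 + s11.
  by rewrite /S /s1 /s2 /s3 /s4 /s5 /s6 /s7 /s8 /s9 /s10 /s11; ring.
have p1 : 0 <= s1 by rewrite divr_ge0// ltW.
have p2 : 0 <= s2 by rewrite mulr_ge0 ?sqr_ge0// divr_ge0// ltW.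
have p3 : 0 <= s3 by rewrite mulr_ge0 ?sqr_ge0// ltW.
have p4 : 0 <= s4 by rewrite mulr_ge0 ?sqr_ge0// divr_ge0// ltW.
have p5 : 0 <= s5 by rewrite mulr_ge0 ?exprn_ge0// divr_ge0// ltW.
have p6 : 0 <= s6 by rewrite exprn_ge0.
have p7 : 0 <= s7 by rewrite exprn_ge0.
have p8 : 0 <= s8 by rewrite mulr_ge0.
have p9 : 0 <= s9 by rewrite mulr_ge0// ltW.
have p10 : 0 <= s10 by rewrite !mulr_ge0 ?sqr_ge0// ltW.
have p11 : 0 <= s11 by rewrite subr_ge0.
have At : A * t = s1.
  by rewrite /A /t /s1; field; rewrite gt_eqF.
have ht : h * t <= s1 by rewrite /s1 ler_wpM2l// ltW.
have BA : B * A <= B^-1.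
  apply: le_trans tB; have := ler_wpM2l (ltW B0) AB.
  by have -> : B * B^-1 ^+ 3 = t by rewrite tE; field; rewrite gt_eqF.
have AA : A ^+ 2 <= s1.
  by rewrite expr2 {1}/A -mulrA /s1 ler_wpM2l// ltW.
have hh : h ^+ 2 <= s1.
  rewrite expr2 /s1 ler_wpM2l ?(ltW h0)//.
  rewrite (le_trans hB')// exprS -[leRHS]mulr1 ler_wpM2l ?(ltW BB)//.
have Ah : A * h <= s1.
  apply: le_trans AA; rewrite expr2 ler_wpM2l// /A -[leLHS]mulr1 ler_wpM2l// ltW//.
have Lk k : 1 <= L ^+ k by rewrite exprn_ege1.
have L12 : L <= L ^+ 2 by rewrite expr2 -[leLHS]mulr1 ler_wpM2l.
have e1 : A * x <= s1 + s2.
  rewrite -At /s2 -mulrA [t^-1 * _]mulrC -mulrDr ler_wpM2l//; exact: amgm2.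
have e2 : x ^+ 3 <= s3 + s5.
  have h3 : x ^+ 3 <= t * x ^+ 2 + x ^+ 4 / t.
    have := ler_wpM2l (sqr_ge0 x) (amgm2 t0 x0).
    by rewrite -exprSr mulrDr mulrA -exprD (mulrC _ t).
  apply: le_trans h3 _; rewrite lerD2l /s5 mulrC -mulrA -[leLHS]mul1r ler_wpM2r//.
  by rewrite mulr_ge0 ?exprn_ge0// invr_ge0 ltW.
have e3 : x ^+ 6 <= s6 + s7.
  have := sqr_ge0 (x ^+ 2 - x ^+ 4); have := exprn_ge0 4 x0; have := exprn_ge0 8 x0.
  rewrite /s6 /s7 !expr2; rewrite !exprS !expr0; lra.
(* Two weighted splittings in a row: [x <= B^-1 + B * x ^+ 2], then
   [x ^+ 2 * n <= x ^+ 4 / t + t * n ^+ 2]. *)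
have e4 : x * n <= s9 + s5 + s10.
  have g1 : x * n <= s9 + B * (x ^+ 2 * n).
    have := ler_wpM2r n0 (amgm2 BB x0).
    by rewrite mulrDl invrK mulrAC -mulrA (mulrC n) mulrC (mulrC n) /s9 [B * _]mulrCA [B * n]mulrC !mulrA.
  have g2 : x ^+ 2 * n <= x ^+ 4 / t + t * n ^+ 2.
    rewrite -(ler_pM2r t0) mulrDl divfK ?gt_eqF//.
    have := sqr_ge0 (x ^+ 2 - t * n); have := sqr_ge0 (x ^+ 2); have := sqr_ge0 (t * n).
    rewrite !exprS !expr0; lra.
  have g3 : B * (x ^+ 4 / t + t * n ^+ 2) = s5 + s10.
    by rewrite /s5 /s10; field; rewrite gt_eqF.
  have := ler_wpM2l (ltW B0) g2; lra.
have e5 : x * h <= s1 + s4.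
  have := ler_wpM2l (ltW h0) (amgm2 t0 x0).
  rewrite mulrDr (mulrC x) /s4; have -> : h * (x ^+ 2 / t) = h / t * x ^+ 2 by rewrite mulrA mulrAC.
  lra.
have f1 : A * (L * x) <= L ^+ 6 * (s1 + s2).
  rewrite mulrCA; apply: le_trans (ler_wpM2l L0 e1) _.
  by rewrite ler_wpM2r ?addr_ge0// -[leLHS]mulr1 exprS ler_wpM2l.
have f2 : A ^+ 2 <= L ^+ 6 * s1.
  by apply: le_trans AA _; rewrite -[leLHS]mul1r ler_wpM2r.
have Lx0 : 0 <= L * x by rewrite mulr_ge0.
have cube (a b : R) : 0 <= a -> 0 <= b -> (a + b) ^+ 3 <= 4 * (a ^+ 3 + b ^+ 3).
  move=> a0 b0; have : 0 <= 3 * ((a + b) * (a - b) ^+ 2).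
    by nonneg.
  by rewrite !exprS !expr0; goal_lra.
have A3 : A ^+ 3 <= A ^+ 2 by rewrite exprS -[leRHS]mul1r ler_wpM2r ?sqr_ge0.
have A6 : A ^+ 6 <= A ^+ 2.
  by rewrite (exprD A 4 2) -[leRHS]mul1r ler_wpM2r ?sqr_ge0// exprn_ile1.
have f3 : v ^+ 3 <= 4 * L ^+ 6 * (s1 + s3 + s5).
  have LxE : (L * x) ^+ 3 = L ^+ 3 * x ^+ 3 by rewrite exprMn.
  have := cube _ _ A0 Lx0; rewrite LxE => c1.
  have g1 : L ^+ 3 * x ^+ 3 <= L ^+ 6 * (s3 + s5).
    by rewrite ler_pM ?exprn_ge0// ler_weXn2l.
  by move: A3 f2 c1 g1; rewrite -/v; goal_lra.
have f4 : v ^+ 6 <= 32 * L ^+ 6 * (s1 + s6 + s7).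
  have c1 : v ^+ 6 <= 32 * (A ^+ 6 + (L * x) ^+ 6).
    have := cube _ _ A0 Lx0; rewrite -/v => c0.
    have c2 : (v ^+ 3) ^+ 2 <= (4 * (A ^+ 3 + (L * x) ^+ 3)) ^+ 2.
      by rewrite lerXn2r ?nnegrE// ?exprn_ge0// mulr_ge0// addr_ge0 ?exprn_ge0.
    rewrite (exprM v 3 2) (exprM A 3 2) (exprM (L * x) 3 2).
    apply: le_trans c2 _; set a := A ^+ 3; set b := (L * x) ^+ 3.
    by have := sqr_ge0 (a - b); rewrite !exprS !expr0; goal_lra.
  have g1 : L ^+ 6 * x ^+ 6 <= L ^+ 6 * (s6 + s7) by rewrite ler_wpM2l ?exprn_ge0.
  have LxE : (L * x) ^+ 6 = L ^+ 6 * x ^+ 6 by rewrite exprMn.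
  by rewrite LxE in c1; move: A6 f2 c1 g1; goal_lra.
have vn : v * n <= L * (s8 + s9 + s5 + s10).
  rewrite /v mulrDl -mulrA -/s8.
  have := ler_wpM2l L0 e4; have : s8 <= L * s8 by rewrite -[leLHS]mul1r ler_wpM2r.
  lra.
have vh : v * h <= L * (2 * s1 + s4).
  rewrite /v mulrDl -mulrA.
  have := ler_wpM2l L0 e5; have : s1 <= L * s1 by rewrite -[leLHS]mul1r ler_wpM2r.
  lra.
have f5 : v * j <= 2 * L ^+ 6 * (s1 + s4 + s5 + s8 + s9 + s10).
  have g1 : v * j <= L * (v * n) + L ^+ 2 * (v * h).
    by have := ler_wpM2l v0 jL; rewrite expr2; goal_lra.
  have g2 := ler_wpM2l L0 vn.
  have g3 := ler_wpM2l (exprn_ge0 2 L0) vh.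
  have g4 : L * (L * (s8 + s9 + s5 + s10)) <= L ^+ 6 * (s8 + s9 + s5 + s10).
    by rewrite mulrA -expr2; apply: ler_wpM2r; [nonneg|exact: ler_weXn2l].
  have g5 : L ^+ 2 * (L * (2 * s1 + s4)) <= L ^+ 6 * (2 * s1 + s4).
    by rewrite mulrA -exprSr; apply: ler_wpM2r; [nonneg|exact: ler_weXn2l].
  have L6 : 0 <= L ^+ 6 by rewrite exprn_ge0.
  have := mulr_ge0 L6 p4; have := mulr_ge0 L6 p5; have := mulr_ge0 L6 p8.
  have := mulr_ge0 L6 p9; have := mulr_ge0 L6 p10.
  by move: g1 g2 g3 g4 g5; goal_lra.
set m := Num.min v 1.
have m0 : 0 <= m by rewrite /m le_min v0 ler01.
have mv : m <= v by rewrite /m ge_min lexx.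
have m1 : m <= 1 by rewrite /m ge_min lexx orbT.
have f6 : m * j ^+ 2 <= 4 * L ^+ 6 * (s1 + s5 + s8 + s9 + s10 + s11).
  have g1 : j ^+ 2 <= 2 * (L ^+ 2 * n ^+ 2 + L ^+ 4 * h ^+ 2).
    have j2 : j ^+ 2 <= (L * (n + h * L)) ^+ 2.
      by rewrite lerXn2r ?nnegrE// mulr_ge0// addr_ge0// mulr_ge0// ltW.
    by move: j2 (sqr_ge0 (L * n - L ^+ 2 * h)); rewrite !exprS !expr0; goal_lra.
  (* The expectation of [n ^+ 2] is only of order [h], and [n ^+ 2 = n + (n ^+ 2 - n)] isolates the
     part of that order. It gets the small factor [v]; for the other part, of order [h ^+ 2], the
     bound [m <= 1] is enough. *)
  have g2 : m * n ^+ 2 <= v * n + s11.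
    have -> : n ^+ 2 = n + s11 by rewrite /s11; ring.
    rewrite mulrDr lerD// ?ler_wpM2r// -[leRHS]mul1r ler_wpM2r//.
  have g3 : m * h ^+ 2 <= s1.
    by apply: le_trans hh; rewrite -[leRHS]mul1r ler_wpM2r ?sqr_ge0.
  have g4 := ler_wpM2l m0 g1.
  have g5 := ler_wpM2l (exprn_ge0 2 L0) g2.
  have g6 := ler_wpM2l (exprn_ge0 4 L0) g3.
  have g7 := ler_wpM2l (exprn_ge0 2 L0) vn.
  have g8 : L ^+ 2 * (L * (s8 + s9 + s5 + s10)) <= L ^+ 6 * (s8 + s9 + s5 + s10).
    by rewrite mulrA -exprSr; apply: ler_wpM2r; [nonneg|exact: ler_weXn2l].
  have g9 : L ^+ 2 * s11 <= L ^+ 6 * s11 by rewrite ler_wpM2r// ler_weXn2l.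
  have g10 : L ^+ 4 * s1 <= L ^+ 6 * s1 by rewrite ler_wpM2r// ler_weXn2l.
  have L6 : 0 <= L ^+ 6 by rewrite exprn_ge0.
  have := mulr_ge0 L6 p4; have := mulr_ge0 L6 p5; have := mulr_ge0 L6 p8.
  have := mulr_ge0 L6 p9; have := mulr_ge0 L6 p10; have := mulr_ge0 L6 p11.
  have := mulr_ge0 L6 p1.
  by move: g3 g4 g5 g6 g7 g8 g9 g10; goal_lra.
have L6 : 0 <= L ^+ 6 by rewrite exprn_ge0.
have q1 := mulr_ge0 L6 p1. have q2 := mulr_ge0 L6 p2. have q3 := mulr_ge0 L6 p3.
have q4 := mulr_ge0 L6 p4. have q5 := mulr_ge0 L6 p5. have q6 := mulr_ge0 L6 p6.
have q7 := mulr_ge0 L6 p7. have q8 := mulr_ge0 L6 p8. have q9 := mulr_ge0 L6 p9.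
have q10 := mulr_ge0 L6 p10. have q11 := mulr_ge0 L6 p11.
rewrite SE; move: f1 f2 f3 f4 f5 f6 q1 q2 q3 q4 q5 q6 q7 q8 q9 q10 q11; clear.
lra.
Qed.

End step_error.

Section one_step.
Context (R : realType) (dO : measure_display) (Omega : measurableType dO).
Variables (P : probability Omega R) (d p : nat).

(* [g] stands for a Brownian increment, [n] for compensated Poisson increments
   and [N] for a Poisson variable dominating the uncompensated ones; [g] and [n]
   are separately independent of [G], no joint independence is assumed. *)
Record noise (G : set (set Omega)) (h m2 Cg a : R) (c : 'I_p -> 'I_p -> R)
    (g : 'I_d -> Omega -> R) (n : 'I_p -> Omega -> R) (N : Omega -> R) : Prop := Noise {
  g_L1 : forall l, L1 P (g l);
  gg_L1 : forall l l', L1 P (fun w => g l w * g l' w);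
  g_mean : forall l U, bGm G U -> Ex P (fun w => U w * g l w) = 0;
  gg_cov : forall l l' U, bGm G U ->
    Ex P (fun w => U w * (g l w * g l' w)) = (l == l')%:R * (h * m2) * Ex P U;
  g4_L1 : forall l, L1 P (fun w => g l w ^+ 4);
  g8_L1 : forall l, L1 P (fun w => g l w ^+ 8);
  g4_le : forall l, Ex P (fun w => g l w ^+ 4) <= Cg * h ^+ 2;
  g8_le : forall l, Ex P (fun w => g l w ^+ 8) <= Cg * h ^+ 4;
  n_L1 : forall i, L1 P (n i);
  nn_L1 : forall i k, L1 P (fun w => n i w * n k w);
  n_mean : forall i U, bGm G U -> Ex P (fun w => U w * n i w) = 0;
  nn_cov : forall i k U, bGm G U ->
    Ex P (fun w => U w * (n i w * n k w)) = h * c i k * Ex P U;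
  N_L1 : L1 P N;
  N2_L1 : L1 P (fun w => N w ^+ 2);
  N_Ex : Ex P N = h * a;
  N2_Ex : Ex P (fun w => N w ^+ 2) = (h * a) ^+ 2 + h * a;
  N_nat : {ae P, forall w, 0 <= N w <= N w ^+ 2};
  n_le : {ae P, forall w, forall i, `|n i w| <= N w + h * a} }.

(** The generator expression of the overview for constant integrands. If [c i k] is the [nu]-measure
    of the intersection of the marks [i] and [k], the double sum is the integral of the squared
    simple jump integrand. *)
Definition bracket (r m2 : R) (c : 'I_p -> 'I_p -> R) (z be : 'cV[R]_d)
    (xi : 'M[R]_d) (eta : 'I_p -> 'cV[R]_d) : R :=
  let s := r ^+ 2 - dotv z z in
  - 6 * s ^+ 2 * dotv z be
  - 3 * s ^+ 2 * (m2 * enorm xi ^+ 2 + \sum_i \sum_k c i k * dotv (eta i) (eta k))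
  + 12 * m2 * s * enorm (xi^T *m z) ^+ 2.

Definition stepz (h : R) (z be : 'cV[R]_d) (xi : 'M[R]_d) (eta : 'I_p -> 'cV[R]_d)
    (g : 'I_d -> R) (n : 'I_p -> R) : 'cV[R]_d :=
  z + h *: be + xi *m (\col_l g l) + \sum_i n i *: eta i.

(** Ordered by monomials in the noise: each is multiplied by a factor known before the step, so that
    the expectation can be read off from the moments in [noise]. *)
Lemma main_term_expand (s h : R) (z be : 'cV[R]_d) (xi : 'M[R]_d)
    (eta : 'I_p -> 'cV[R]_d) (g : 'I_d -> R) (n : 'I_p -> R) :
  s ^+ 3 - 6 * s ^+ 2 * (dotv z (h *: be) + dotv z (xi *m (\col_l g l))
      + dotv z (\sum_i n i *: eta i))
    - 3 * s ^+ 2 * dotv (xi *m (\col_l g l)) (xi *m (\col_l g l))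
    - 3 * s ^+ 2 * dotv (\sum_i n i *: eta i) (\sum_i n i *: eta i)
    + 12 * s * dotv z (xi *m (\col_l g l)) ^+ 2 =
  s ^+ 3 - 6 * s ^+ 2 * h * dotv z be
  + \sum_l (- 6 * s ^+ 2 * (xi^T *m z) l 0) * g l
  + \sum_l \sum_l' (12 * s * ((xi^T *m z) l 0 * (xi^T *m z) l' 0)
       - 3 * s ^+ 2 * (xi^T *m xi) l l') * (g l * g l')
  + \sum_i (- 6 * s ^+ 2 * dotv z (eta i)) * n i
  + \sum_i \sum_k (- 3 * s ^+ 2 * dotv (eta i) (eta k)) * (n i * n k).
Proof.
have E1 : dotv z (xi *m (\col_l g l)) = \sum_l (xi^T *m z) l 0 * g l.
  by rewrite dotv_mulmx; apply: eq_bigr => l _; rewrite [(\col__ _) _ _]mxE.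
have E2 : dotv (xi *m (\col_l g l)) (xi *m (\col_l g l)) =
    \sum_l \sum_l' (xi^T *m xi) l l' * (g l * g l').
  rewrite dotv_mulmx mulmxA; apply: eq_bigr => l _.
  rewrite !mxE mulr_suml; apply: eq_bigr => l' _; rewrite !mxE; ring.
have E3 : dotv z (\sum_i n i *: eta i) = \sum_i dotv z (eta i) * n i.
  by rewrite dotv_sumr; apply: eq_bigr => i _; rewrite dotvZr mulrC.
have E4 : dotv (\sum_i n i *: eta i) (\sum_i n i *: eta i) =
    \sum_i \sum_k dotv (eta i) (eta k) * (n i * n k).
  rewrite dotv_suml; apply: eq_bigr => i _; rewrite dotvZl dotv_sumr mulr_sumr.
  by apply: eq_bigr => k _; rewrite dotvZr; ring.
have E5 : (\sum_l (xi^T *m z) l 0 * g l) ^+ 2 =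
    \sum_l \sum_l' ((xi^T *m z) l 0 * (xi^T *m z) l' 0) * (g l * g l').
  rewrite expr2 mulr_suml; apply: eq_bigr => l _; rewrite mulr_sumr.
  by apply: eq_bigr => l' _; ring.
rewrite E2 E4 E1 E3 E5 dotvZr.
have F1 : \sum_l - 6 * s ^+ 2 * (xi^T *m z) l 0 * g l =
   - 6 * s ^+ 2 * \sum_l (xi^T *m z) l 0 * g l.
  by rewrite mulr_sumr; apply: eq_bigr => l _; ring.
have F2 : \sum_l \sum_l' (12 * s * ((xi^T *m z) l 0 * (xi^T *m z) l' 0)
       - 3 * s ^+ 2 * (xi^T *m xi) l l') * (g l * g l') =
  12 * s * (\sum_l \sum_l' ((xi^T *m z) l 0 * (xi^T *m z) l' 0) * (g l * g l'))
  - 3 * s ^+ 2 * (\sum_l \sum_l' (xi^T *m xi) l l' * (g l * g l')).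
  rewrite !mulr_sumr -sumrB; apply: eq_bigr => l _.
  by rewrite !mulr_sumr -sumrB; apply: eq_bigr => l' _; ring.
have F3 : \sum_i - 6 * s ^+ 2 * dotv z (eta i) * n i =
   - 6 * s ^+ 2 * \sum_i dotv z (eta i) * n i.
  by rewrite mulr_sumr; apply: eq_bigr => l _; ring.
have F4 : \sum_i \sum_k - 3 * s ^+ 2 * dotv (eta i) (eta k) * (n i * n k) =
   - 3 * s ^+ 2 * \sum_i \sum_k dotv (eta i) (eta k) * (n i * n k).
  rewrite !mulr_sumr; apply: eq_bigr => l _.
  by rewrite !mulr_sumr; apply: eq_bigr => l' _; ring.
rewrite F1 F2 F3 F4; ring.
Qed.

Lemma sum_pow2_le (I : finType) (f : I -> R) :
  (\sum_i f i) ^+ 2 <= #|I|%:R * \sum_i f i ^+ 2.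
Proof.
have := sum_CauchySchwarz (fun _ : I => 1) f.
under eq_bigr do rewrite mul1r; move=> /le_trans; apply.
rewrite ler_wpM2r ?sumr_ge0// => [i _|]; first exact: sqr_ge0.
by rewrite (eq_bigr (fun=> 1)) ?sumr_const// => i _; rewrite expr1n.
Qed.

Lemma one_step_pathwise (r L : R) : 0 < r -> 1 <= L -> exists2 C : R, 0 <= C &
  forall (h B a N : R) (z be : 'cV[R]_d) (xi : 'M[R]_d) (eta : 'I_p -> 'cV[R]_d)
    (g : 'I_d -> R) (n : 'I_p -> R),
  let s := r ^+ 2 - dotv z z in
  let A := h * B in let t := (B ^+ 2)^-1 in
  0 < s -> 0 < h -> 1 <= B -> h * B ^+ 4 <= 1 -> 0 <= a <= L ->
  enorm be <= B -> enorm xi <= L -> (forall i, enorm (eta i) <= L) ->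
  0 <= N <= N ^+ 2 -> (forall i, `|n i| <= N + h * a) ->
  s ^+ 3 - 6 * s ^+ 2 * h * dotv z be
  + \sum_l (- 6 * s ^+ 2 * (xi^T *m z) l 0) * g l
  + \sum_l \sum_l' (12 * s * ((xi^T *m z) l 0 * (xi^T *m z) l' 0)
       - 3 * s ^+ 2 * (xi^T *m xi) l l') * (g l * g l')
  + \sum_i (- 6 * s ^+ 2 * dotv z (eta i)) * n i
  + \sum_i \sum_k (- 3 * s ^+ 2 * dotv (eta i) (eta k)) * (n i * n k)
  - C * (h / B + (A / t + t + h / t) * (\sum_l g l * g l)
      + (B / t + 1) * (d%:R * \sum_l g l ^+ 4) + d%:R ^+ 3 * (\sum_l g l ^+ 8)
       + (A + B^-1) * N + B * t * N ^+ 2 + (N ^+ 2 - N))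
  <= barrier r (stepz h z be xi eta g n).
Proof.
move=> r0 L1.
have [C1 C10 H1] := @barrier_step R d r r0.
(* The jump displacement is a sum of [p] terms, each of norm at most [L * (N + h * L)]; the factor
   [p] is absorbed into the constant. *)
set L' := (p%:R + 1) * L.
have p0 : 0 <= p%:R :> R by [].
have LL' : L <= L' by rewrite /L' mulrDl mul1r lerDr mulr_ge0//; lra.
have L'1 : 1 <= L' by apply: le_trans LL'.
have [C2 C20 H2] := step_error_bound L'1.
exists (C1 * C2); first exact: mulr_ge0.
move=> h B a N z be xi eta g n; cbv zeta => s0 h0 B1 hB /andP[a0 aL] beB xiL etaL /andP[N0 NN] nN.
set s := r ^+ 2 - dotv z z in s0 *.
set gv : 'cV_d := \col_l g l.
set J := \sum_i n i *: eta i.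
set x := enorm gv.
have x2 : x ^+ 2 = \sum_l g l * g l.
  by rewrite /x enorm_dotv; apply: eq_bigr => l _; rewrite !mxE.
have x4 : x ^+ 4 <= d%:R * \sum_l g l ^+ 4.
  rewrite (exprM x 2 2) x2; apply: le_trans (sum_pow2_le _) _; rewrite card_ord.
  rewrite le_eqVlt; apply/orP; left; apply/eqP; congr (_ * _).
  by apply: eq_bigr => l _; ring.
have x8 : x ^+ 8 <= d%:R ^+ 3 * \sum_l g l ^+ 8.
  rewrite (exprM x 4 2).
  apply: le_trans (_ : (d%:R * \sum_l g l ^+ 4) ^+ 2 <= _).
    rewrite lerXn2r ?nnegrE ?exprn_ge0 ?enorm_ge0// mulr_ge0// sumr_ge0// => l _.
    by rewrite (exprM _ 2 2) sqr_ge0.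
  rewrite exprMn; have := sum_pow2_le (fun l => g l ^+ 4); rewrite card_ord => e.
  have := ler_wpM2l (sqr_ge0 (d%:R : R)) e; rewrite mulrA => /le_trans; apply.
  rewrite [d%:R ^+ 3]exprSr -[leRHS]mulrA le_eqVlt; apply/orP; left.
  apply/eqP; congr (_ * (_ * _)).
  by apply: eq_bigr => l _; rewrite -exprM.
have x0 : 0 <= x by exact: enorm_ge0.
have L0 : 0 <= L by lra.
have L'0 : 0 <= L' by lra.
have uA : enorm (h *: be) <= h * B by rewrite enormZ gtr0_norm// ler_wpM2l// ltW.
have gG : enorm (xi *m gv) <= L' * x.
  by rewrite (le_trans (enorm_mulmx _ _))// ler_wpM2r//; exact: le_trans LL'.
have JL : enorm J <= L' * (N + h * L').
  apply: (@le_trans _ _ (\sum_i `|n i| * L)).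
    rewrite /J; elim/big_ind2: _ => [|u1 v1 u2 v2 h1 h2|i _]; first by rewrite enorm0.
      by rewrite (le_trans (enormD _ _))// lerD.
    by rewrite enormZ ler_wpM2l.
  apply: (@le_trans _ _ (\sum_(i < p) (N + h * L') * L)).
    apply: ler_sum => i _; rewrite ler_wpM2r// (le_trans (nN i))// lerD2l.
    by rewrite ler_wpM2l ?(ltW h0)//; exact: le_trans LL'.
  rewrite sumr_const card_ord -mulr_natr mulrAC [leRHS]mulrC -mulrA ler_wpM2l//.
    by rewrite addr_ge0// mulr_ge0// ltW.
  by rewrite /L' ler_wpM2r// lerDl.
have Lx0 : 0 <= L' * x by rewrite mulr_ge0.
have H3 := H1 z (h *: be) (xi *m gv) J (h * B) (L' * x) s0 uA gG.
rewrite -/s main_term_expand in H3.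
rewrite /stepz -/gv -/J; apply: le_trans H3.
rewrite lerD2l lerN2 -[C1 * C2 * _]mulrA ler_wpM2l//.
have := H2 h B x N (enorm J) h0 B1 hB x0 N0 NN (enorm_ge0 _) JL.
cbv zeta => /le_trans; apply; rewrite ler_wpM2l//.
rewrite -x2.
have B0 : 0 < B by lra.
have k0 : 0 <= B / B ^- 2 + 1.
  by rewrite addr_ge0// divr_ge0 ?invr_ge0 ?exprn_ge0// ltW.
have := ler_wpM2l k0 x4; lra.
Qed.

(** A predicate of its own, so that [C] is fixed before the step length, the truncation level and
    the data of the step. The indicator [chi] restricts to an event known before the step, on which
    [z] lies in the open ball. *)
Definition step_estimate (r L m2 Cg C : R) : Prop :=
  forall (G : set (set Omega)) (h B a : R) (c : 'I_p -> 'I_p -> R)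
    (g : 'I_d -> Omega -> R) (n : 'I_p -> Omega -> R) (N : Omega -> R)
    (chi : Omega -> R) (z be : Omega -> 'cV[R]_d) (xi : Omega -> 'M[R]_d)
    (eta : Omega -> 'I_p -> 'cV[R]_d),
  sub_sigma G -> 0 < h -> 1 <= B -> h * B ^+ 4 <= 1 -> 0 <= a <= L ->
  noise G h m2 Cg a c g n N ->
  bGm G chi -> (forall w, chi w = 0 \/ chi w = 1) ->
  (forall i, bGm G (fun w => z w i 0)) -> (forall i, bGm G (fun w => be w i 0)) ->
  (forall i k, bGm G (fun w => xi w i k)) ->
  (forall i k, bGm G (fun w => eta w i k 0)) ->
  (forall w, chi w = 1 -> 0 < r ^+ 2 - dotv (z w) (z w)) ->
  (forall w, enorm (be w) <= B) -> (forall w, enorm (xi w) <= L) ->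
  (forall w i, enorm (eta w i) <= L) ->
  Ex P (fun w => chi w * ((r ^+ 2 - dotv (z w) (z w)) ^+ 3
                 + h * bracket r m2 c (z w) (be w) (xi w) (eta w))) - C * (h / B)
  <= Ex P (fun w => chi w *
      barrier r (stepz h (z w) (be w) (xi w) (eta w) (g ^~ w) (n ^~ w))).

Lemma one_step (r L m2 Cg : R) : 0 < r -> 1 <= L -> 0 <= m2 -> 0 <= Cg ->
  exists2 C : R, 0 <= C & step_estimate r L m2 Cg C.
Proof.
move=> r0 Lge1 m20 Cg0.
have [C C0 H] := one_step_pathwise r0 Lge1.
(* The summands pay for the terms of [Q] below: the constant one, the second, fourth and eighth
   powers of the Brownian increment, and the Poisson terms. *)
set K := 1 + 3 * d%:R * m2 + 2 * d%:R ^+ 2 * Cg + d%:R ^+ 4 * Cg + 3 * L + 2 * L ^+ 2.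
exists (C * K).
  rewrite mulr_ge0// /K; have := ler0n R d; have L0 : 0 <= L by lra.
  by move=> d0; nonneg.
move=> G h B a c g n N chi z be xi eta sG h0 B1 hB aL nz bchi chi01 bz bbe bxi beta_ s0 beB xiL etaL.
have [a0 aL'] := andP aL.
pose s w := r ^+ 2 - dotv (z w) (z w).
have bdot (u v : Omega -> 'cV[R]_d) : (forall i, bGm G (fun w => u w i 0)) ->
    (forall i, bGm G (fun w => v w i 0)) -> bGm G (fun w => dotv (u w) (v w)).
  by move=> bu bv; apply: bGm_sum => i; exact: bGmM.
have bs : bGm G s by apply: bGmB; [exact: bGm_cst|exact: bdot].
have by_ l : bGm G (fun w => ((xi w)^T *m z w) l 0).
  under eq_fun do rewrite mxE; apply: bGm_sum => k.
  by under eq_fun do rewrite mxE; exact: bGmM.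
have bxx l l' : bGm G (fun w => ((xi w)^T *m xi w) l l').
  under eq_fun do rewrite mxE; apply: bGm_sum => k.
  by under eq_fun do rewrite mxE; exact: bGmM.
have bc k U : bGm G U -> bGm G (fun w => k * U w).
  by move=> bU; apply: bGmM => //; exact: bGm_cst.
pose U0 w := chi w * (s w ^+ 3 - 6 * s w ^+ 2 * h * dotv (z w) (be w)).
pose U1 l w := chi w * (- 6 * s w ^+ 2 * ((xi w)^T *m z w) l 0).
pose U2 l l' w := chi w * (12 * s w * (((xi w)^T *m z w) l 0 * ((xi w)^T *m z w) l' 0)
       - 3 * s w ^+ 2 * ((xi w)^T *m xi w) l l').
pose U3 i w := chi w * (- 6 * s w ^+ 2 * dotv (z w) (eta w i)).
pose U4 i k w := chi w * (- 3 * s w ^+ 2 * dotv (eta w i) (eta w k)).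
have bs2 : bGm G (fun w => s w ^+ 2) by exact: bGmX.
have b0 : bGm G U0.
  apply: bGmM => //; apply: bGmB; first exact: bGmX.
  apply: bGmM; last exact: bdot.
  by apply: bGmM; [exact: bc|exact: bGm_cst].
have b1 l : bGm G (U1 l).
  by apply: bGmM => //; apply: bGmM => //; exact: bc.
have b2 l l' : bGm G (U2 l l').
  apply: bGmM => //; apply: bGmB; first by apply: bGmM; [exact: bc|exact: bGmM].
  by apply: bGmM => //; exact: bc.
have b3 i : bGm G (U3 i).
  by apply: bGmM => //; apply: bGmM; [exact: bc|exact: bdot].
have b4 i k : bGm G (U4 i k).
  by apply: bGmM => //; apply: bGmM; [exact: bc|exact: bdot].
pose A := h * B. pose t := (B ^+ 2)^-1.
pose Q w := h / B + (A / t + t + h / t) * (\sum_l g l w * g l w)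
      + (B / t + 1) * (d%:R * \sum_l g l w ^+ 4) + d%:R ^+ 3 * (\sum_l g l w ^+ 8)
       + (A + B^-1) * N w + B * t * N w ^+ 2 + (N w ^+ 2 - N w).
pose M w := U0 w + \sum_l U1 l w * g l w + \sum_l \sum_l' U2 l l' w * (g l w * g l' w)
  + \sum_i U3 i w * n i w + \sum_i \sum_k U4 i k w * (n i w * n k w).
have i0 : L1 P U0 by exact: (bGm_L1 P sG).
have i1 l : L1 P (fun w => U1 l w * g l w) by apply: (bGm_L1M sG) => //; exact: (g_L1 nz).
have i2 l l' : L1 P (fun w => U2 l l' w * (g l w * g l' w)).
  by apply: (bGm_L1M sG) => //; exact: (gg_L1 nz).
have i3 i : L1 P (fun w => U3 i w * n i w) by apply: (bGm_L1M sG) => //; exact: (n_L1 nz).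
have i4 i k : L1 P (fun w => U4 i k w * (n i w * n k w)).
  by apply: (bGm_L1M sG) => //; exact: (nn_L1 nz).
have iS1 : L1 P (fun w => \sum_l U1 l w * g l w) by apply: L1_sum.
have iS2' l : L1 P (fun w => \sum_l' U2 l l' w * (g l w * g l' w)) by apply: L1_sum.
have iS2 : L1 P (fun w => \sum_l \sum_l' U2 l l' w * (g l w * g l' w)) by apply: L1_sum.
have iS3 : L1 P (fun w => \sum_i U3 i w * n i w) by apply: L1_sum.
have iS4' i : L1 P (fun w => \sum_k U4 i k w * (n i w * n k w)) by apply: L1_sum.
have iS4 : L1 P (fun w => \sum_i \sum_k U4 i k w * (n i w * n k w)) by apply: L1_sum.
have iM : L1 P M by do 4 (apply: L1D => //).
(* The linear terms have mean 0, the Brownian products survive on the diagonal only, and the Poisson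
   products give [h * c i k]; what is left is [h] times the bracket. *)
have EM : Ex P M = Ex P (fun w => chi w * (s w ^+ 3
                 + h * bracket r m2 c (z w) (be w) (xi w) (eta w))).
  rewrite /M !ExD//; do ?[by do 3 (apply: L1D => //) | by do 2 (apply: L1D => //) | by apply: L1D].
  rewrite !Ex_sum//.
  rewrite big1 => [|l _]; last exact: (g_mean nz).
  rewrite [X in _ + _ + _ + X + _]big1 => [|i _]; last exact: (n_mean nz).
  rewrite !addr0.
  under eq_bigr => l _.
    rewrite Ex_sum//; under eq_bigr => l' _ do rewrite (gg_cov nz)//.
    rewrite (bigD1 l)//= eqxx mul1r big1 ?addr0 => [|l' /negbTE]; last first.
      by rewrite eq_sym => ->; rewrite !mul0r.
  over.
  under [X in _ + X = _]eq_bigr => i _.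
    rewrite Ex_sum//; under eq_bigr => k _ do rewrite (nn_cov nz)//.
  over.
  have -> : \sum_l h * m2 * Ex P (U2 l l) = Ex P (fun w => \sum_l (h * m2) * U2 l l w).
    rewrite Ex_sum => [|l _]; last by apply: L1Z; exact: (bGm_L1 P sG).
    by apply: eq_bigr => l _; rewrite ExZ//; exact: (bGm_L1 P sG).
  have -> : \sum_i \sum_k h * c i k * Ex P (U4 i k) =
      Ex P (fun w => \sum_i \sum_k (h * c i k) * U4 i k w).
    rewrite Ex_sum => [|i _]; last by apply: L1_sum => k _; apply: L1Z; exact: (bGm_L1 P sG).
    apply: eq_bigr => i _.
    rewrite Ex_sum => [|k _]; last by apply: L1Z; exact: (bGm_L1 P sG).
    by apply: eq_bigr => k _; rewrite ExZ//; exact: (bGm_L1 P sG).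
  have j2 : L1 P (fun w => \sum_l (h * m2) * U2 l l w).
    by apply: L1_sum => l _; apply: L1Z; exact: (bGm_L1 P sG).
  have j4 : L1 P (fun w => \sum_i \sum_k (h * c i k) * U4 i k w).
    by do 2 (apply: L1_sum => ? _); apply: L1Z; exact: (bGm_L1 P sG).
  rewrite -!ExD//; last exact: L1D.
  apply: eq_Ex => w; rewrite /U0 /U2 /U4 /bracket -/(s w).
  have T2 : \sum_l (h * m2) * (chi w * (12 * s w * (((xi w)^T *m z w) l 0 * ((xi w)^T *m z w) l 0)
       - 3 * s w ^+ 2 * ((xi w)^T *m xi w) l l)) =
     chi w * h * m2 * (12 * s w * enorm ((xi w)^T *m z w) ^+ 2 - 3 * s w ^+ 2 * enorm (xi w) ^+ 2).
    have -> : enorm (xi w) ^+ 2 = \sum_l ((xi w)^T *m xi w) l l.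
      rewrite enorm_sqr exchange_big; apply: eq_bigr => l _; rewrite mxE.
      by apply: eq_bigr => k _; rewrite mxE expr2.
    rewrite enorm_dotv /dotv !mulr_sumr -sumrB mulr_sumr.
    by apply: eq_bigr => l _; ring.
  have T4 : \sum_i \sum_k (h * c i k) * (chi w * (- 3 * s w ^+ 2 * dotv (eta w i) (eta w k))) =
    chi w * h * (- 3 * s w ^+ 2) * \sum_i \sum_k c i k * dotv (eta w i) (eta w k).
    rewrite mulr_sumr; apply: eq_bigr => i _; rewrite mulr_sumr.
    by apply: eq_bigr => k _; ring.
  rewrite T2 T4; ring.
have B0 : 0 < B by lra.
have BB : 0 < B^-1 by rewrite invr_gt0.
have t0 : 0 < t by rewrite invr_gt0 exprn_gt0.
have A0 : 0 <= A by rewrite mulr_ge0// ltW.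
have jg2 : L1 P (fun w => \sum_l g l w * g l w) by apply: L1_sum => l _; exact: (gg_L1 nz).
have jg4 : L1 P (fun w => \sum_l g l w ^+ 4) by apply: L1_sum => l _; exact: (g4_L1 nz).
have jg8 : L1 P (fun w => \sum_l g l w ^+ 8) by apply: L1_sum => l _; exact: (g8_L1 nz).
have jN := N_L1 nz; have jN2 := N2_L1 nz.
have iQ : L1 P Q.
  rewrite /Q; do ! apply: L1D; do ? apply: L1Z; do ? apply: L1Z; do ? exact: L1N; rewrite //.
  exact: L1_cst.
have EQ : Ex P Q <= K * (h / B).
  have -> : Ex P Q = h / B + (A / t + t + h / t) * Ex P (fun w => \sum_l g l w * g l w)
      + (B / t + 1) * (d%:R * Ex P (fun w => \sum_l g l w ^+ 4))
      + d%:R ^+ 3 * Ex P (fun w => \sum_l g l w ^+ 8)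
       + (A + B^-1) * Ex P N + B * t * Ex P (fun w => N w ^+ 2) + (Ex P (fun w => N w ^+ 2) - Ex P N).
    have q1 := L1_cst P (h / B).
    have q2 := L1Z (A / t + t + h / t) jg2.
    have q3' := L1Z d%:R jg4. have q3 := L1Z (B / t + 1) q3'.
    have q4 := L1Z (d%:R ^+ 3) jg8. have q5 := L1Z (A + B^-1) jN.
    have q6 := L1Z (B * t) jN2. have q7 := L1B jN2 jN.
    have r2 := L1D q1 q2. have r3 := L1D r2 q3. have r4 := L1D r3 q4.
    have r5 := L1D r4 q5. have r6 := L1D r5 q6.
    rewrite /Q (ExD r6 q7) (ExD r5 q6) (ExD r4 q5) (ExD r3 q4) (ExD r2 q3) (ExD q1 q2).
    by rewrite Ex_cst !ExZ// ExB.
  have -> : Ex P (fun w => \sum_l g l w * g l w) = d%:R * (h * m2).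
    rewrite Ex_sum => [|l _]; last exact: (gg_L1 nz).
    rewrite (eq_bigr (fun=> h * m2)) => [|l _].
      by rewrite sumr_const card_ord [RHS]mulr_natl.
    have := gg_cov nz l l (bGm_cst G 1); rewrite eqxx mul1r.
    rewrite (Ex_cst P 1) mulr1 => <-; apply: eq_Ex => w; rewrite mul1r//.
  have e4 : Ex P (fun w => \sum_l g l w ^+ 4) <= d%:R * (Cg * h ^+ 2).
    rewrite Ex_sum => [|l _]; last exact: (g4_L1 nz).
    apply: (@le_trans _ _ (\sum_(l < d) Cg * h ^+ 2)).
      by apply: ler_sum => l _; exact: (g4_le nz).
    by rewrite sumr_const card_ord [leRHS]mulr_natl.
  have e8 : Ex P (fun w => \sum_l g l w ^+ 8) <= d%:R * (Cg * h ^+ 4).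
    rewrite Ex_sum => [|l _]; last exact: (g8_L1 nz).
    apply: (@le_trans _ _ (\sum_(l < d) Cg * h ^+ 4)).
      by apply: ler_sum => l _; exact: (g8_le nz).
    by rewrite sumr_const card_ord [leRHS]mulr_natl.
  rewrite (N_Ex nz) (N2_Ex nz).
  have d0 : 0 <= d%:R :> R by [].
  have L0 : 0 <= L by exact: le_trans ler01 Lge1.
  have Bi1 : B^-1 <= 1 by rewrite invf_le1.
  have tE : t = B^-1 ^+ 2 by rewrite exprVn.
  have tB : t <= B^-1 by rewrite tE expr2 -[leRHS]mulr1 ler_wpM2l// ltW.
  have hB' : h <= B^-1 ^+ 4.
    by rewrite -(@ler_pM2r _ (B ^+ 4)) ?exprn_gt0// -exprMn mulVf ?gt_eqF// expr1n.
  have Bk k : (0 < k)%N -> B^-1 ^+ k <= B^-1.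
    case: k => // k _; rewrite exprS -[leRHS]mulr1 ler_wpM2l ?(ltW BB)//.
    by rewrite exprn_ile1// ltW.
  (* From [h <= B^-4]: a power of [B] below the fourth leaves at least one factor [B^-1]. *)
  have hk k : (k < 4)%N -> h * B ^+ k <= B^-1.
    move=> k4; apply: le_trans (_ : B^-1 ^+ 4 * B ^+ k <= _).
      by rewrite ler_wpM2r ?exprn_ge0// ltW.
    apply: le_trans (Bk (4 - k)%N _); last by rewrite subn_gt0.
    rewrite -[in B^-1 ^+ 4](subnK (ltnW k4)) exprD -mulrA -exprMn mulVf ?gt_eqF//.
    by rewrite expr1n mulr1.
  have h3 : h * B ^+ 3 <= B^-1 by exact: hk.
  have h2 : h * B ^+ 2 <= B^-1 by exact: hk.
  have hA : A <= B^-1 by have := hk 1%N isT; rewrite expr1.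
  have h00 : h <= B^-1 by have := hk 0%N isT; rewrite expr0 mulr1.
  have h1 : h <= 1 by exact: le_trans Bi1.
  have AtE : A / t = h * B ^+ 3 by rewrite /A /t; field; rewrite gt_eqF.
  have htE : h / t = h * B ^+ 2 by rewrite /t; field; rewrite gt_eqF.
  have BtE : B / t = B ^+ 3 by rewrite /t; field; rewrite gt_eqF.
  have Bt2 : B * t = B^-1 by rewrite /t; field; rewrite gt_eqF.
  rewrite AtE htE BtE Bt2.
  have w1 : (h * B ^+ 3 + t + h * B ^+ 2) * (d%:R * (h * m2)) <= (3 * B^-1) * (d%:R * (h * m2)).
    by apply: ler_wpM2r; [nonneg|move: h3 tB h2; goal_lra].
  have w2 : (B ^+ 3 + 1) * (d%:R * Ex P (fun w => \sum_l g l w ^+ 4))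
     <= 2 * B^-1 * (d%:R ^+ 2 * Cg * h).
    apply: (@le_trans _ _ ((B ^+ 3 + 1) * (d%:R * (d%:R * (Cg * h ^+ 2))))).
      by apply: ler_wpM2l; [nonneg|apply: ler_wpM2l].
    have -> : (B ^+ 3 + 1) * (d%:R * (d%:R * (Cg * h ^+ 2))) =
      (h * B ^+ 3 + h) * (d%:R ^+ 2 * Cg * h) by ring.
    by apply: ler_wpM2r; [nonneg|move: h3 h00; goal_lra].
  have w3 : d%:R ^+ 3 * Ex P (fun w => \sum_l g l w ^+ 8) <= B^-1 * (d%:R ^+ 4 * Cg * h).
    apply: (@le_trans _ _ (d%:R ^+ 3 * (d%:R * (Cg * h ^+ 4)))).
      by apply: ler_wpM2l; nonneg.
    have -> : d%:R ^+ 3 * (d%:R * (Cg * h ^+ 4)) = h ^+ 3 * (d%:R ^+ 4 * Cg * h) by ring.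
    apply: ler_wpM2r; first by nonneg.
    apply: le_trans h00; rewrite exprS -[leRHS]mulr1 ler_wpM2l ?(ltW h0)//.
    by rewrite exprn_ile1// ltW.
  have w4 : (A + B^-1) * (h * a) <= 2 * B^-1 * (h * L).
    apply: ler_pM; [nonneg|nonneg|move: hA; goal_lra|].
    by apply: ler_wpM2l => //; exact: ltW.
  have ha : (h * a) ^+ 2 <= B^-1 * (h * L ^+ 2).
    have -> : (h * a) ^+ 2 = h * (h * a ^+ 2) by ring.
    apply: ler_pM; [nonneg|nonneg|exact: h00|].
    by apply: ler_wpM2l; [exact: ltW|rewrite lerXn2r ?nnegrE].
  have ha' : (h * a) ^+ 2 <= h * L ^+ 2.
    apply: le_trans ha _; rewrite -[leRHS]mul1r; apply: ler_wpM2r => //; nonneg.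
  have w5 : B^-1 * ((h * a) ^+ 2 + h * a) <= B^-1 * (h * L ^+ 2 + h * L).
    apply: ler_wpM2l; first exact: ltW.
    by apply: lerD => //; apply: ler_wpM2l => //; exact: ltW.
  by rewrite /K; move: w1 w2 w3 w4 w5 ha; goal_lra.
have Qae : {ae P, forall w, 0 <= Q w}.
  apply: filterS (N_nat nz) => w /andP[N0 NN].
  have Bt0 : 0 <= B * t by rewrite mulr_ge0// ltW.
  have t1 : 0 <= h / B by rewrite divr_ge0// ltW.
  have t2 : 0 <= (A / t + t + h / t) * \sum_l g l w * g l w.
    apply: mulr_ge0; last by rewrite sumr_ge0// => l _; rewrite -expr2 sqr_ge0.
    by rewrite !addr_ge0 ?divr_ge0// ltW.
  have t3 : 0 <= (B / t + 1) * (d%:R * \sum_l g l w ^+ 4).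
    apply: mulr_ge0; first by rewrite addr_ge0// divr_ge0// ltW.
    by rewrite mulr_ge0// sumr_ge0// => l _; rewrite (exprM _ 2 2) sqr_ge0.
  have t4 : 0 <= d%:R ^+ 3 * \sum_l g l w ^+ 8.
    by rewrite mulr_ge0 ?exprn_ge0// sumr_ge0// => l _; rewrite (exprM _ 4 2) sqr_ge0.
  have t5 : 0 <= (A + B^-1) * N w by rewrite mulr_ge0// addr_ge0// ltW.
  have t6 : 0 <= B * t * N w ^+ 2 by rewrite mulr_ge0// sqr_ge0.
  by rewrite /Q; move: t1 t2 t3 t4 t5 t6 N0 NN; goal_lra.
have iF : L1 P (fun w => chi w *
      barrier r (stepz h (z w) (be w) (xi w) (eta w) (g ^~ w) (n ^~ w))).
  apply: (bGm_L1M sG) => //; apply: (@L1_bounded _ _ _ _ _ (r ^+ 6)) => [|w]; last first.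
    by rewrite ger0_norm ?barrier_ge0// barrier_le.
  apply: measurable_funX; apply: measurable_maxr => //.
  apply: measurable_funB => //; apply: measurable_sum => i.
  have mz : measurable_fun setT (fun w => stepz h (z w) (be w) (xi w) (eta w) (g ^~ w) (n ^~ w) i 0).
    rewrite /stepz; under eq_fun do rewrite !mxE summxE.
    apply: measurable_funD.
      apply: measurable_funD.
        apply: measurable_funD; first by apply: (Gm_meas sG); case: (bz i).
        by apply: measurable_funM => //; apply: (Gm_meas sG); case: (bbe i).
      apply: measurable_sum => l; under eq_fun do rewrite mxE.
      apply: measurable_funM; last exact: L1_meas (g_L1 nz l).
      by apply: (Gm_meas sG); case: (bxi i l).
    apply: measurable_sum => k; under eq_fun do rewrite mxE.
    apply: measurable_funM; first exact: L1_meas (n_L1 nz k).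
    by apply: (Gm_meas sG); case: (beta_ k i).
  exact: measurable_funM.
have := EM; rewrite /s => <-.
apply: (@le_trans _ _ (Ex P (fun w => M w - C * Q w))).
  by rewrite ExB ?ExZ//; [rewrite lerD2l lerN2 -mulrA ler_wpM2l|exact: L1Z].
apply: Ex_ae_le => //; first by apply: L1B => //; exact: L1Z.
apply: filterS3 (N_nat nz) (n_le nz) Qae => w Nw nw Qw.
have ME : M w = chi w * (s w ^+ 3 - 6 * s w ^+ 2 * h * dotv (z w) (be w)
  + \sum_l (- 6 * s w ^+ 2 * ((xi w)^T *m z w) l 0) * g l w
  + \sum_l \sum_l' (12 * s w * (((xi w)^T *m z w) l 0 * ((xi w)^T *m z w) l' 0)
       - 3 * s w ^+ 2 * ((xi w)^T *m xi w) l l') * (g l w * g l' w)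
  + \sum_i (- 6 * s w ^+ 2 * dotv (z w) (eta w i)) * n i w
  + \sum_i \sum_k (- 3 * s w ^+ 2 * dotv (eta w i) (eta w k)) * (n i w * n k w)).
  do 4 rewrite [chi w * (_ + _)]mulrDr.
  rewrite /M; congr (_ + _ + _ + _ + _).
  - by rewrite mulr_sumr; apply: eq_bigr => l _; rewrite /U1; ring.
  - rewrite mulr_sumr; apply: eq_bigr => l _; rewrite mulr_sumr.
    by apply: eq_bigr => l' _; rewrite /U2; ring.
  - by rewrite mulr_sumr; apply: eq_bigr => l _; rewrite /U3; ring.
  - rewrite mulr_sumr; apply: eq_bigr => l _; rewrite mulr_sumr.
    by apply: eq_bigr => l' _; rewrite /U4; ring.
rewrite ME; have [c0|c1] := chi01 w.
  by rewrite c0 !mul0r sub0r oppr_le0 mulr_ge0.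
rewrite c1 !mul1r.
have := H h B a (N w) (z w) (be w) (xi w) (eta w) (g ^~ w) (n ^~ w).
by cbv zeta; apply => //; exact: s0.
Qed.

End one_step.

(** * Increments of the driving noises *)

Section borel_maps.
Context (R : realType).

Lemma continuous_borel_measurable (T : ptopologicalType) (f : T -> R) :
  continuous f -> measurable_fun [set: borel T] (f : borel T -> R).
Proof.
move=> cf; apply: (measurability (@RGenOInfty.G R)) => //.
  exact: RGenOInfty.measurableE.
move=> _ [_ [x ->] <-]; rewrite setTI; apply: sub_sigma_algebra.
by move/continuousP: cf; apply; exact: interval_open.
Qed.

Lemma entry_continuous m n (i : 'I_m) (j : 'I_n) :
  continuous (fun A : 'M[R]_(m, n) => A i j).
Proof. exact: coord_continuous. Qed.

End borel_maps.

Section noise_increments.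
Context (R : realType) (d : nat) (dU : measure_display) (U : measurableType dU).
Variable nu : {sigma_finite_measure set U -> \bar R}.
Context (dO : measure_display) (Omega : measurableType dO).
Variables (P : probability Omega R) (F : R -> set (set Omega)).
Hypothesis F_usual : usual_filtration P F.
Variables (W : R -> Omega -> 'cV[R]_d)
  (N : Omega -> {measure set (measurableTypeR R * U) -> \bar R}).
Hypothesis WN : driving_noises P F nu W N.

Let bmW : brownian_motion P F W. Proof. by case: WN. Qed.
Let prmN : poisson_random_measure P F nu N. Proof. by case: WN. Qed.

Lemma F_sub_sigma t : 0 <= t -> sub_sigma (F t).
Proof. by move=> t0; case: F_usual => h _ _ _; exact: h. Qed.

Lemma F_mono s t : 0 <= s -> s <= t -> F s `<=` F t.
Proof. by case: F_usual => _ h _ _; exact: h. Qed.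

Lemma Gm_mono s t (Y : Omega -> R) : 0 <= s -> s <= t -> Gm (F s) Y -> Gm (F t) Y.
Proof.
move=> s0 st; apply: Gm_sub; first exact: F_sub_sigma.
exact: F_mono.
Qed.

Lemma bGm_mono s t (Y : Omega -> R) : 0 <= s -> s <= t -> bGm (F s) Y -> bGm (F t) Y.
Proof. by move=> s0 st [mY bY]; split => //; exact: Gm_mono mY. Qed.

Lemma sigma_rv_entry (G : set (set Omega)) m n (Y : Omega -> 'M[R]_(m, n)) i j :
  sigma_rv Y `<=` G -> Gm G (fun w => Y w i j).
Proof.
move=> YG _ B mB; rewrite setTI; apply: sub_sigma_algebra; apply: YG.
exists ((fun A : 'M[R]_(m, n) => A i j) @^-1` B) => //.
have := @continuous_borel_measurable R 'M[R]_(m, n) _ (@entry_continuous R m n i j).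
by move=> /(_ measurableT B mB); rewrite setTI.
Qed.

Section increment.
Variables (a b : R).
Hypotheses (a0 : 0 <= a) (ab : a < b).
Let h := b - a.
Let h0 : 0 < h. Proof. by rewrite subr_gt0. Qed.
Let q := Num.sqrt h.
Let q0 : 0 < q. Proof. by rewrite sqrtr_gt0. Qed.
Let q2 : q ^+ 2 = h. Proof. by rewrite sqr_sqrtr// ltW. Qed.
Let b0 : 0 <= b. Proof. exact: le_trans a0 (ltW ab). Qed.

Definition dW (l : 'I_d) (w : Omega) : R := (W b w - W a w) l 0.

Lemma Gm_dW l : Gm (F b) (dW l).
Proof.
case: bmW => adW _ _ _ _.
rewrite /dW; under eq_fun do rewrite mxE [X in _ + X]mxE.
apply: measurable_funB; apply: sigma_rv_entry.
  exact: adW.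
by apply: subset_trans (adW a a0) _; apply: F_mono => //; exact: ltW.
Qed.

Let mdW l : measurable_fun setT (dW l).
Proof. by apply: (Gm_meas (F_sub_sigma b0)); exact: Gm_dW. Qed.

Let dW_joint (B : 'I_d -> set R) : (forall i, measurable (B i)) ->
  P [set w | forall i, B i (dW i w)] = (\prod_(i < d) normal_prob 0 q (B i))%E.
Proof. by move=> mB; case: bmW => _ _ _ _; apply. Qed.

(** The joint law is given on boxes; whole lines in the other coordinates isolate one coordinate
    here, and two of them in [dW_indep]. *)
Lemma dW_law l : normal_law P (dW l) q.
Proof.
move=> B mB.
pose B' i : set R := if i == l then B else setT.
have mB' i : measurable (B' i) by rewrite /B'; case: eqP.
have E := dW_joint mB'.
have Bl : B' l = B by rewrite /B' eqxx.
rewrite (bigD1 l)//= Bl big1 ?mule1 in E; last first.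
  by move=> i /negbTE il; rewrite /B' il; exact: probability_setT.
rewrite -E; congr (P _); apply/seteqP; split => [w Bw i|w /(_ l)]; last by rewrite Bl.
by rewrite /B'; case: eqP => [->|].
Qed.

Let dW_indep l l' : l != l' -> indep_rv P (dW l) (dW l').
Proof.
move=> ll A B mA mB.
pose C i : set R := if i == l then A else if i == l' then B else setT.
have : P [set w | forall i, C i (dW i w)] = (\prod_(i < d) normal_prob 0 q (C i))%E.
  by apply: dW_joint => i; rewrite /C; case: ifP => // _; case: ifP.
rewrite (bigD1 l)//= (bigD1 l')/=; last by rewrite eq_sym.
rewrite big1 ?mule1; last first.
  move=> i /andP[/negbTE il /negbTE il']; rewrite /C il il'; exact: probability_setT.
have -> : C l = A by rewrite /C eqxx.
have -> : C l' = B by rewrite /C eq_sym (negbTE ll) eqxx.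
move=> E; rewrite (dW_law l mA) (dW_law l' mB) -E; congr (P _).
apply/seteqP; split => [w /= [Aw Bw] i|w /= Cw].
  rewrite /C; case: eqP => [->//|_]; by case: eqP => [->|].
split; first by have := Cw l; rewrite /C eqxx.
by have := Cw l'; rewrite /C eq_sym (negbTE ll) eqxx.
Qed.

Let dW2_L1 l : L1 P (fun w => dW l w ^+ 2).
Proof. exact: (normal_law_L1X 1 q0 (mdW l) (@dW_law l)). Qed.

Let L1_mul (X Y : Omega -> R) : measurable_fun setT X -> measurable_fun setT Y ->
  L1 P (fun w => X w ^+ 2) -> L1 P (fun w => Y w ^+ 2) -> L1 P (fun w => X w * Y w).
Proof.
move=> mX mY iX iY; apply: (L1_le _ (L1D iX iY)); first exact: measurable_funM.
move=> w; rewrite ler_norml.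
have := sqr_ge0 (X w + Y w); have := sqr_ge0 (X w - Y w).
have := sqr_ge0 (X w); have := sqr_ge0 (Y w).
by rewrite !expr2 => *; apply/andP; split; lra.
Qed.

Let dWdW_L1 l l' : L1 P (fun w => dW l w * dW l' w).
Proof. by apply: L1_mul. Qed.

Let dW_Ex2 l l' : Ex P (fun w => dW l w * dW l' w) = (l == l')%:R * (h * nmom R 1).
Proof.
case: eqP => [<-|/eqP ll]; last first.
  rewrite mul0r indep_rv_Ex//; [|exact: dW_indep|exact: normal_law_L1 (@dW_law _)..].
  by rewrite (normal_law_Ex0 q0 (mdW l) (@dW_law l)) mul0r.
rewrite mul1r -q2 -(normal_law_ExX 1 q0 (mdW l) (@dW_law l)).
by apply: eq_Ex => w; rewrite muln1 expr2.
Qed.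

Let indepW (Y V : Omega -> R) (f : 'cV[R]_d -> R) : bGm (F a) Y -> L1 P V ->
  continuous f -> (V = fun w => f (W b w - W a w)) ->
  Ex P (fun w => Y w * V w) = Ex P Y * Ex P V.
Proof.
move=> bY iV cf VE.
have iH : indep P (F a) (sigma_rv (fun w => W b w - W a w)).
  by case: bmW => _ _ _ h' _; exact: h'.
apply: (indep_Ex (F_sub_sigma a0) iH) => // B mB.
exists (f @^-1` B); last by rewrite VE.
by have := continuous_borel_measurable cf measurableT mB; rewrite setTI.
Qed.

Section marks.
Implicit Types A : set U.

(** [N w] has extended real values and [fine] sends an infinite one to 0; for a mark of finite
    measure this concerns a null event only. *)
Definition cnt (A : set U) (w : Omega) : R := fine (N w (`]a, b] `*` A)).

Let strip A : set (measurableTypeR R * U) := `]a, b] `*` A.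

Let mstrip A : measurable A -> measurable (strip A).
Proof. by move=> mA; apply: measurableX => //; exact: measurable_itv. Qed.

Lemma intensity_strip A : measurable A -> (nu A < +oo)%E ->
  intensity nu (`]a, b] `*` A) = (h * fine (nu A))%:E.
Proof.
move=> mA nA; rewrite /intensity [LHS]product_measure1E//.
have -> : (h * fine (nu A))%:E = (h%:E * nu A)%E by rewrite EFinM fineK// ge0_fin_numE.
congr (_ * _)%E.
by have := @lebesgue_measure_itv R `]a, b]; rewrite /= lte_fin ab -EFinB.
Qed.

Lemma N_Gm A : measurable A ->
  measurable_fun [set: g_sigma_algebraType (F b)] (fun w => N w (`]a, b] `*` A)).
Proof.
move=> mA _ B mB; rewrite setTI; apply: sub_sigma_algebra.
case: prmN => adN _ _ _; apply: (adN b b0); apply: sub_sigma_algebra.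
exists (strip A), B; split => //; first exact: mstrip.
move=> [s u] /= [/andP[]]; rewrite !bnd_simp => as_ sb _; split => //; rewrite in_itv/= sb.
by rewrite andbT (le_trans a0)// ltW.
Qed.

Let mN A : measurable A -> measurable_fun setT (fun w => N w (strip A)).
Proof.
move=> mA _ B mB; rewrite setTI; apply: (F_sub_sigma b0).2.
have := N_Gm mA measurableT mB; rewrite setTI /measurable/=.
by rewrite /Measurable.sort /= (sigma_algebra_id (F_sub_sigma b0).1).
Qed.

Lemma Gm_cnt A : measurable A -> Gm (F b) (cnt A).
Proof. by move=> mA; apply: measurableT_comp (N_Gm mA); exact: fine_measurable. Qed.

Let mcnt A : measurable A -> measurable_fun setT (cnt A).
Proof. by move=> mA; apply: (Gm_meas (F_sub_sigma b0)); exact: Gm_cnt. Qed.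

Let lam A := h * fine (nu A).
Let lam0 A : 0 <= lam A.
Proof. by rewrite mulr_ge0 ?fine_ge0// ltW. Qed.

Let NlawE A k : measurable A -> (nu A < +oo)%E ->
  P [set w | N w (strip A) = (k%:R)%:E] = poisson_prob (lam A) 0 [set k].
Proof.
move=> mA nA; case: prmN => _ _ + _ => /(_ (strip A) (mstrip mA)).
rewrite intensity_strip// => ->//; last exact: ltry.
move=> [s u] /= [/andP[]]; rewrite !bnd_simp => as_ sb _; split => //; rewrite in_itv/= andbT.
by rewrite (le_trans a0)// ltW.
Qed.

(** The Poisson masses of the disjoint events [E k] add up to 1. *)
Lemma N_ae_nat A : measurable A -> (nu A < +oo)%E ->
  {ae P, forall w, exists k : nat, N w (`]a, b] `*` A) = (k%:R)%:E}.
Proof.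
move=> mA nA.
pose E k := [set w | N w (strip A) = (k%:R)%:E].
have mE k : measurable (E k).
  have -> : E k = (fun w => N w (strip A)) @^-1` [set (k%:R)%:E] by [].
  by rewrite -[X in measurable X]setTI; exact: (mN mA).
have tE : trivIset setT E.
  apply/trivIsetP => i j _ _ ij; apply/seteqP; split => // w /= [Ei Ej].
  by move: ij; rewrite -(eqr_nat R) -eqe -Ei -Ej eqxx.
have mD : measurable (\bigcup_k E k) by exact: bigcup_measurable.
have PD : P (\bigcup_k E k) = 1%E.
  rewrite measure_bigcup//.
  have := probability_setT (poisson_prob (lam A) 0).
  have -> : [set: nat] = \bigcup_k [set k].
    by apply/seteqP; split => // k _; exists k.
  rewrite measure_bigcup => [<-|//|]; last first.
    by apply/trivIsetP => i j _ _ ij; apply/seteqP; split => // k /= [-> /eqP]; rewrite (negbTE ij).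
  rewrite (@eq_eseriesl _ (fun i => i \in \bigcup_k [set k]) xpredT); last first.
    by move=> k; apply/mem_set; exists k.
  rewrite [RHS](@eq_eseriesl _ (fun i => i \in [set: nat]) xpredT); last first.
    by move=> k; rewrite in_setT.
  by apply: eq_eseriesr => k _; exact: NlawE.
exists (~` \bigcup_k E k); split; first exact: measurableC.
  by rewrite probability_setC// PD subee.
by move=> w /= Nw [k _ Ek]; apply: Nw; exists k.
Qed.

(** The events [cnt A w = k] and [N w (strip A) = k] can differ only where the value of [N] is not a
    natural number; for [k = 0] they do differ where it is infinite. *)
Lemma cnt_law A k : measurable A -> (nu A < +oo)%E ->
  P (cnt A @^-1` [set k%:R]) = poisson_prob (lam A) 0 [set k].
Proof.
move=> mA nA; rewrite -NlawE//.
have mS1 : measurable (cnt A @^-1` [set k%:R]).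
  by rewrite -[X in measurable X]setTI; exact: (mcnt mA).
have mS2 : measurable [set w | N w (strip A) = (k%:R)%:E].
  have -> : [set w | N w (strip A) = (k%:R)%:E] = (fun w => N w (strip A)) @^-1` [set (k%:R)%:E] by [].
  by rewrite -[X in measurable X]setTI; exact: (mN mA).
have /negligibleP := N_ae_nat mA nA.
have [D [mD D0 sD]] := N_ae_nat mA nA => _.
rewrite (measureDI P mS1 mD) (measureDI P mS2 mD).
rewrite [X in (_ + X)%E](_ : _ = 0%E); last first.
  by apply/eqP; rewrite eq_le measure_ge0 andbT -D0 le_measure ?inE//; exact: measurableI.
rewrite [X in _ = (_ + X)%E](_ : _ = 0%E); last first.
  by apply/eqP; rewrite eq_le measure_ge0 andbT -D0 le_measure ?inE//; exact: measurableI.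
congr (P _ + _)%E; apply/seteqP; split => w [/= Zk Dw]; split => //.
  have [k' Nk'] : exists k' : nat, N w (`]a, b] `*` A) = (k'%:R)%:E.
    by apply: contrapT => h'; apply: Dw; apply: sD.
  by move: Zk; rewrite /cnt /strip Nk'/= => ->.
by rewrite /cnt -/(strip A) Zk.
Qed.

Let cnt_L1 A : measurable A -> (nu A < +oo)%E -> L1 P (cnt A).
Proof. by move=> mA nA; apply: (poisson_L1 (mcnt mA) (lam0 A)) => k; exact: cnt_law. Qed.

Let cnt2_L1 A : measurable A -> (nu A < +oo)%E -> L1 P (fun w => cnt A w ^+ 2).
Proof. by move=> mA nA; apply: (poisson_L1X2 (mcnt mA) (lam0 A)) => k; exact: cnt_law. Qed.

Let cnt_Ex A : measurable A -> (nu A < +oo)%E -> Ex P (cnt A) = lam A.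
Proof. by move=> mA nA; apply: (poisson_Ex (mcnt mA) (lam0 A)) => k; exact: cnt_law. Qed.

Let cnt2_Ex A : measurable A -> (nu A < +oo)%E ->
  Ex P (fun w => cnt A w ^+ 2) = lam A ^+ 2 + lam A.
Proof. by move=> mA nA; apply: (poisson_ExX2 (mcnt mA) (lam0 A)) => k; exact: cnt_law. Qed.

Let indepN (Y : Omega -> R) (A : set U) (f : R -> R) : bGm (F a) Y -> measurable A ->
  measurable_fun setT f -> L1 P (fun w => f (cnt A w)) ->
  Ex P (fun w => Y w * f (cnt A w)) = Ex P Y * Ex P (fun w => f (cnt A w)).
Proof.
move=> bY mA mf iV.
have iH : indep P (F a) (sigma_prm N (`]a, +oo[ `*` setT)).
  by case: prmN => _ h' _ _; exact: h'.
apply: (indep_Ex (F_sub_sigma a0) iH) => // B mB.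
apply: sub_sigma_algebra; exists (strip A), ((f \o fine) @^-1` B); split => //.
- exact: mstrip.
- by move=> [s u] /= [/andP[]]; rewrite !bnd_simp => as_ sb _; split => //; rewrite in_itv/= andbT.
- rewrite -[X in measurable X]setTI; apply: measurableT_comp => //.
Qed.

Let cnt_setU A B : measurable A -> measurable B -> (nu A < +oo)%E -> (nu B < +oo)%E ->
  [disjoint A & B] -> {ae P, forall w, cnt (A `|` B) w = cnt A w + cnt B w}.
Proof.
move=> mA mB nA nB AB.
apply: filterS2 (N_ae_nat mA nA) (N_ae_nat mB nB) => w [k Nk] [l Nl].
have -> : cnt (A `|` B) w = fine (N w (strip A `|` strip B)).
  rewrite /cnt; congr (fine (N w _)); apply/seteqP.
  by split => -[s u] /=; [move=> [? []] ?; [left|right]|move=> [] []; split => //; [left|right]].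
rewrite measureU; [|exact: mstrip|exact: mstrip|].
  rewrite /cnt /strip [X in (X + _)%E]Nk [X in (_ + X)%E]Nl [in RHS]Nk [in RHS]Nl.
  by [].
move/disj_setPS: AB => AB.
by apply/seteqP; split => // -[s u] /= [[_ Au] [_ Bu]]; apply: (AB u).
Qed.

Let nuI A B : measurable A -> measurable B -> (nu A < +oo)%E -> (nu (A `&` B) < +oo)%E.
Proof.
move=> mA mB; apply: le_lt_trans; rewrite le_measure ?inE//; exact: measurableI.
Qed.

Let nuD A B : measurable A -> measurable B -> (nu A < +oo)%E -> (nu (A `\` B) < +oo)%E.
Proof.
move=> mA mB; apply: le_lt_trans; rewrite le_measure ?inE//; exact: measurableD.
Qed.

Let lamU A B : measurable A -> measurable B -> (nu A < +oo)%E -> (nu B < +oo)%E ->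
  [disjoint A & B] -> lam (A `|` B) = lam A + lam B.
Proof.
move=> mA mB nA nB AB; rewrite /lam -mulrDr measureU//; last exact/eqP.
by rewrite fineD// ge0_fin_numE.
Qed.

(** Polarization: with counts [c], [d], [e] of the disjoint sets [C], [D], [E] below, [2 (c + e) (d
    + e) = (c + d + e)^2 - c^2 - d^2 + e^2]. Only the second moment of a single count, independent
    of the past, is then required. *)
Lemma cnt_cov A B (Y : Omega -> R) : measurable A -> measurable B ->
  (nu A < +oo)%E -> (nu B < +oo)%E -> bGm (F a) Y ->
  Ex P (fun w => Y w * (cnt A w * cnt B w)) =
  (lam A * lam B + lam (A `&` B)) * Ex P Y.
Proof.
move=> mA mB nA nB bY.
have dAB : [disjoint A `\` B & A `&` B].
  by apply/disj_setPS => u [[_ nBu] [_ Bu]].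
have dBA : [disjoint B `\` A & A `&` B].
  by apply/disj_setPS => u [[_ nAu] [Au _]].
have dCD : [disjoint A `\` B & B `\` A].
  by apply/disj_setPS => u [[_ nBu] [Bu _]].
have dCDE : [disjoint (A `\` B) `|` (B `\` A) & A `&` B].
  by apply/disj_setPS => u [[[_ nBu] | [_ nAu]] [Au Bu]].
have AE : A = (A `\` B) `|` (A `&` B) by rewrite setUC setUIDK.
have BE : B = (B `\` A) `|` (A `&` B) by rewrite [A `&` B]setIC setUC setUIDK.
set C := A `\` B in dAB dCD dCDE AE; set D := B `\` A in dBA dCD dCDE BE.
set E := A `&` B in dAB dBA dCDE AE BE *.
have mC : measurable C by exact: measurableD.
have mD : measurable D by exact: measurableD.
have mE : measurable E by exact: measurableI.
have nC : (nu C < +oo)%E by exact: nuD.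
have nD : (nu D < +oo)%E by exact: nuD.
have nE : (nu E < +oo)%E by exact: nuI.
have mCD : measurable (C `|` D) by exact: measurableU.
have nCD : (nu (C `|` D) < +oo)%E.
  by rewrite measureU//; [exact: lte_add_pinfty|exact/eqP].
pose T := (C `|` D) `|` E.
have mT : measurable T by exact: measurableU.
have nT : (nu T < +oo)%E.
  by rewrite measureU//; [exact: lte_add_pinfty|exact/eqP].
have mX2 : measurable_fun setT (fun x : R => x ^+ 2) by exact: measurable_funX.
have H X : measurable X -> (nu X < +oo)%E ->
    Ex P (fun w => Y w * cnt X w ^+ 2) = (lam X ^+ 2 + lam X) * Ex P Y.
  move=> mX nX; rewrite (indepN bY mX mX2); last exact: cnt2_L1.
  by rewrite cnt2_Ex// mulrC.
have iH X : measurable X -> (nu X < +oo)%E -> L1 P (fun w => Y w * cnt X w ^+ 2).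
  by move=> mX nX; apply: (bGm_L1M (F_sub_sigma a0)) => //; exact: cnt2_L1.
have lA : lam A = lam C + lam E by rewrite AE lamU.
have lB : lam B = lam D + lam E by rewrite BE lamU.
have lT : lam T = lam C + lam D + lam E by rewrite /T !lamU.
transitivity (Ex P (fun w => 2^-1 * (Y w * cnt T w ^+ 2 - Y w * cnt C w ^+ 2
    - Y w * cnt D w ^+ 2 + Y w * cnt E w ^+ 2))).
  apply: Ex_ae_eq.
  - by apply: (bGm_L1M (F_sub_sigma a0)) => //; apply: L1_mul; rewrite //; first [exact: mcnt|exact: cnt2_L1].
  - by apply: L1Z; apply: L1D; [apply: L1B; [apply: L1B|]|]; exact: iH.
  have u1 := cnt_setU mC mE nC nE dAB; have u2 := cnt_setU mD mE nD nE dBA.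
  have u3 := cnt_setU mCD mE nCD nE dCDE; have u4 := cnt_setU mC mD nC nD dCD.
  rewrite -AE in u1; rewrite -BE in u2.
  apply: filterS2 (filterI u1 u2) (filterI u3 u4) => w [-> ->] [-> ->].
  by field.
rewrite ExZ; last by apply: L1D; [apply: L1B; [apply: L1B|]|]; exact: iH.
rewrite ExD; [|by apply: L1B; [apply: L1B|]; exact: iH|exact: iH].
rewrite ExB; [|by apply: L1B; exact: iH|exact: iH].
rewrite ExB; [|exact: iH|exact: iH].
rewrite !H// lT lA lB; by field.
Qed.

Variables (p : nat) (A : 'I_p -> set U) (At : set U).
Hypotheses (mA : forall i, measurable (A i)) (mAt : measurable At)
  (nAt : (nu At < +oo)%E) (AAt : forall i, A i `<=` At).

Let nA i : (nu (A i) < +oo)%E.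
Proof. by apply: le_lt_trans nAt; rewrite le_measure ?inE. Qed.

Definition comp_incr (i : 'I_p) (w : Omega) : R :=
  compensated nu N w (`]a, b] `*` A i).

Let comp_incrE i w : comp_incr i w = cnt (A i) w - lam (A i).
Proof. by rewrite /comp_incr /compensated intensity_strip. Qed.

Lemma Gm_comp_incr i : Gm (F b) (comp_incr i).
Proof.
have -> : comp_incr i = fun w => cnt (A i) w - lam (A i) by apply/funext => w; exact: comp_incrE.
by apply: measurable_funB => //; exact: Gm_cnt.
Qed.

(** The set [At] contains all marks, so its count dominates each of theirs. The sum
    [nmom R 2 + nmom R 4] serves as one constant for both the fourth and the eighth Brownian
    moments. *)
Lemma noise_increment :
  noise P (F a) h (nmom R 1) (nmom R 2 + nmom R 4) (fine (nu At))
    (fun i k => fine (nu (A i `&` A k))) dW comp_incr (cnt At).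
Proof.
have idY (Y : Omega -> R) : bGm (F a) Y -> L1 P Y by exact: (bGm_L1 P (F_sub_sigma a0)).
have mid : measurable_fun setT (fun x : R => x) by exact: measurable_id.
have n_L1 i : L1 P (comp_incr i).
  have -> : comp_incr i = fun w => cnt (A i) w - lam (A i) by apply/funext => w; exact: comp_incrE.
  by apply: L1B; [exact: cnt_L1|exact: L1_cst].
have cc_L1 i k : L1 P (fun w => cnt (A i) w * cnt (A k) w).
  by apply: L1_mul; first [exact: mcnt|exact: cnt2_L1].
have nnE i k w : comp_incr i w * comp_incr k w = cnt (A i) w * cnt (A k) w
    - lam (A i) * cnt (A k) w - lam (A k) * cnt (A i) w + lam (A i) * lam (A k).
  by rewrite !comp_incrE; ring.
have Yc_Ex i (Y : Omega -> R) : bGm (F a) Y ->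
    Ex P (fun w => Y w * cnt (A i) w) = lam (A i) * Ex P Y.
  move=> bY; rewrite (indepN bY (mA i) mid); last exact: cnt_L1.
  by rewrite cnt_Ex// mulrC.
have q4 : q ^+ 4 = h ^+ 2 by rewrite (exprM q 2 2) q2.
have q8 : q ^+ 8 = h ^+ 4 by rewrite (exprM q 2 4) q2.
split.
- by move=> l; exact: normal_law_L1 q0 (mdW l) (@dW_law l).
- exact: dWdW_L1.
- move=> l Y bY; rewrite (indepW bY _ (f := fun x => x l 0))//.
  + by rewrite (normal_law_Ex0 q0 (mdW l) (@dW_law l)) mulr0.
  + exact: normal_law_L1 q0 (mdW l) (@dW_law l).
  + exact: entry_continuous.
- move=> l l' Y bY; rewrite (indepW bY _ (f := fun x => x l 0 * x l' 0))//.
  + by rewrite dW_Ex2 mulrC.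
  + move=> x; apply: continuousM; exact: entry_continuous.
- by move=> l; exact: (normal_law_L1X 2 q0 (mdW l) (@dW_law l)).
- by move=> l; exact: (normal_law_L1X 4 q0 (mdW l) (@dW_law l)).
- move=> l; rewrite (normal_law_ExX 2 q0 (mdW l) (@dW_law l)) q4 mulrC.
  by rewrite ler_wpM2r ?sqr_ge0// lerDl nmom_ge0.
- move=> l; rewrite (normal_law_ExX 4 q0 (mdW l) (@dW_law l)) q8 mulrC.
  by rewrite ler_wpM2r ?exprn_ge0 ?(ltW h0)// lerDr nmom_ge0.
- exact: n_L1.
- move=> i k; under eq_fun do rewrite nnE.
  apply: L1D; last exact: L1_cst.
  by apply: L1B; [apply: L1B => //|]; apply: L1Z; exact: cnt_L1.
- move=> i Y bY.
  transitivity (Ex P (fun w => Y w * cnt (A i) w - lam (A i) * Y w)).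
    by apply: eq_Ex => w; rewrite comp_incrE; ring.
  rewrite ExB; [|by apply: (bGm_L1M (F_sub_sigma a0)) => //; exact: cnt_L1|by apply: L1Z; exact: idY].
  by rewrite Yc_Ex// ExZ ?subrr//; exact: idY.
- move=> i k Y bY.
  have i1 : L1 P (fun w => Y w * (cnt (A i) w * cnt (A k) w)).
    exact: (bGm_L1M (F_sub_sigma a0)).
  have i2 j : L1 P (fun w => Y w * cnt (A j) w).
    by apply: (bGm_L1M (F_sub_sigma a0)) => //; exact: cnt_L1.
  transitivity (Ex P (fun w => Y w * (cnt (A i) w * cnt (A k) w)
      - lam (A i) * (Y w * cnt (A k) w) - lam (A k) * (Y w * cnt (A i) w)
      + lam (A i) * lam (A k) * Y w)).
    by apply: eq_Ex => w; rewrite nnE; ring.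
  rewrite ExD; [|by apply: L1B; [apply: L1B => //|]; exact: L1Z|by apply: L1Z; exact: idY].
  rewrite ExB; [|by apply: L1B => //; exact: L1Z|exact: L1Z].
  rewrite ExB//; last exact: L1Z.
  rewrite !ExZ//; last exact: idY.
  by rewrite !Yc_Ex// cnt_cov// /lam; ring.
- exact: cnt_L1.
- exact: cnt2_L1.
- exact: cnt_Ex.
- by rewrite cnt2_Ex.
- have := poisson_ae_nat (mcnt mAt) (lam0 At) (fun k => cnt_law k mAt nAt).
  apply: filterS => w [k ->]; rewrite ler0n/= -natrX ler_nat.
  by case: k => // k; rewrite expnS expn1 leq_pmull.
- have : {ae P, forall w, forall i, cnt (A i) w <= cnt At w}.
    have [D [mD D0 sD]] := N_ae_nat mAt nAt.
    exists D; split => // w /= nw; apply: sD => /= -[k Nk]; apply: nw => i.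
    have le : (N w (`]a, b] `*` A i) <= N w (`]a, b] `*` At))%E.
      rewrite le_measure ?inE//; [exact: mstrip|exact: mstrip|].
      by move=> [s u] /= [? /AAt].
    rewrite /cnt fine_le// ?Nk// ge0_fin_numE//.
    by rewrite (le_lt_trans le)// Nk ltry.
  apply: filterS => w cw i; rewrite comp_incrE.
  have c0 : 0 <= cnt (A i) w by rewrite fine_ge0.
  have lle : lam (A i) <= lam At.
    rewrite ler_wpM2l ?(ltW h0)// fine_le ?ge0_fin_numE// le_measure ?inE//.
  have := cw i; have := lam0 (A i); rewrite -/(lam At) ler_norml => *.
  by apply/andP; split; lra.
Qed.

End marks.
End increment.
End noise_increments.

(** * Iteration along a grid *)

Section Gm_algebra.
Context (R : realType) (d : measure_display) (T : measurableType d).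
Variable G : set (set T).
Implicit Types U V X Y : T -> R.

Lemma Gm_cst (k : R) : Gm G (fun=> k).
Proof. exact: measurable_cst. Qed.

Lemma GmD U V : Gm G U -> Gm G V -> Gm G (fun w => U w + V w).
Proof. exact: measurable_funD. Qed.

Lemma GmM U V : Gm G U -> Gm G V -> Gm G (fun w => U w * V w).
Proof. exact: measurable_funM. Qed.

Lemma GmB U V : Gm G U -> Gm G V -> Gm G (fun w => U w - V w).
Proof. exact: measurable_funB. Qed.

Lemma GmN U : Gm G U -> Gm G (fun w => - U w).
Proof. by move=> mU; apply: measurableT_comp. Qed.

Lemma GmX U k : Gm G U -> Gm G (fun w => U w ^+ k).
Proof. exact: measurable_funX. Qed.

Lemma Gm_sum I (s : seq I) (U : I -> T -> R) :
  (forall i, Gm G (U i)) -> Gm G (fun w => \sum_(i <- s) U i w).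
Proof. exact: measurable_sum. Qed.

Lemma Gm_posp U : Gm G U -> Gm G (fun w => posp (U w)).
Proof. by move=> mU; apply: measurable_maxr => //; exact: measurable_cst. Qed.

Lemma Gm_if_lt U V X Y : Gm G U -> Gm G V -> Gm G X -> Gm G Y ->
  Gm G (fun w => if U w < V w then X w else Y w).
Proof. by move=> mU mV mX mY; apply: measurable_fun_ifT => //; exact: measurable_fun_ltr. Qed.

Lemma Gm_if_le U V X Y : Gm G U -> Gm G V -> Gm G X -> Gm G Y ->
  Gm G (fun w => if U w <= V w then X w else Y w).
Proof. by move=> mU mV mX mY; apply: measurable_fun_ifT => //; exact: measurable_fun_ler. Qed.

End Gm_algebra.

Section tube.
Context (R : realType) (d p : nat) (dO : measure_display) (Omega : measurableType dO).
Variables (P : probability Omega R) (G : nat -> set (set Omega)).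
Hypotheses (sG : forall j, sub_sigma (G j)) (GS : forall j, G j `<=` G j.+1).
Variables (t : nat -> R) (r L m2 Cg C a B kap eps : R) (c : 'I_p -> 'I_p -> R).
Variables (g : nat -> 'I_d -> Omega -> R) (n : nat -> 'I_p -> Omega -> R)
  (Nt : nat -> Omega -> R).
Variables (be : nat -> Omega -> 'cV[R]_d) (xi : nat -> Omega -> 'M[R]_d)
  (eta : nat -> Omega -> 'I_p -> 'cV[R]_d).

Let h j := t j.+1 - t j.

Hypotheses (HC : step_estimate P d p r L m2 Cg C) (r0 : 0 < r).
Hypotheses (C0 : 0 <= C) (kap0 : 0 <= kap) (eps0 : 0 <= eps).
Hypotheses (t0 : t 0 = 0) (tS : forall j, t j <= t j.+1).
Hypotheses (B1 : 1 <= B) (hB : forall j, h j * B ^+ 4 <= 1).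
Hypotheses (aL : 0 <= a <= L) (hkap : forall j, kap * h j <= 2^-1).
Hypothesis nz : forall j, 0 < h j -> noise P (G j) (h j) m2 Cg a c (g j) (n j) (Nt j).
Hypotheses (gh0 : forall j l w, h j = 0 -> g j l w = 0)
  (nh0 : forall j i w, h j = 0 -> n j i w = 0).
Hypotheses (mg : forall j l, Gm (G j.+1) (g j l)) (mn : forall j i, Gm (G j.+1) (n j i)).
Hypotheses (bbe : forall j i, bGm (G j) (fun w => be j w i 0))
  (bxi : forall j i k, bGm (G j) (fun w => xi j w i k))
  (beta_ : forall j i k, bGm (G j) (fun w => eta j w i k 0)).
Hypotheses (beB : forall j w, enorm (be j w) <= B) (xiL : forall j w, enorm (xi j w) <= L)
  (etaL : forall j w i, enorm (eta j w i) <= L).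

Fixpoint tube (j : nat) (w : Omega) : 'cV[R]_d :=
  if j is j'.+1 then
    stepz (h j') (tube j' w) (be j' w) (xi j' w) (eta j' w) (g j' ^~ w) (n j' ^~ w)
  else 0.

(** Outside the open ball nothing can be lost: the barrier is 0 there, and its next value is
    nonnegative. *)
Definition deficit (j : nat) (w : Omega) : R :=
  let s := r ^+ 2 - dotv (tube j w) (tube j w) in
  if 0 < s then
    h j * posp (- (bracket r m2 c (tube j w) (be j w) (xi j w) (eta j w) + kap * s ^+ 3))
  else 0.

(** The sum includes the deficit of step [j] itself, which involves only the position and the
    integrands at the start of that step. Hence [alive j] is [G j]-measurable and may enter the
    event [chi] of the one-step estimate. *)
Definition alive (j : nat) (w : Omega) : R :=
  if \sum_(i < j.+1) deficit i w <= eps then 1 else 0.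

Let h0 j : 0 <= h j. Proof. by rewrite subr_ge0. Qed.

Let deficit_ge0 j w : 0 <= deficit j w.
Proof. by rewrite /deficit; case: ifP => // _; rewrite mulr_ge0// posp_ge0. Qed.

Let deficit_h0 j w : h j = 0 -> deficit j w = 0.
Proof. by rewrite /deficit => ->; rewrite mul0r if_same. Qed.

Let alive01 j w : alive j w = 0 \/ alive j w = 1.
Proof. by rewrite /alive; case: ifP; [right|left]. Qed.

Let alive_ge0 j w : 0 <= alive j w.
Proof. by case: (alive01 j w) => ->. Qed.

Let alive_le1 j w : alive j w <= 1.
Proof. by case: (alive01 j w) => ->. Qed.

Let aliveS j w : alive j.+1 w <= alive j w.
Proof.
rewrite {1}/alive; case: ifP => // le1.
rewrite /alive ifT// (le_trans _ le1)// [leRHS]big_ord_recr/= lerDl.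
exact: deficit_ge0.
Qed.

(** Holds path by path: a term counts only if the whole sum up to and including it is at most [eps].
    The induction also carries the comparison with the full sum of deficits. *)
Let alive_deficit m w : \sum_(i < m) alive i w * deficit i w <= eps.
Proof.
suff : \sum_(i < m) alive i w * deficit i w <= eps /\
       \sum_(i < m) alive i w * deficit i w <= \sum_(i < m) deficit i w by case.
elim: m => [|m [IH1 IH2]]; first by rewrite !big_ord0.
rewrite big_ord_recr/= [X in _ /\ _ <= X]big_ord_recr/=.
have dm := deficit_ge0 m w.
rewrite {2 4}/alive; case: ifP => [le1|_].
  by move: le1; rewrite big_ord_recr/= => le1; rewrite mul1r; split; lra.
by rewrite mul0r addr0; split => //; lra.
Qed.

Let mG_sub j (X : Omega -> R) : Gm (G j) X -> Gm (G j.+1) X.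
Proof. by apply: (Gm_sub (sG j)); exact: GS. Qed.

Let mdotv j (u v : Omega -> 'cV[R]_d) : (forall i, Gm (G j) (fun w => u w i 0)) ->
  (forall i, Gm (G j) (fun w => v w i 0)) -> Gm (G j) (fun w => dotv (u w) (v w)).
Proof. by move=> mu mv; apply: Gm_sum => i; exact: GmM. Qed.

Let mtube j i : Gm (G j) (fun w => tube j w i 0).
Proof.
elim: j i => [|j IH] i /=; first by under eq_fun do rewrite mxE; exact: Gm_cst.
rewrite /stepz; under eq_fun do rewrite !mxE summxE.
apply: GmD; first apply: GmD; first apply: GmD.
- by apply: mG_sub; exact: IH.
- by apply: GmM; [exact: Gm_cst|apply: mG_sub; case: (bbe j i)].
- apply: Gm_sum => l; under eq_fun do rewrite mxE; apply: GmM => //.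
  by apply: mG_sub; case: (bxi j i l).
- apply: Gm_sum => k; under eq_fun do rewrite mxE; apply: GmM => //.
  by apply: mG_sub; case: (beta_ j k i).
Qed.

Let ms j : Gm (G j) (fun w => r ^+ 2 - dotv (tube j w) (tube j w)).
Proof. by apply: GmB; [exact: Gm_cst|apply: mdotv => i; exact: mtube]. Qed.

Let mposp j (X : Omega -> R) : Gm (G j) X -> Gm (G j) (fun w => posp (X w)).
Proof. exact: Gm_posp. Qed.

Let menorm j q (A : Omega -> 'M[R]_(d, q)) : (forall i k, Gm (G j) (fun w => A w i k)) ->
  Gm (G j) (fun w => enorm (A w) ^+ 2).
Proof.
move=> mA; under eq_fun do rewrite enorm_sqr.
by apply: Gm_sum => i; apply: Gm_sum => k; exact: GmX.
Qed.

Let mbracket j :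
  Gm (G j) (fun w => bracket r m2 c (tube j w) (be j w) (xi j w) (eta j w)).
Proof.
have mxi i k : Gm (G j) (fun w => xi j w i k) by case: (bxi j i k).
have meta i k : Gm (G j) (fun w => eta j w i k 0) by case: (beta_ j i k).
have mbe i : Gm (G j) (fun w => be j w i 0) by case: (bbe j i).
have bc (k : R) (U : Omega -> R) : Gm (G j) U -> Gm (G j) (fun w => k * U w).
  by move=> bU; apply: GmM => //; exact: Gm_cst.
rewrite /bracket; apply: GmD; first apply: GmB.
- apply: GmM; last by apply: mdotv => // i; exact: mtube.
  by apply: bc; apply: GmX; exact: ms.
- apply: GmM; first by apply: bc; apply: GmX; exact: ms.
  apply: GmD; first by apply: bc; exact: menorm.
  by apply: Gm_sum => i; apply: Gm_sum => k; apply: bc; exact: mdotv.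
- apply: GmM; first by apply: bc; exact: ms.
  apply: menorm => i k; under eq_fun do rewrite mxE.
  rewrite (ord1 k); apply: Gm_sum => l; under eq_fun do rewrite mxE.
  by apply: GmM => //; exact: mtube.
Qed.

Let mdeficit j : Gm (G j) (deficit j).
Proof.
apply: Gm_if_lt; [exact: Gm_cst|exact: ms| |exact: Gm_cst].
apply: GmM; first exact: Gm_cst.
apply: mposp; apply: GmN; apply: GmD; first exact: mbracket.
by apply: GmM; [exact: Gm_cst|apply: GmX; exact: ms].
Qed.

Let Gm_le i j (X : Omega -> R) : (i <= j)%N -> Gm (G i) X -> Gm (G j) X.
Proof.
move=> /subnK <-; elim: (j - i)%N => [//|k IH] mX.
by rewrite addSn; apply: mG_sub; exact: IH.
Qed.

Let malive j : Gm (G j) (alive j).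
Proof.
apply: Gm_if_le; [|exact: Gm_cst|exact: Gm_cst|exact: Gm_cst].
rewrite [X in Gm _ X](_ : _ = fun w => \sum_(i <- map val (enum 'I_j.+1))
    (if (i <= j)%N then deficit i w else 0)); last first.
  apply/funext => w; rewrite big_map big_enum/=; apply: eq_bigr => i _.
  by rewrite -ltnS ltn_ord.
apply: Gm_sum => i; case: (leqP i j) => ij; last exact: Gm_cst.
exact: (Gm_le ij).
Qed.

Let mF j : Gm (G j) (fun w => barrier r (tube j w)).
Proof. by apply: GmX; apply: mposp; exact: ms. Qed.

Let balive j : bGm (G j) (alive j).
Proof. by split; [exact: malive|exists 1 => w; rewrite ger0_norm]. Qed.

Let bF j : bGm (G j) (fun w => barrier r (tube j w)).
Proof.
split; first exact: mF.
by exists (r ^+ 6) => w; rewrite ger0_norm ?barrier_le// barrier_ge0.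
Qed.

Let alive_L1 j : L1 P (alive j). Proof. exact: (bGm_L1 P (sG j) (balive j)). Qed.

Let u j := Ex P (fun w => alive j w * barrier r (tube j w)).

Let aF_L1 j : L1 P (fun w => alive j w * barrier r (tube j w)).
Proof. by apply: (bGm_L1 P (sG j)); exact: bGmM. Qed.

Let aFS_L1 j : L1 P (fun w => alive j w * barrier r (tube j.+1 w)).
Proof.
apply: (bGm_L1 P (sG j.+1)); apply: bGmM => //; split; first exact: mG_sub.
by exists 1 => w; rewrite ger0_norm.
Qed.

Let aD_L1 j : L1 P (fun w => alive j w * deficit j w).
Proof.
apply: (@L1_bounded _ _ _ _ _ eps).
  by apply: (Gm_meas (sG j)); exact: GmM.
move=> w; rewrite ger0_norm ?mulr_ge0//.
apply: le_trans (alive_deficit j.+1 w); rewrite big_ord_recr/= lerDr.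
by apply: sumr_ge0 => i _; rewrite mulr_ge0.
Qed.

(** A path that dies at this step loses at most the maximum [r ^+ 6] of the barrier; over all steps
    these costs telescope. *)
Let drop_alive j :
  Ex P (fun w => alive j w * barrier r (tube j.+1 w))
    - r ^+ 6 * (Ex P (alive j) - Ex P (alive j.+1)) <= u j.+1.
Proof.
rewrite -(ExB (alive_L1 j) (alive_L1 j.+1)) -ExZ; last exact: L1B.
rewrite -ExB; [|exact: aFS_L1|by apply: L1Z; exact: L1B].
apply: Ex_le => [||w]; [by apply: L1B => //; apply: L1Z; exact: L1B|exact: aF_L1|].
have F0 := barrier_ge0 r (tube j.+1 w); have Fr := barrier_le r (tube j.+1 w).
have := aliveS j w; rewrite -subr_ge0 => aS.
have : 0 <= (alive j w - alive j.+1 w) * (r ^+ 6 - barrier r (tube j.+1 w)).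
  by rewrite mulr_ge0// subr_ge0.
lra.
Qed.

Let one_step_lb j :
  (1 - kap * h j) * u j - Ex P (fun w => alive j w * deficit j w) - C * (h j / B)
  <= Ex P (fun w => alive j w * barrier r (tube j.+1 w)).
Proof.
(* Grids may repeat a point, and [noise] is available only for a positive step length. In an empty
   step the tube does not move. *)
have [hj0|hj0] := eqVneq (h j) 0.
  rewrite hj0 mul0r !mulr0 !subr0 mul1r lerBlDr.
  have -> : Ex P (fun w => alive j w * deficit j w) = 0.
    rewrite -[RHS](Ex_cst P 0); apply: eq_Ex => w.
    by rewrite deficit_h0// mulr0.
  rewrite addr0 le_eqVlt; apply/orP; left; apply/eqP.
  apply: eq_Ex => w /=; rewrite /stepz hj0 scale0r addr0.
  rewrite (_ : (\col_l g j l w) = 0) ?mulmx0 ?addr0; last first.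
    by apply/matrixP => l k; rewrite !mxE gh0.
  by rewrite big1 ?addr0// => i _; rewrite nh0// scale0r.
have hj : 0 < h j by rewrite lt_neqAle eq_sym hj0 h0.
pose s w := r ^+ 2 - dotv (tube j w) (tube j w).
pose chi w := if 0 < s w then alive j w else 0.
have chi01 w : chi w = 0 \/ chi w = 1.
  by rewrite /chi; case: ifP => _; [exact: alive01|left].
have mchi : Gm (G j) chi.
  by apply: Gm_if_lt; [exact: Gm_cst|exact: ms|exact: malive|exact: Gm_cst].
have bchi : bGm (G j) chi.
  by split => //; exists 1 => w; case: (chi01 w) => ->; rewrite ?normr0 ?normr1.
(* The one-step estimate requires a bounded position; this one is bounded by [r] and agrees with the
   tube where [chi] is 1. *)
pose z w : 'cV[R]_d := chi w *: tube j w.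
have chi_s w : chi w = 1 -> 0 < s w.
  by rewrite /chi; case: ifP => // _ /esym/eqP; rewrite oner_eq0.
have chi_z w : chi w = 1 -> z w = tube j w by rewrite /z => ->; rewrite scale1r.
have bz i : bGm (G j) (fun w => z w i 0).
  split; first by under eq_fun do rewrite mxE; apply: GmM => //; exact: mtube.
  exists r => w; rewrite mxE; case: (chi01 w) => e.
    by rewrite e mul0r normr0 ltW.
  rewrite e mul1r (le_trans (enorm_entry _ _ _))//.
  rewrite -(@ler_pXn2r _ 2)// ?nnegrE ?enorm_ge0 ?(ltW r0)// enorm_dotv.
  by have := chi_s w e; rewrite /s; lra.
have zs w : chi w = 1 -> 0 < r ^+ 2 - dotv (z w) (z w).
  by move=> e; rewrite chi_z//; exact: chi_s.
have H := HC (sG j) hj B1 (hB j) aL (nz hj) bchi chi01 bz (bbe j) (bxi j) (beta_ j)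
  zs (beB j) (xiL j) (etaL j).
have iB : bGm (G j) (fun w => chi w * ((r ^+ 2 - dotv (z w) (z w)) ^+ 3
     + h j * bracket r m2 c (z w) (be j w) (xi j w) (eta j w))).
  have bdot (u1 v : Omega -> 'cV[R]_d) : (forall i, bGm (G j) (fun w => u1 w i 0)) ->
      (forall i, bGm (G j) (fun w => v w i 0)) -> bGm (G j) (fun w => dotv (u1 w) (v w)).
    by move=> bu bv; apply: bGm_sum => i; exact: bGmM.
  have bs : bGm (G j) (fun w => r ^+ 2 - dotv (z w) (z w)).
    by apply: bGmB; [exact: bGm_cst|exact: bdot].
  have bc (k : R) (U : Omega -> R) : bGm (G j) U -> bGm (G j) (fun w => k * U w).
    by move=> bU; apply: bGmM => //; exact: bGm_cst.
  have be2 q (A : Omega -> 'M[R]_(d, q)) : (forall i k, bGm (G j) (fun w => A w i k)) ->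
      bGm (G j) (fun w => enorm (A w) ^+ 2).
    move=> mA; under eq_fun do rewrite enorm_sqr.
    by apply: bGm_sum => i; apply: bGm_sum => k; exact: bGmX.
  apply: bGmM => //; apply: bGmD; first exact: bGmX.
  apply/bc; rewrite /bracket; apply: bGmD; first apply: bGmB.
  - by apply: bGmM; [apply: bc; exact: bGmX|exact: bdot].
  - apply: bGmM; first by apply: bc; exact: bGmX.
    apply: bGmD; first by apply: bc; exact: be2.
    by apply: bGm_sum => i; apply: bGm_sum => k; apply: bc; exact: bdot.
  - apply: bGmM; first exact: bc.
    apply: be2 => i k; under eq_fun do rewrite mxE.
    apply: bGm_sum => l; under eq_fun do rewrite mxE.
    by apply: bGmM => //; rewrite (ord1 k).
have := H; set A := Ex P _; set A' := Ex P _ => {}H.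
have lhs : (1 - kap * h j) * u j - Ex P (fun w => alive j w * deficit j w) <= A.
  rewrite /u -ExZ// -ExB//; last exact: L1Z.
  apply: Ex_le => [||w]; [by apply: L1B => //; exact: L1Z|exact: bGm_L1 iB|].
  have [e|e] := chi01 w.
    rewrite e mul0r; have : alive j w * barrier r (tube j w) = 0.
      move: e; rewrite /chi; case: ifP => [_ ->|/negbT]; first by rewrite mul0r.
      by rewrite -leNgt => s0 _; rewrite /barrier (posp0 s0) expr0n/= mulr0.
    by move=> ->; rewrite mulr0 sub0r oppr_le0 mulr_ge0.
  have s0 := chi_s w e.
  have a1 : alive j w = 1 by move: e; rewrite /chi s0.
  rewrite e a1 !mul1r (chi_z w e) /deficit -/(s w) s0 /barrier -/(s w) (pospE (ltW s0)).
  set br := bracket _ _ _ _ _ _ _.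
  have : - posp (- (br + kap * s w ^+ 3)) <= br + kap * s w ^+ 3.
    by rewrite lerNl /posp le_max lexx.
  move=> /(ler_wpM2l (h0 j)); lra.
have rhs : A' <= Ex P (fun w => alive j w * barrier r (tube j.+1 w)).
  have E w : chi w * barrier r (stepz (h j) (z w) (be j w) (xi j w) (eta j w)
      (fun l => g j l w) (fun i => n j i w)) = chi w * barrier r (tube j.+1 w).
    by case: (chi01 w) => e; rewrite e ?mul0r// chi_z.
  rewrite /A' (eq_Ex P E); apply: Ex_le => // [|w].
    apply: (bGm_L1 P (sG j.+1)); apply: bGmM => //; split; first exact: mG_sub.
    by case: bchi.
  by rewrite ler_wpM2r ?barrier_ge0// /chi; case: ifP.
lra.
Qed.

Lemma tube_bound M : r ^+ 6 <= expR (2 * kap * t M) *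
  (Ex P (fun w => alive M w * barrier r (tube M w))
   + 2 * r ^+ 6 * (1 - Ex P (alive M)) + eps + C * (t M / B)).
Proof.
have B0 : 0 < B by rewrite (lt_le_trans _ B1).
have t_ge0 j : 0 <= t j.
  by elim: j => [|j IH]; rewrite ?t0// (le_trans IH).
(* The three losses of a step: paths that die, the deficit of those that survive, and the
   discretization error. Their sums are controlled by telescoping, by [eps] and by
   [C * (t M / B)]. *)
pose e j := r ^+ 6 * (Ex P (alive j) - Ex P (alive j.+1))
  + Ex P (fun w => alive j w * deficit j w) + C * (h j / B).
have e0 j : 0 <= e j.
  rewrite /e; apply: addr_ge0; last by rewrite mulr_ge0// divr_ge0// ltW.
  apply: addr_ge0; last by apply: Ex_ge0 => w; rewrite mulr_ge0.
  apply: mulr_ge0; first exact/exprn_ge0/ltW.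
  by rewrite subr_ge0; apply: Ex_le => // w; exact: aliveS.
have uS j : (1 - kap * h j) * u j - e j <= u j.+1.
  have := drop_alive j; have := one_step_lb j; rewrite /e; lra.
have u_ge0 j : 0 <= u j by apply: Ex_ge0 => w; rewrite mulr_ge0// barrier_ge0.
have gron m : u 0%N <= expR (2 * kap * t m) * (u m + \sum_(i < m) e i).
  elim: m => [|m IH]; first by rewrite t0 mulr0 expR0 mul1r big_ord0 addr0.
  apply: (le_trans IH).
  have -> : 2 * kap * t m.+1 = 2 * kap * t m + 2 * (kap * h m) by rewrite /h; ring.
  rewrite expRD -[leRHS]mulrA ler_pM2l ?expR_gt0// big_ord_recr/=.
  have S0 : 0 <= \sum_(i < m) e i by apply: sumr_ge0.
  have k0 : 0 <= kap * h m by rewrite mulr_ge0.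
  have k1 := hkap m.
  have E : 1 + 2 * (kap * h m) <= expR (2 * (kap * h m)) by exact: expR_ge1Dx.
  have um := uS m; have um0 := u_ge0 m; have em := e0 m; have um1 := u_ge0 m.+1.
  (* With [x = kap * h m], the product [(1 + 2 * x) * (1 - x)] is at least 1 for [x] between 0 and
     1/2: hence the bound in [hkap] and the factor 2 in the exponent. *)
  apply: (@le_trans _ _ ((1 + 2 * (kap * h m)) * (u m.+1 + (\sum_(i < m) e i + e m)))).
    set x := kap * h m in k0 k1 um *.
    have : 0 <= u m * (x * (1 - 2 * x)) by rewrite !mulr_ge0//; lra.
    have := ler_wpM2l (_ : 0 <= 1 + 2 * x) um; move=> /(_ ltac:(lra)).
    have : 0 <= 2 * x * \sum_(i < m) e i by rewrite !mulr_ge0.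
    lra.
  by apply: ler_wpM2r => //; apply: addr_ge0 => //; exact: addr_ge0.
have E1 : u 0%N = r ^+ 6 * Ex P (alive 0).
  rewrite -ExZ//; apply: eq_Ex => w /=; rewrite /barrier dotv0l subr0 pospE ?sqr_ge0//.
  by rewrite mulrC -exprM.
have Se : \sum_(i < M) e i <= r ^+ 6 * (Ex P (alive 0) - Ex P (alive M)) + eps + C * (t M / B).
  have -> : \sum_(i < M) e i = r ^+ 6 * (Ex P (alive 0) - Ex P (alive M))
      + Ex P (fun w => \sum_(i < M) alive i w * deficit i w) + C * (t M / B).
    rewrite Ex_sum//; elim: M => [|m IH].
      by rewrite !big_ord0 t0 mul0r subrr !mulr0 !addr0.
    by rewrite !big_ord_recr/= IH /e /h; field; rewrite gt_eqF.
  have : Ex P (fun w => \sum_(i < M) alive i w * deficit i w) <= eps.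
    rewrite -[leRHS](Ex_cst P eps); apply: Ex_le => //.
    + by apply: L1_sum.
    + exact: L1_cst.
  lra.
have := gron M; rewrite E1 => H.
have EM : Ex P (alive M) <= Ex P (alive 0).
  by clear -aliveS alive_L1; elim: M => // m; apply: le_trans; apply: Ex_le => // w; exact: aliveS.
have E01 : Ex P (alive 0) <= 1.
  by rewrite -(Ex_cst P 1); apply: Ex_le => //; exact: L1_cst.
have ge1 : 1 <= expR (2 * kap * t M).
  apply: le_trans (expR_ge1Dx _); rewrite lerDl; exact/mulr_ge0/t_ge0/mulr_ge0.
have r6 : 0 <= r ^+ 6 by exact/exprn_ge0/ltW.
have EM0 : 0 <= Ex P (alive M) by apply: Ex_ge0.
set Q := expR _ in ge1 H *.
have Q0 : 0 <= Q by lra.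
have := ler_wpM2l Q0 Se; rewrite -/(u M).
have : 0 <= (Q - 1) * (r ^+ 6 * (1 - Ex P (alive 0))).
  by apply: mulr_ge0; [lra|apply: mulr_ge0 => //; lra].
have : 0 <= Q * (r ^+ 6 * (1 - Ex P (alive M))).
  by apply: mulr_ge0 => //; apply: mulr_ge0 => //; lra.
nra.
Qed.

Lemma Gm_tube j i : Gm (G j) (fun w => tube j w i 0).
Proof. exact: mtube. Qed.

Lemma Gm_alive j : Gm (G j) (alive j).
Proof. exact: malive. Qed.

End tube.

(** * Grids and cadlag paths *)

Section grids.
Context (R : realType).

(** An interval []l, r]] whose endpoints are both separated contains each step []t j, t j.+1]] or is
    disjoint from it, so that simple integrands are constant on steps. *)
Definition separates (t : nat -> R) (p : R) : Prop := forall j, p <= t j \/ t j.+1 <= p.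

(** The points are clamped to [[0, T]] and sorted. The default value [T] of [nth] extends the list
    to an infinite sequence and gives [t M = T] at [M = size q]. *)
Lemma separating_sequence (T : R) (s : seq R) : 0 <= T -> exists (t : nat -> R) (M : nat),
  [/\ t 0 = 0, forall j, t j <= t j.+1, t M = T, forall j, t j <= T
    & forall p, p \in s -> separates t p].
Proof.
move=> T0; pose cl p : R := Num.min T (Num.max 0 p).
pose q := sort <=%R (0 :: [seq cl p | p <- s]).
have clT p : cl p <= T by rewrite ge_min lexx.
have cl0 p : 0 <= cl p by rewrite le_min T0 le_max lexx.
have q_in x : x \in q -> 0 <= x <= T.
  rewrite mem_sort inE => /orP[/eqP ->|/mapP[p _ ->]]; first by rewrite lexx T0.
  by rewrite cl0 clT.
pose t j := nth T q j.
have sq : sorted <=%R q by apply: sort_sorted; exact: le_total.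
have t_in j : 0 <= t j <= T.
  have [jq|jq] := ltnP j (size q); first exact/q_in/mem_nth.
  by rewrite /t nth_default// T0 lexx.
have t_mono i j : (i <= j)%N -> t i <= t j.
  move=> ij; have [jq|jq] := ltnP j (size q).
    apply: (sorted_leq_nth le_trans (@lexx _ _) T sq) => //.
    by rewrite inE (leq_ltn_trans ij).
  by rewrite {2}/t nth_default//; case/andP: (t_in i).
exists t, (size q); split.
- have : 0 \in q by rewrite mem_sort inE eqxx.
  move=> /(nthP T)[i iq ti]; apply/eqP; rewrite eq_le.
  have := t_mono 0%N i (leq0n i); rewrite {2}/t ti => ->.
  by case/andP: (t_in 0%N).
- by move=> j; exact: t_mono.
- by rewrite /t nth_default.
- by move=> j; case/andP: (t_in j).
- move=> p ps j.
  have : cl p \in q by rewrite mem_sort inE map_f ?orbT.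
  move=> /(nthP T)[i iq ti].
  have tiE : t i = cl p by [].
  have [p0|p0] := leP p 0; first by left; case/andP: (t_in j) => + _; exact: le_trans.
  have [pT|pT] := leP T p; first by right; case/andP: (t_in j.+1) => _ /le_trans; apply.
  have clp : cl p = p by rewrite /cl (max_r (ltW p0)) min_r// ltW.
  have [ij|ij] := leqP i j; [left|right]; rewrite -clp -tiE; exact: t_mono.
Qed.

Lemma grid_exists (T e : R) (s : seq R) : 0 <= T -> 0 < e -> exists (t : nat -> R) (M : nat),
  [/\ t 0 = 0, forall j, t j <= t j.+1, t M = T, forall j, t j <= T
    & (forall j, t j.+1 - t j <= e) /\ forall p, p \in s -> separates t p].
Proof.
move=> T0 e0; pose m := (Num.truncn (T / e)).+1.
have [t [M [t0 tS tM tT sep]]] := separating_sequence (s ++ [seq e * k%:R | k <- iota 0 m.+1]) T0.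
exists t, M; split => //; split => [j|p ps]; last by apply: sep; rewrite mem_cat ps.
have t_ge0 : 0 <= t j.
  by elim: j => [|j IH]; rewrite ?t0// (le_trans IH).
rewrite leNgt; apply/negP => gt.
(* The first multiple of [e] beyond [t j] would lie strictly inside a step longer than [e], but it
   is one of the separated points. *)
pose k := (Num.truncn (t j / e)).+1.
have k1 : t j < e * k%:R.
  by rewrite mulrC -ltr_pdivrMr// truncnS_gt.
have k2 : e * k%:R <= t j + e.
  rewrite /k -natr1 mulrDr mulr1 lerD2r mulrC -ler_pdivlMr// truncn_le//.
  by rewrite divr_ge0// ltW.
have km : (k < m.+1)%N.
  rewrite ltnS /k /m ltnS; apply: le_truncn; rewrite ler_pM2r ?invr_gt0//.
have pk : e * k%:R \in s ++ [seq e * k%:R | k <- iota 0 m.+1].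
  by rewrite mem_cat; apply/orP; right; apply: (map_f (fun i => e * i%:R)); rewrite mem_iota.
by have [h|h] := sep _ pk j; lra.
Qed.

(** Each point of [D] lies in at most one of the steps []t j, t j.+1]], and that step is no longer
    than [e]. *)
Lemma bad_steps (t : nat -> R) (e : R) (D : seq R) M :
  (forall j, t j <= t j.+1) -> (forall j, t j.+1 - t j <= e) -> 0 <= e ->
  \sum_(j < M | has (fun p => t j < p <= t j.+1) D) (t j.+1 - t j) <= (size D)%:R * e.
Proof.
move=> tS te e0.
have tmono i j : (i <= j)%N -> t i <= t j.
  move=> /subnK <-; elim: (j - i)%N => // k; rewrite addSn; move/le_trans; exact.
have one p : \sum_(j < M | t j < p <= t j.+1) (t j.+1 - t j) <= e.
  have [[j0 pj0]|no] := pselect (exists j0 : 'I_M, t j0 < p <= t j0.+1).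
    rewrite (bigD1 j0)//= big_pred0 ?addr0// => j.
    apply/negbTE/negP => /andP[/andP[h1 h2] jj0].
    move: pj0 => /andP[h3 h4].
    have [lt|gt|/val_inj e1] := ltngtP j j0; last by rewrite e1 eqxx in jj0.
      have := tmono _ _ lt; lra.
    have := tmono _ _ gt; lra.
  by rewrite big_pred0// => j; apply/negbTE/negP => pj; apply: no; exists j.
elim: D => [|p D IH] /=; first by rewrite big_pred0// mul0r.
rewrite -addn1 natrD mulrDl mul1r addrC.
apply: le_trans (lerD (one p) IH).
rewrite big_mkcond [X in _ <= X + _]big_mkcond [X in _ <= _ + X]big_mkcond -big_split.
apply: ler_sum => j _ /=; have := tS j; rewrite -subr_ge0 => h.
by case: (t j < p <= t j.+1) => /=; case: has; lra.
Qed.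

End grids.

Section partition.
Context (R : realType).

(** Let [x] be the supremum of the times up to which a finite set exists. The left hypothesis at [x]
    extends such a set up to [x], and the right one beyond [x] unless [x = T]. The test
    [s < p <= s'] assigns [p] to the piece on its right, in accordance with right continuity. *)
Lemma piecewise_partition (T : R) (K : R -> R -> Prop) : 0 <= T -> (forall s, K s s) ->
  (forall t, 0 <= t < T -> exists2 e, 0 < e & forall s s', t <= s -> s <= s' -> s' < t + e -> K s s') ->
  (forall t, 0 < t <= T -> exists2 e, 0 < e & forall s s', t - e < s -> s <= s' -> s' < t -> K s s') ->
  exists D : seq R, forall s s', 0 <= s -> s <= s' -> s' <= T ->
    ~~ has (fun p => s < p <= s') D -> K s s'.
Proof.
move=> T0 K0 Kr Kl.
pose good x := exists D : seq R, forall s s', 0 <= s -> s <= s' -> s' <= x ->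
  ~~ has (fun p => s < p <= s') D -> K s s'.
pose A := [set x | 0 <= x <= T /\ good x].
have A0 : A 0.
  split; first by rewrite lexx T0.
  by exists [::] => s s' s0 ss' s'0 _; have -> : s' = s by lra.
have supA : has_sup A.
  by split; [exists 0|exists T => x [/andP[]]].
set x := sup A.
have x0 : 0 <= x by exact: (sup_upper_bound supA).
have xT : x <= T by apply: ge_sup; [exists 0|move=> y [/andP[]]].
have gx : good x.
  have [xE|xgt0] : x = 0 \/ 0 < x by move: x0; rewrite le_eqVlt => /orP[/eqP|]; [left|right].
    by rewrite xE; case: A0.
  have [|e e0 He] := Kl x; first by rewrite xgt0.
  have [y [y01 [D HD]] yx] := sup_adherent e0 supA.
  exists (y :: x :: D) => s s' s0 ss' s'x /=; rewrite !negb_or => /and3P[ny nx nD].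
  have [s'y|ys'] := leP s' y; first exact: HD.
  have sy : y <= s by rewrite leNgt; apply/negP => sy; rewrite sy (ltW ys') in ny.
  move: s'x; rewrite le_eqVlt => /orP[/eqP s'E|s'x].
    move: ss'; rewrite le_eqVlt => /orP[/eqP ->//|ss'].
    by rewrite -s'E ss' lexx in nx.
  by apply: He => //; rewrite (lt_le_trans yx).
suff -> : T = x by [].
apply/eqP; rewrite eq_le xT andbT leNgt; apply/negP => xT'.
have [|e e0 He] := Kr x; first by rewrite x0.
pose y := x + Num.min (e / 2) (T - x).
have m0 : 0 < Num.min (e / 2) (T - x) by rewrite lt_min divr_gt0//= subr_gt0.
have yxe : y < x + e.
  by rewrite ltrD2l (@le_lt_trans _ _ (e / 2))// ?ge_min ?lexx//; lra.
have yT : y <= T by rewrite -lerBrDl ge_min lexx orbT.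
have : A y.
  split; first by rewrite yT andbT /y addr_ge0// ltW.
  case: gx => D HD; exists (x :: D) => s s' s0 ss' s'y /=; rewrite negb_or => /andP[nx nD].
  have [s'x|xs'] := leP s' x; first exact: HD.
  have sx : x <= s by rewrite leNgt; apply/negP => sx; rewrite sx (ltW xs') in nx.
  by apply: He => //; exact: le_lt_trans yxe.
move=> /(sup_upper_bound supA); rewrite -/x /y gerDl => /(lt_le_trans m0).
by rewrite ltxx.
Qed.

(** The value at [s] is compared with the value at the last point of [D] not after [s], or at 0 if
    there is none: finitely many reference values. *)
Lemma partition_bounded (T : R) (f : R -> R) (D : seq R) : 0 <= T ->
  (forall s s', 0 <= s -> s <= s' -> s' <= T -> ~~ has (fun p => s < p <= s') D ->
    `|f s - f s'| <= 1) ->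
  exists K, forall s, 0 <= s <= T -> `|f s| <= K.
Proof.
move=> T0 H.
have [K HK] : exists K, forall s, 0 <= s -> exists q,
    [/\ 0 <= q <= s, `|f q| <= K & ~~ has (fun p => q < p <= s) D].
  elim: {H} D => [|p D [K IH]]; first by exists `|f 0| => s s0; exists 0; rewrite lexx s0.
  exists (Num.max K `|f p|) => s s0; have [q [/andP[q0 qs] fq nD]] := IH s s0.
  have [/andP[qp ps]|nqp] := boolP (q < p <= s).
    exists p; split; [by rewrite ps (le_trans q0)// ltW|by rewrite le_max lexx orbT|].
    rewrite /= ltxx/=; apply: contra nD => /hasP[p' p'D /andP[h1 h2]].
    by apply/hasP; exists p' => //; rewrite h2 (lt_trans qp).
  by exists q; split; [rewrite q0|rewrite le_max fq|rewrite /= (negbTE nqp)].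
exists (K + 1) => s /andP[s0 sT]; have [q [/andP[q0 qs] fq nD]] := HK s s0.
have := H q s q0 qs sT nD; have := ler_distD (f q) (f s) 0; rewrite !subr0 distrC; lra.
Qed.

End partition.

Section matrix_topology.
Context (R : realType).

Lemma enorm_continuous m n : continuous (@enorm R m n).
Proof.
have csum (I : Type) (s : seq I) (G : I -> 'M[R]_(m, n) -> R) :
    (forall i, continuous (G i)) -> continuous (fun A => \sum_(i <- s) G i A).
  move=> cG; elim: s => [|i s IH].
    rewrite (_ : (fun _ => _) = cst 0); first exact: cst_continuous.
    by apply/funext => A; rewrite big_nil.
  rewrite (_ : (fun _ => _) = (G i \+ fun A => \sum_(j <- s) G j A)); last first.
    by apply/funext => A; rewrite big_cons.
  by move=> A; apply: continuousD; [exact: cG|exact: IH].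
have cs : continuous (fun A : 'M[R]_(m, n) => \sum_i \sum_j A i j * A i j).
  apply/csum => i; apply/csum => j.
  by move=> A; apply: continuousM; exact: coord_continuous.
rewrite (_ : @enorm R m n = Num.sqrt \o (fun A => \sum_i \sum_j A i j * A i j)); last first.
  apply/funext => B; rewrite /enorm /mxtrace /=; congr Num.sqrt; apply: eq_bigr => i _.
  by rewrite mxE; apply: eq_bigr => j _; rewrite mxE.
by move=> A; apply: continuous_comp; [exact: cs|exact: sqrt_continuous].
Qed.

Lemma subr_mx_continuous m n (l : 'M[R]_(m, n)) : continuous (fun A : 'M[R]_(m, n) => A - l).
Proof.
move=> A /= B /nbhs_ballP[e e0 eB]; apply/nbhs_ballP; exists e => //= C [_ AC].
by apply: eB; split => // i j; have := AC i j; rewrite /ball/= !mxE opprB addrA subrK.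
Qed.

Lemma cvg_enorm T (F : set_system T) m n (f : T -> 'M[R]_(m, n))
    (l : 'M[R]_(m, n)) : Filter F ->
  f @ F --> l -> (fun s => enorm (f s - l)) @ F --> 0.
Proof.
move=> FF fl.
rewrite -(@enorm0 R m n) -(subrr l).
have : (fun A : 'M[R]_(m, n) => enorm (A - l)) @ l --> enorm (l - l).
  apply: (@continuous_comp 'M[R]_(m, n) 'M[R]_(m, n) R (fun A => A - l) (@enorm R m n)); last exact: enorm_continuous.
  exact: subr_mx_continuous.
by move=> h; exact: (@cvg_comp _ _ _ f (fun A => enorm (A - l)) F (nbhs l) _ fl h).
Qed.

Lemma near_enorm T (F : set_system T) m n (f : T -> 'M[R]_(m, n))
    (l : 'M[R]_(m, n)) (e : R) : Filter F ->
  f @ F --> l -> 0 < e -> \forall s \near F, enorm (f s - l) < e.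
Proof.
move=> FF fl e0; have := @cvgr_lt _ _ _ FF _ _ (cvg_enorm FF fl) e e0.
exact.
Qed.

Lemma nbhs_enorm m n (y : 'M[R]_(m, n)) (B : set 'M[R]_(m, n)) : nbhs y B ->
  exists2 r : R, 0 < r & forall z, enorm (z - y) < r -> B z.
Proof.
move=> /nbhs_ballP[e e0 eB]; exists e => // z zy; apply: eB; split => // i j.
apply: le_lt_trans zy; rewrite distrC.
by have := enorm_entry (z - y) i j; rewrite !mxE.
Qed.

Lemma trmx_continuous m n : continuous (@trmx R m n).
Proof.
move=> A /= B /nbhs_ballP[e e0 eB]; apply/nbhs_ballP; exists e => //= C [_ AC].
by apply: eB; split => // i j; rewrite !mxE; exact: AC.
Qed.

(** The ball sits in a closed box, whose compactness is used on row vectors through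
    transposition. *)
Lemma continuous_bounded_ball d (g : 'cV[R]_d -> R) (rho : R) : continuous g ->
  exists K, forall x, enorm x <= rho -> `|g x| <= K.
Proof.
move=> cg.
have cK : compact [set v : 'rV[R]_d | forall i, `[- rho, rho]%classic (v ord0 i)].
  by apply: (@rV_compact R d (fun=> `[- rho, rho]%classic)) => i; exact: segment_compact.
have : compact ((g \o trmx) @` [set v : 'rV[R]_d | forall i, `[- rho, rho]%classic (v ord0 i)]).
  apply: continuous_compact cK; apply: continuous_subspaceT => v.
  by apply: continuous_comp; [exact: trmx_continuous|exact: cg].
move=> /compact_bounded[K [_ HK]]; exists (K + 1) => x xr.
apply: (HK (K + 1)); first by rewrite ltrDl.
exists x^T; last by rewrite /= trmxK.
move=> i /=; rewrite in_itv/= mxE -ler_norml.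
exact: le_trans (enorm_entry _ _ _) xr.
Qed.

Lemma continuous_enorm_bounded d m n (g : 'cV[R]_d -> 'M[R]_(m, n)) (rho : R) :
  continuous g -> exists K, forall x, enorm x <= rho -> enorm (g x) <= K.
Proof.
move=> cg; have [|K HK] := @continuous_bounded_ball d (fun x => enorm (g x)) rho.
  by move=> x; apply: continuous_comp; [exact: cg|exact: enorm_continuous].
by exists K => x /HK; rewrite ger0_norm// enorm_ge0.
Qed.

Lemma enorm_dist m n (A B C : 'M[R]_(m, n)) :
  enorm (A - C) <= enorm (A - B) + enorm (B - C).
Proof. by rewrite -[A - C](subrKA B); exact: enormD. Qed.

Lemma enorm_distC m n (A B : 'M[R]_(m, n)) : enorm (A - B) = enorm (B - A).
Proof. by rewrite -opprB enormN. Qed.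

End matrix_topology.

Section cadlag_paths.
Context (R : realType) (m n : nat).
Variables (f : R -> 'M[R]_(m, n)).
Hypothesis cf : cadlag f.

Lemma cadlag_cvg_left (t : R) : 0 < t -> f s @[s --> t^'-] --> left_lim f t.
Proof. by move=> t0; exact: cf.2. Qed.

(** One-sided limits make the oscillation small on one-sided neighbourhoods of each time, and
    [piecewise_partition] patches these together. It is applied with [g] the drift coefficient and
    with the identity. *)
Lemma cadlag_partition (m' n' : nat) (g : 'M[R]_(m, n) -> 'M[R]_(m', n')) (T e : R) :
  continuous g -> 0 <= T -> 0 < e ->
  exists D : seq R, forall s s', 0 <= s -> s <= s' -> s' <= T ->
    ~~ has (fun p => s < p <= s') D -> enorm (g (f s) - g (f s')) <= e.
Proof.
move=> cg T0 e0.
have near2 (F : set_system R) (l : 'M[R]_(m, n)) : Filter F -> f @ F --> l ->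
    \forall s \near F, enorm (g (f s) - g l) < e / 4.
  move=> FF fl; apply: near_enorm; last by rewrite divr_gt0.
  exact: (@cvg_comp _ _ _ f g F (nbhs l) _ fl (cg l)).
have tri l s s' : enorm (g (f s) - g l) < e / 4 -> enorm (g (f s') - g l) < e / 4 ->
    enorm (g (f s) - g (f s')) <= e.
  move=> h h'; have := enorm_dist (g (f s)) (g l) (g (f s')).
  by rewrite (enorm_distC (g l)); lra.
apply: piecewise_partition => //.
- by move=> s; rewrite subrr enorm0 ltW.
- move=> t /andP[t0 tT].
  have := near2 _ _ _ (cf.1 t t0) => -/(_ _) [] r /= r0 Hr.
  have H s : t <= s -> s < t + r -> enorm (g (f s) - g (f t)) < e / 4.
    rewrite le_eqVlt => /orP[/eqP <- _|ts st]; first by rewrite subrr enorm0 divr_gt0.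
    by apply: Hr => //; rewrite /ball/= ltr_distlC; lra.
  by exists r => // s s' ts ss' s't; apply: (tri (f t)); apply: H; lra.
- move=> t /andP[t0 tT].
  have := near2 _ _ _ (cadlag_cvg_left t0) => -/(_ _) [] r /= r0 Hr.
  have H s : t - r < s -> s < t -> enorm (g (f s) - g (left_lim f t)) < e / 4.
    by move=> ts st; apply: Hr => //; rewrite /ball/= ltr_distlC; lra.
  by exists r => // s s' ts ss' s't; apply: (tri (left_lim f t)); apply: H; lra.
Qed.

Lemma cadlag_bounded (T : R) : 0 <= T ->
  exists K, forall s, 0 <= s <= T -> enorm (f s) <= K.
Proof.
move=> T0; have [D HD] := @cadlag_partition _ _ id T 1 (fun=> cvg_id) T0 ltr01.
have near1 s s' : 0 <= s -> s <= s' -> s' <= T -> ~~ has (fun p => s < p <= s') D ->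
    `|enorm (f s) - enorm (f s')| <= 1.
  move=> s0 ss' s'T nD; apply: le_trans (HD s s' s0 ss' s'T nD); rewrite ler_norml.
  have := enormD (f s - f s') (f s'); have := enormD (f s' - f s) (f s).
  by rewrite !subrK (enorm_distC (f s')); lra.
have [K HK] := partition_bounded T0 near1.
exists K => s /HK; exact: le_trans (ler_norm _).
Qed.

End cadlag_paths.

(** * Measurability by cells, and integrals over a grid *)

Section time_integrals.
Context (R : realType).
Notation mu := (@lebesgue_measure R).

(** The cells are left-open: when [s * N%:R] is an integer, the index is one less than its
    truncation. *)
Lemma dyadic_cell (s : R) (N : nat) : 0 < s -> (0 < N)%N ->
  exists m : nat, m%:R / N%:R < s <= m.+1%:R / N%:R.
Proof.
move=> s0 N0; have N0' : 0 < N%:R :> R by rewrite ltr0n.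
have sN : 0 < s * N%:R by rewrite mulr_gt0.
have h1 : (Num.truncn (s * N%:R))%:R <= s * N%:R by rewrite truncn_le ltW.
have h2 : s * N%:R < (Num.truncn (s * N%:R)).+1%:R by exact: truncnS_gt.
move: h1 h2; set k := Num.truncn _ => h1 h2.
move: h1; rewrite le_eqVlt => /orP[/eqP h1|h1]; last first.
  by exists k; rewrite ltr_pdivrMr// ler_pdivlMr// h1 ltW.
case: k h1 h2 => [h1 _|k h1 _]; first by move: sN; rewrite -h1 ltxx.
exists k; rewrite ltr_pdivrMr// ler_pdivlMr// -h1 lexx andbT.
by rewrite ltr_nat.
Qed.

(** Joint measurability in time and mark of a limit of functions that are constant in time on the
    cells of length [1 / n.+1]. It serves right-continuous paths and left limits alike. *)
Lemma measurable_cell_limit (dU : measure_display) (U : measurableType dU)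
    (F : nat -> nat -> U -> R) (G : R -> U -> R) :
  (forall n m, measurable_fun setT (F n m)) ->
  (forall (s : R) u (e : R), 0 < s -> 0 < e -> exists n0, forall n m, (n0 <= n)%N ->
     m%:R / n.+1%:R < s <= m.+1%:R / n.+1%:R -> `|F n m u - G s u| < e) ->
  measurable_fun (`]0, +oo[ `*` setT : set (measurableTypeR R * U))
    (fun z : measurableTypeR R * U => G z.1 z.2).
Proof.
move=> mF FG.
pose I n m : set R := `]m%:R / n.+1%:R, m.+1%:R / n.+1%:R]%classic.
(* The [n.+1 ^ 2] cells cover the times up to [n.+1], hence any given time once [n] is large. *)
pose h n (z : measurableTypeR R * U) : R :=
  \sum_(m < n.+1 ^ 2) (\1_(I n m) z.1 : R) * F n m z.2.
have hE n m s u : (m < n.+1 ^ 2)%N -> I n m s -> h n (s, u) = F n m u.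
  move=> mn Is; rewrite /h (bigD1 (Ordinal mn))//= indicE mem_set// mul1r.
  rewrite big1 ?addr0// => k km; rewrite indicE memNset ?mul0r//= => Ik.
  move: km; rewrite -val_eqE/= => /eqP; apply.
  move: Is Ik; rewrite /I /= !in_itv/= => /andP[a1 a2] /andP[b1 b2].
  have N0 : 0 < n.+1%:R^-1 :> R by rewrite invr_gt0 ltr0n.
  have c1 := lt_le_trans a1 b2; have c2 := lt_le_trans b1 a2.
  rewrite ltr_pM2r// ltr_nat ltnS in c1; rewrite ltr_pM2r// ltr_nat ltnS in c2.
  by apply/eqP; rewrite eqn_leq c1 c2.
apply: (measurable_fun_cvg (h := h)).
- move=> n; apply: measurable_funTS; apply: measurable_sum => m.
  apply: measurable_funM; last by apply: measurableT_comp.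
  by apply: measurableT_comp => //; apply: measurable_indic; exact: measurable_itv.
- move=> [s u] [/=]; rewrite in_itv/= andbT => s0 _.
  apply/cvgrPdist_lt => e e0.
  have [n0 Hn0] := FG s u e s0 e0.
  exists (maxn n0 (Num.truncn s).+1) => // n /=; rewrite geq_max => /andP[n0n sn].
  have [m Im] := @dyadic_cell s n.+1 s0 isT.
  rewrite (@hE n m); [by rewrite distrC; exact: Hn0| |by rewrite /I/= in_itv/=].
  rewrite -(ltr_nat R) natrX; case/andP: Im => ms _.
  move: ms; rewrite ltr_pdivrMr ?ltr0n// => /lt_trans; apply.
  rewrite expr2 ltr_pM2r ?ltr0n//; apply: lt_trans (truncnS_gt s) _.
  by rewrite ltr_nat ltnS.
Qed.

Variables (t : nat -> R) (T : R).
Hypotheses (t0 : t 0 = 0) (tS : forall j, t j <= t j.+1) (tT : forall j, t j <= T).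

Let t_ge0 j : 0 <= t j.
Proof. by elim: j => [|j IH]; rewrite ?t0// (le_trans IH). Qed.

Let itvS j : `]0, t j.+1]%classic = `]0, t j]%classic `|` `]t j, t j.+1]%classic.
Proof. by rewrite -itv_bndbnd_setU// bnd_simp. Qed.

Let itv_disj j : [disjoint `]0, t j]%classic & `]t j, t j.+1]%classic].
Proof.
apply/disj_setPS => s [/=]; rewrite !in_itv/= => /andP[_ a] /andP[b _].
by move: b; rewrite ltNge a.
Qed.

Let mu_step j : mu `]t j, t j.+1]%classic = (t j.+1 - t j)%:E.
Proof.
rewrite lebesgue_measure_itv/= lte_fin; case: ifPn => [_|]; first by rewrite -EFinB.
by rewrite -leNgt => h; rewrite (_ : t j.+1 = t j) ?subrr//; apply/eqP; rewrite eq_le h tS.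
Qed.

(** Used with [phi] the squared distance between the integrands and the coefficients: a bound valid
    at every time of a step becomes a bound for a sum over steps. *)
Lemma step_sum_le_integral (phi : R -> \bar R) (m : nat -> R) M :
  measurable_fun (`]0, T]%classic : set R) phi -> (forall s, (0 <= phi s)%E) -> (forall j, 0 <= m j) ->
  (forall j s, t j < s <= t j.+1 -> ((m j)%:E <= phi s)%E) ->
  ((\sum_(j < M) (t j.+1 - t j) * m j)%:E <= \int[mu]_(s in `]0%R, T]) phi s)%E.
Proof.
move=> mphi phi0 m0 mphi_le.
have sub a b : 0 <= a -> b <= T -> `]a, b]%classic `<=` `]0, T]%classic.
  move=> a0 bT s /=; rewrite !in_itv/= => /andP[h1 h2].
  by rewrite (le_lt_trans a0 h1) (le_trans h2 bT).
have step : ((\sum_(j < M) (t j.+1 - t j) * m j)%:E <= \int[mu]_(s in `]0%R, t M]) phi s)%E.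
  elim: M => [|M IH]; first by rewrite big_ord0 integral_ge0.
  rewrite big_ord_recr/= EFinD itvS ge0_integral_setU//=; last first.
    by apply: measurable_funS mphi => //; rewrite -itvS; exact: sub.
  apply: leeD IH _.
  rewrite mulrC EFinM -mu_step -integral_cst//.
  apply: ge0_le_integral => //.
  - by move=> s _; rewrite lee_fin.
  - by apply: measurable_funS mphi => //; exact: sub.
  - by move=> s /=; rewrite in_itv/=; exact: mphi_le.
apply: (le_trans step); apply: ge0_subset_integral => //; exact: sub.
Qed.

Lemma riemann_sum_error (f : R -> R) (v err : nat -> R) M (K : R) :
  measurable_fun (`]0, T]%classic : set R) f -> (forall s, 0 < s <= T -> `|f s| <= K) ->
  (forall j s, t j < s <= t j.+1 -> `|f s - v j| <= err j) ->
  `|\int[mu]_(s in `[0, t M]) f s - \sum_(j < M) (t j.+1 - t j) * v j|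
    <= \sum_(j < M) (t j.+1 - t j) * err j.
Proof.
move=> mf fK fv.
have fint a b : 0 <= a -> b <= T -> mu.-integrable `]a, b] (EFin \o f).
  move=> a0 bT.
  have sub : `]a, b]%classic `<=` `]0, T]%classic.
    move=> s /=; rewrite !in_itv/= => /andP[h1 h2].
    by rewrite (le_lt_trans a0 h1) (le_trans h2 bT).
  apply: measurable_bounded_integrable => //.
  - have E := @lebesgue_measure_itv R `]a, b]; rewrite /= lte_fin in E.
    suff : (mu `]a, b]%classic < +oo)%E by [].
    by rewrite E; case: ifP => _; rewrite ?ltry// -EFinB ltry.
  - exact: measurable_funS mf.
  - exists K; split; first exact: num_real.
    move=> k Kk s /sub /=; rewrite in_itv/= => /fK; move/le_trans; apply; exact: ltW.
rewrite -Rintegral_itv_obnd_cbnd; last exact: fint.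
elim: M => [|M IH].
  by rewrite !big_ord0 subr0 t0 set_itvoc0 Rintegral_set0 normr0.
rewrite !big_ord_recr/= itvS Rintegral_setU//; last by rewrite -itvS; exact: fint.
set I1 := Rintegral _ _ _; set I2 := Rintegral _ _ _.
rewrite (_ : _ - _ = (I1 - \sum_(j < M) (t j.+1 - t j) * v j) + (I2 - (t M.+1 - t M) * v M)); last by ring.
apply: le_trans (ler_normD _ _) _; apply: lerD => //.
have ic k : mu.-integrable `]t M, t M.+1] (EFin \o fun=> k : R).
  apply: measurable_bounded_integrable => //.
    by rewrite [X in (X < _)%E]mu_step ltry.
  by exists `|k|; split; [exact: num_real|move=> k' kk' s _; exact: ltW].
have mufin : fine (mu `]t M, t M.+1]) = t M.+1 - t M by rewrite [X in fine X]mu_step.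
have -> : (t M.+1 - t M) * v M = \int[mu]_(s in `]t M, t M.+1]) (v M).
  by rewrite Rintegral_cst// mufin mulrC.
have If : mu.-integrable `]t M, t M.+1] (EFin \o f) by exact: fint.
rewrite -RintegralB//.
apply: le_trans (le_normr_Rintegral _ _) _ => //; first exact: (integrableB _ If (ic _)).
rewrite -mufin mulrC -Rintegral_cst//; apply: le_Rintegral => //.
  by apply: integrable_norm; exact: (integrableB _ If (ic _)).
by move=> s /=; rewrite in_itv/=; exact: fv.
Qed.

End time_integrals.

(** * Integrals of simple processes along an adapted grid *)

Section telescoping.
Context (R : realType) (d : nat) (dO : measure_display) (Omega : measurableType dO).
Variables (t : nat -> R) (T : R).
Hypotheses (t0 : t 0 = 0) (tS : forall j, t j <= t j.+1) (tT : forall j, t j <= T).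

Let t_ge0 j : 0 <= t j.
Proof. by elim: j => [|j IH]; rewrite ?t0// (le_trans IH). Qed.

Definition active (l r : R) (j : nat) : bool := (l <= t j) && (t j.+1 <= r).

Lemma active_itv (l r s : R) j : separates t l -> separates t r ->
  t j < s <= t j.+1 -> (s \in `]l, r]) = active l r j.
Proof.
move=> sl sr /andP[ts st]; rewrite in_itv/= /active; apply/andP/andP => -[h1 h2].
  by split; [case: (sl j) => //|case: (sr j) => //]; move=> h; lra.
by split; [exact: le_lt_trans ts|exact: le_trans h2].
Qed.

Section brownian.
Variables (W : R -> Omega -> 'cV[R]_d) (S : bm_simple R Omega d).
Hypotheses (lr : forall i, 0 <= bms_l (b := S) i <= bms_r (b := S) i)
  (sl : forall i, separates t (bms_l (b := S) i))
  (sr : forall i, separates t (bms_r (b := S) i)).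

(** The constant value of the simple integrand on step [j]. An active term has [l <= t j], so this
    value is known at the start of the step. *)
Definition bm_step (j : nat) (w : Omega) : 'M[R]_d :=
  \sum_i if active (bms_l (b := S) i) (bms_r (b := S) i) j then bms_coef i w else 0.

Lemma bm_simple_fun_step j s w : t j < s <= t j.+1 -> bm_simple_fun S s w = bm_step j w.
Proof.
move=> ts; apply: eq_bigr => i _; rewrite indicE.
rewrite (_ : (s \in _) = active (bms_l (b := S) i) (bms_r (b := S) i) j).
  by case: ifP; rewrite ?scale1r ?scale0r.
rewrite -(active_itv (sl i) (sr i) ts).
by apply/idP/idP => [/set_mem//|h]; exact/mem_set.
Qed.

Lemma bm_simple_int_step j w : bm_simple_int W S (t j.+1) w =
  bm_simple_int W S (t j) w + bm_step j w *m (W (t j.+1) w - W (t j) w).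
Proof.
rewrite mulmx_suml -big_split; apply: eq_bigr => i _ /=.
have /andP[l0 lri] := lr i; have tj := tS j.
rewrite /active; have [ltj|] := boolP (bms_l (b := S) i <= t j); last first.
  rewrite -ltNge => ltj.
  have ltS : t j.+1 <= bms_l (b := S) i by case: (sl i j) => // h; lra.
  have ltr : t j.+1 <= bms_r (b := S) i by exact: le_trans lri.
  rewrite mul0mx addr0 (min_r ltS) (min_r ltr) (min_r (ltW ltj)) (min_r (le_trans tj ltr)).
  by rewrite !subrr.
have lS : bms_l (b := S) i <= t j.+1 by exact: le_trans tj.
rewrite (min_l lS) (min_l ltj) /=.
have [rS|] := boolP (t j.+1 <= bms_r (b := S) i).
  rewrite (min_r rS) (min_r (le_trans tj rS)).
  by rewrite -mulmxDr; congr (_ *m _); rewrite [RHS]addrC subrKA.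
rewrite -ltNge => rS; have rj : bms_r (b := S) i <= t j by case: (sr i j) => // h; lra.
by rewrite mul0mx addr0 (min_l rj) (min_l (le_trans rj tj)).
Qed.

Lemma bm_simple_int0 w : bm_simple_int W S 0 w = 0.
Proof.
apply: big1 => i _; have /andP[l0 lri] := lr i.
by rewrite !min_r ?subrr ?mulmx0// (le_trans l0).
Qed.

End brownian.

Section poisson.
Context (dU : measure_display) (U : measurableType dU).
Variables (nu : {sigma_finite_measure set U -> \bar R})
  (N : Omega -> {measure set (measurableTypeR R * U) -> \bar R}) (w : Omega).

Lemma compensated0 (A : set U) a b : b <= a ->
  compensated nu N w (`]a, b] `*` A) = 0.
Proof.
move=> ba; rewrite /compensated (_ : _ `*` _ = set0) ?measure0 ?subrr//.
  by rewrite /intensity measure0 subrr.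
apply/seteqP; split => // -[s u] /= [/andP[]]; rewrite !bnd_simp => h1 h2 _.
by have := lt_le_trans h1 h2; rewrite ltNge ba.
Qed.

(** Finiteness of [N w] and of the intensity on the whole strip lets [fine] commute with the
    sums. *)
Lemma compensated_split (A : set U) a b c : measurable A -> (nu A < +oo)%E ->
  0 <= a -> a <= b -> b <= c -> c <= T -> (N w (`]0%R, T] `*` A) < +oo)%E ->
  compensated nu N w (`]a, c] `*` A) =
  compensated nu N w (`]a, b] `*` A) + compensated nu N w (`]b, c] `*` A).
Proof.
move=> mA nA a0 ab bc cT NT.
have mI (x y : R) : measurable (`]x, y] `*` A : set (measurableTypeR R * U)).
  by apply: measurableX => //; exact: measurable_itv.
have acE : `]a, c]%classic `*` A = (`]a, b]%classic `*` A) `|` (`]b, c]%classic `*` A).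
  rewrite (@itv_bndbnd_setU _ _ (BRight a) (BRight b) (BRight c)) ?bnd_simp//.
  apply/seteqP; split => -[s u] /=; first by move=> [[] h Au]; [left|right].
  by move=> [] [] h Au; split => //; [left|right].
have dis : (`]a, b]%classic `*` A) `&` (`]b, c]%classic `*` A) = set0.
  apply/seteqP; split => // -[s u] /= [[/andP[]]]; rewrite !bnd_simp => h1 h2 _.
  by move=> [/andP[]]; rewrite !bnd_simp ltNge h2.
have fin (m : {measure set (measurableTypeR R * U) -> \bar R}) x y : 0 <= x -> y <= T ->
    (m (`]0%R, T] `*` A) < +oo)%E -> m (`]x, y] `*` A) \is a fin_num.
  move=> x0 yT mT; rewrite ge0_fin_numE//; apply: le_lt_trans mT.
  rewrite le_measure ?inE//.
  move=> [s u] /= [/andP[]]; rewrite !bnd_simp => h1 h2 Au; split => //.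
  by rewrite in_itv/= (le_lt_trans x0 h1) (le_trans h2).
have iT : (intensity nu (`]0%R, T] `*` A) < +oo)%E.
  rewrite /intensity [X in (X < _)%E]product_measure1E//.
  have E := @lebesgue_measure_itv R `]0, T]; rewrite /= lte_fin in E.
  rewrite [X in (X * _)%E]E; case: ifP => _; last by rewrite mul0e ltry.
  by rewrite -EFinB lte_mul_pinfty// lee_fin subr0; have := t_ge0 0; have := tT 0; lra.
have b0 : 0 <= b by lra.
have bT : b <= T by lra.
rewrite /compensated acE !measureU//.
rewrite fineD; [|exact: fin|exact: fin].
rewrite /intensity measureU// fineD; [|exact: fin|exact: fin].
ring.
Qed.

Variable S : prm_simple R Omega U d.
Hypotheses (lr : forall i, 0 <= prms_l (p := S) i <= prms_r (p := S) i)
  (sl : forall i, separates t (prms_l (p := S) i))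
  (sr : forall i, separates t (prms_r (p := S) i))
  (mA : forall i, measurable (prms_mark (p := S) i))
  (nA : forall i, (nu (prms_mark (p := S) i) < +oo)%E)
  (NA : forall i, (N w (`]0%R, T] `*` prms_mark (p := S) i) < +oo)%E).

Definition prm_step (j : nat) (w' : Omega) (i : 'I_(prms_size S)) : 'cV[R]_d :=
  if active (prms_l (p := S) i) (prms_r (p := S) i) j then prms_coef i w' else 0.

Lemma prm_simple_fun_step j s u w' : t j < s <= t j.+1 ->
  prm_simple_fun S s u w' = \sum_i (\1_(prms_mark (p := S) i) u : R) *: prm_step j w' i.
Proof.
move=> ts; apply: eq_bigr => i _; rewrite [X in X * _]indicE.
rewrite (_ : (s \in _) = active (prms_l (p := S) i) (prms_r (p := S) i) j).
  by rewrite /prm_step; case: ifP; rewrite ?mul1r// mul0r scale0r scaler0.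
rewrite -(active_itv (sl i) (sr i) ts).
by apply/idP/idP => [/set_mem//|h]; exact/mem_set.
Qed.

Lemma prm_simple_int_step j : prm_simple_int nu N S (t j.+1) w =
  prm_simple_int nu N S (t j) w
  + \sum_i comp_incr nu N (t j) (t j.+1) (prms_mark (p := S)) i w *: prm_step j w i.
Proof.
rewrite -big_split; apply: eq_bigr => i _ /=.
have /andP[l0 lri] := lr i; have tj := tS j.
rewrite /prm_step /active; have [ltj|] := boolP (prms_l (p := S) i <= t j); last first.
  rewrite -ltNge => ltj.
  have ltS : t j.+1 <= prms_l (p := S) i by case: (sl i j) => // h; lra.
  have ltr : t j.+1 <= prms_r (p := S) i by exact: le_trans lri.
  rewrite scaler0 addr0 (min_r ltS) (min_r ltr) (min_r (ltW ltj)) (min_r (le_trans tj ltr)).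
  by rewrite !compensated0 ?scale0r.
have lS : prms_l (p := S) i <= t j.+1 by exact: le_trans tj.
rewrite (min_l lS) (min_l ltj) /=.
have [rS|] := boolP (t j.+1 <= prms_r (p := S) i).
  rewrite (min_r rS) (min_r (le_trans tj rS)).
  by rewrite -scalerDl /comp_incr -compensated_split.
rewrite -ltNge => rS; have rj : prms_r (p := S) i <= t j by case: (sr i j) => // h; lra.
by rewrite scaler0 addr0 (min_l rj) (min_l (le_trans rj tj)).
Qed.

Lemma prm_simple_int0 : prm_simple_int nu N S 0 w = 0.
Proof.
apply: big1 => i _; have /andP[l0 lri] := lr i.
by rewrite !min_r ?(le_trans l0)// compensated0// scale0r.
Qed.

End poisson.

End telescoping.

(** * The grid process of a solution *)

Section grid_process.
Context (R : realType) (d : nat) (dU : measure_display) (U : measurableType dU).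
Variable nu : {sigma_finite_measure set U -> \bar R}.
Context (dO : measure_display) (Omega : measurableType dO).
Variables (P : probability Omega R) (F : R -> set (set Omega)).
Hypothesis F_usual : usual_filtration P F.
Variables (W : R -> Omega -> 'cV[R]_d)
  (N : Omega -> {measure set (measurableTypeR R * U) -> \bar R}).
Hypothesis WN : driving_noises P F nu W N.
Variables (b : 'cV[R]_d -> 'cV[R]_d) (X : R -> Omega -> 'cV[R]_d) (v : 'cV[R]_d).
Hypotheses (cb : continuous b) (adX : adapted F X).
Variables (S : bm_simple R Omega d) (S' : prm_simple R Omega U d).
Hypotheses (okS : bm_simple_ok F S) (okS' : prm_simple_ok F nu S').

Lemma Gm_continuous (G : set (set Omega)) m n (Y : Omega -> 'M[R]_(m, n)) (f : 'M[R]_(m, n) -> R) :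
  continuous f -> sigma_rv Y `<=` G -> Gm G (fun w => f (Y w)).
Proof.
move=> cf YG _ B mB; rewrite setTI; apply: sub_sigma_algebra; apply: YG.
exists (f @^-1` B) => //.
by have := continuous_borel_measurable cf measurableT mB; rewrite setTI.
Qed.

(* Only finitely many values of [b X - v] matter; truncating them keeps the increments bounded. *)
Definition drift (t : nat -> R) (B : R) (j : nat) (w : Omega) : 'cV[R]_d :=
  let u := b (X (t j) w) - v in if enorm u <= B then u else 0.

Let p := prms_size S'.
Let mark : 'I_p -> set U := @prms_mark _ _ _ _ _ _ S'.

Definition mark_cov (i k : 'I_(prms_size S')) : R :=
  fine (nu (prms_mark i `&` prms_mark k)).

Definition grid_tube (t : nat -> R) (B : R) : nat -> Omega -> 'cV[R]_d :=
  tube t (fun j => dW W (t j) (t j.+1)) (fun j => comp_incr nu N (t j) (t j.+1) mark)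
    (drift t B) (bm_step t S) (prm_step t (S := S')).

Definition grid_deficit (r kap : R) (t : nat -> R) (B : R) : nat -> Omega -> R :=
  deficit t r (nmom R 1) kap mark_cov (fun j => dW W (t j) (t j.+1))
    (fun j => comp_incr nu N (t j) (t j.+1) mark)
    (drift t B) (bm_step t S) (prm_step t (S := S')).

Definition grid_alive (r kap eps : R) (t : nat -> R) (B : R) : nat -> Omega -> R :=
  alive t r (nmom R 1) kap eps mark_cov (fun j => dW W (t j) (t j.+1))
    (fun j => comp_incr nu N (t j) (t j.+1) mark)
    (drift t B) (bm_step t S) (prm_step t (S := S')).

Let sum_mono (q : nat) (f g : 'I_q -> R) : (forall i, f i <= g i) -> \sum_i f i <= \sum_i g i.
Proof. by move=> fg; apply: ler_sum => i _. Qed.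

Let enorm_sum (m n q : nat) (f : 'I_q -> 'M[R]_(m, n)) : enorm (\sum_i f i) <= \sum_i enorm (f i).
Proof.
elim/big_rec2: _ => [|i x y _ h]; first by rewrite enorm0.
by apply: le_trans (enormD _ _) _; rewrite lerD2l.
Qed.

Lemma bm_step_bounded : exists K, forall t j w, enorm (bm_step t S j w) <= K.
Proof.
have /choice[f Hf] : forall i, exists M : R, forall w, enorm (bms_coef (b := S) i w) <= M.
  by move=> i; case: (okS i).
exists (\sum_i `|f i|) => t j w.
apply: le_trans (enorm_sum _) _; apply: sum_mono => i.
by case: ifP => _; rewrite ?enorm0// (le_trans (Hf i w))// ler_norm.
Qed.

Lemma prm_step_bounded : exists K, forall t j w i, enorm (prm_step t (S := S') j w i) <= K.
Proof.
have /choice[f Hf] : forall i, exists M : R, forall w, enorm (prms_coef (p := S') i w) <= M.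
  by move=> i; case: (okS' i).
exists (\sum_i `|f i|) => t j w i.
have le : `|f i| <= \sum_i `|f i|.
  by rewrite (bigD1 i)//= lerDl sumr_ge0.
rewrite /prm_step; case: ifP => _; first exact: le_trans (le_trans (Hf i w) (ler_norm _)) le.
by rewrite enorm0 (le_trans _ le).
Qed.

(** One set of finite measure containing every mark: its count is the variable that dominates the
    jump counts of a step. *)
Definition all_marks : set U := \big[setU/set0]_(i < prms_size S') prms_mark i.

Lemma all_marks_finite : measurable all_marks /\ (nu all_marks < +oo)%E.
Proof.
rewrite /all_marks; elim/big_ind: _ => [|A A' [mA nA] [mA' nA']|i _].
- by split => //; rewrite measure0.
- split; first exact: measurableU.
  by apply: le_lt_trans (measureU2 _ mA mA') _; exact: lte_add_pinfty.
- by case: (okS' i).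
Qed.

Lemma sub_all_marks i : mark i `<=` all_marks.
Proof. by rewrite /all_marks (bigD1 i)//= => u; left. Qed.

Section fixed_grid.
Variables (t : nat -> R) (B : R).
Hypotheses (t0 : t 0 = 0) (tS : forall j, t j <= t j.+1).
Hypotheses (B0 : 0 <= B).

Let t_ge0 j : 0 <= t j.
Proof. by elim: j => [|j IH]; rewrite ?t0// (le_trans IH). Qed.

Let sF j : sub_sigma (F (t j)).
Proof. exact: (F_sub_sigma F_usual). Qed.

Let FS j : F (t j) `<=` F (t j.+1).
Proof. exact: (F_mono F_usual). Qed.

Let bdrift j i : bGm (F (t j)) (fun w => drift t B j w i 0).
Proof.
have cont (f : 'cV[R]_d -> R) : continuous f -> continuous (fun y => f (b y - v)).
  move=> cf y; apply: (@continuous_comp _ _ _ b (fun y => f (y - v))); first exact: cb.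
  apply: (@continuous_comp 'cV[R]_d 'cV[R]_d R (fun y => y - v) f); first exact: subr_mx_continuous.
  exact: cf.
split; last first.
  exists B => w; rewrite (le_trans (enorm_entry _ _ _))// /drift.
  by case: ifP => //; rewrite enorm0.
rewrite (_ : (fun w => _) = fun w =>
    if enorm (b (X (t j) w) - v) <= B then (b (X (t j) w) - v) i 0 else 0); last first.
  by apply/funext => w; rewrite /drift; case: ifP => //; rewrite mxE.
apply: Gm_if_le; [|exact: Gm_cst| |exact: Gm_cst].
  apply: (@Gm_continuous _ _ _ (X (t j)) (fun y => enorm (b y - v))); last exact: adX.
  exact/cont/enorm_continuous.
apply: (@Gm_continuous _ _ _ (X (t j)) (fun y => (b y - v) i 0)); last exact: adX.
by apply: (cont (fun y => y i 0)); exact: entry_continuous.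
Qed.

Let bcoef m n (Y : Omega -> 'M[R]_(m, n)) l r j i k (M : R) : 0 <= l ->
  sigma_rv Y `<=` F l -> (forall w, enorm (Y w) <= M) ->
  bGm (F (t j)) (fun w => (if active t l r j then Y w else 0) i k).
Proof.
move=> l0 YF YM; have [/andP[lt _]|_] := boolP (active t l r j); last first.
  by rewrite (_ : (fun _ => _) = fun=> 0); [exact: bGm_cst|apply/funext => w; rewrite mxE].
apply: (bGm_mono F_usual l0 lt); split; first exact: sigma_rv_entry.
by exists M => w; rewrite (le_trans (enorm_entry _ _ _)).
Qed.

Let bbm j i k : bGm (F (t j)) (fun w => bm_step t S j w i k).
Proof.
rewrite /bm_step; under eq_fun do rewrite summxE.
apply: bGm_sum => l; case: (okS l) => l0 lr sF' [M HM].
exact: bcoef sF' HM.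
Qed.

Let bprm j i k : bGm (F (t j)) (fun w => prm_step t (S := S') j w i k 0).
Proof.
rewrite /prm_step; case: (okS' i) => [[l0 lr] mA nA sF' [M HM]].
exact: bcoef sF' HM.
Qed.

Let step0 j : t j.+1 - t j = 0 -> t j.+1 = t j.
Proof. by move=> /eqP; rewrite subr_eq0 => /eqP. Qed.

Let g0 j l w : t j.+1 - t j = 0 -> dW W (t j) (t j.+1) l w = 0.
Proof. by move=> /step0 ->; rewrite /dW subrr mxE. Qed.

Let n0 j i w : t j.+1 - t j = 0 -> comp_incr nu N (t j) (t j.+1) mark i w = 0.
Proof. by move=> /step0 ->; rewrite /comp_incr compensated0. Qed.

Let mmark i : measurable (mark i). Proof. by case: (okS' i). Qed.

Let mg j l : Gm (F (t j.+1)) (dW W (t j) (t j.+1) l).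
Proof.
have [tj|tj] := eqVneq (t j.+1 - t j) 0.
  rewrite (_ : dW _ _ _ _ = fun=> 0); first exact: Gm_cst.
  by apply/funext => w; exact: g0.
apply: (Gm_dW F_usual WN) => //.
by rewrite lt_neqAle tS andbT eq_sym -subr_eq0.
Qed.

Let mn j i : Gm (F (t j.+1)) (comp_incr nu N (t j) (t j.+1) mark i).
Proof.
have [tj|tj] := eqVneq (t j.+1 - t j) 0.
  rewrite (_ : comp_incr _ _ _ _ _ _ = fun=> 0); first exact: Gm_cst.
  by apply/funext => w; exact: n0.
have [mA nA] := all_marks_finite.
apply: (Gm_comp_incr WN _ _ mmark mA nA sub_all_marks) => //.
by rewrite lt_neqAle tS andbT eq_sym -subr_eq0.
Qed.

Lemma measurable_grid_tube j i : measurable_fun setT (fun w => grid_tube t B j w i 0).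
Proof.
apply: (Gm_meas (sF j)).
exact: (@Gm_tube _ _ _ _ _ (fun j => F (t j)) sF FS t _ _ _ _ _ mg mn bdrift bbm bprm).
Qed.

Lemma measurable_grid_alive r kap eps j : measurable_fun setT (grid_alive r kap eps t B j).
Proof.
apply: (Gm_meas (sF j)).
exact: (@Gm_alive _ _ _ _ _ (fun j => F (t j)) sF FS t _ _ _ _ _ _ _ _ _ _ mg mn bdrift bbm bprm).
Qed.

Lemma grid_bound_fixed (r L C kap eps : R) M :
  step_estimate P d p r L (nmom R 1) (nmom R 2 + nmom R 4) C -> 0 < r -> 0 <= C ->
  fine (nu all_marks) <= L -> (forall j w, enorm (bm_step t S j w) <= L) ->
  (forall j w i, enorm (prm_step t (S := S') j w i) <= L) ->
  1 <= B -> (forall j, (t j.+1 - t j) * B ^+ 4 <= 1) -> 0 <= kap ->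
  (forall j, kap * (t j.+1 - t j) <= 2^-1) -> 0 <= eps ->
  r ^+ 6 <= expR (2 * kap * t M) *
    (Ex P (fun w => grid_alive r kap eps t B M w * barrier r (grid_tube t B M w))
     + 2 * r ^+ 6 * (1 - Ex P (grid_alive r kap eps t B M)) + eps + C * (t M / B)).
Proof.
move=> HC r0 C0 nuL SL S'L B1 hB kap0 hkap eps0; have [mA nA] := all_marks_finite.
apply: (@tube_bound _ _ _ _ _ _ (fun j => F (t j)) sF FS t r L (nmom R 1) (nmom R 2 + nmom R 4) C
  (fine (nu all_marks)) B kap eps mark_cov _ _ (fun j => cnt N (t j) (t j.+1) all_marks)) => //.
- by rewrite fine_ge0.
- move=> j hj; apply: (noise_increment F_usual WN) => //; first by rewrite -subr_gt0.
  exact: sub_all_marks.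
- move=> j w; rewrite /drift.
  by have [//|_] := boolP (enorm (b (X (t j) w) - v) <= B); rewrite enorm0.
Qed.

End fixed_grid.

(** [C] depends on [S] and [S'] through their bounds, but it is chosen before the grid, [B], [kap]
    and [eps]. With the simple integrands fixed, the last term therefore vanishes as [B] grows. *)
Lemma grid_bound (r : R) : 0 < r -> exists2 C : R, 0 <= C &
  forall (t : nat -> R) (B kap eps : R) M,
  t 0 = 0 -> (forall j, t j <= t j.+1) -> 1 <= B ->
  (forall j, (t j.+1 - t j) * B ^+ 4 <= 1) -> 0 <= kap ->
  (forall j, kap * (t j.+1 - t j) <= 2^-1) -> 0 <= eps ->
  r ^+ 6 <= expR (2 * kap * t M) *
    (Ex P (fun w => grid_alive r kap eps t B M w * barrier r (grid_tube t B M w))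
     + 2 * r ^+ 6 * (1 - Ex P (grid_alive r kap eps t B M)) + eps + C * (t M / B)).
Proof.
move=> r0; have [K1 HK1] := bm_step_bounded; have [K2 HK2] := prm_step_bounded.
have [mA nA] := all_marks_finite.
pose L := 1 + `|K1| + `|K2| + fine (nu all_marks).
have f0 : 0 <= fine (nu all_marks) by rewrite fine_ge0.
have k1 := normr_ge0 K1; have k2 := normr_ge0 K2.
have L1 : 1 <= L by rewrite /L; lra.
have m20 : 0 <= nmom R 1 by exact: nmom_ge0.
have Cg0 : 0 <= nmom R 2 + nmom R 4 by rewrite addr_ge0// nmom_ge0.
have [C C0 HC] : exists2 C, 0 <= C &
    step_estimate P d p r L (nmom R 1) (nmom R 2 + nmom R 4) C by exact: one_step.
exists C => // t B kap eps M t0 tS B1 hB kap0 hkap eps0.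
have B0 : 0 <= B by rewrite (le_trans _ B1).
apply: (@grid_bound_fixed t B t0 tS B0 r L C) => //.
- by rewrite /L; lra.
- by move=> j w; rewrite (le_trans (HK1 _ _ _))// (le_trans (ler_norm _))// /L; lra.
- by move=> j w i; rewrite (le_trans (HK2 _ _ _ _))// (le_trans (ler_norm _))// /L; lra.
Qed.

End grid_process.

Section integral_lemmas.
Context (d : measure_display) (T : measurableType d) (R : realType).
Variable mu : {measure set T -> \bar R}.

(* No measurability is assumed: the integral of a nonnegative function is a supremum. *)
Lemma ge0_integral_domain_mono (A B : set T) (f : T -> \bar R) :
  (forall x, (0 <= f x)%E) -> A `<=` B ->
  (\int[mu]_(x in A) f x <= \int[mu]_(x in B) f x)%E.
Proof.
move=> f0 AB; rewrite !ge0_integralE//.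
apply: ereal_sup_le => _ [h /= hA <-]; exists h => //= x.
apply: (le_trans (hA x)); rewrite !patchE; case: ifPn => [/set_mem xA|_].
  by rewrite mem_set//; exact: AB.
by case: ifP.
Qed.

(** Identifies the double sum of [bracket] with a squared [L^2] norm; the marks need not be
    disjoint, so their intersections occur. *)
Lemma integral_simple_quadratic (p dim : nat) (A : 'I_p -> set T) (e : 'I_p -> 'cV[R]_dim) :
  (forall i, measurable (A i)) -> (forall i, (mu (A i) < +oo)%E) ->
  (\int[mu]_x (enorm (\sum_i (\1_(A i) x : R) *: e i) ^+ 2)%:E)%E =
  (\sum_i \sum_k fine (mu (A i `&` A k)) * dotv (e i) (e k))%:E.
Proof.
move=> mA nA.
have mI i k : measurable (A i `&` A k) by exact: measurableI.
have nI i k : (mu (A i `&` A k) < +oo)%E.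
  by apply: le_lt_trans (nA i); rewrite le_measure ?inE//; exact: subIsetl.
pose f (ik : 'I_p * 'I_p) x : \bar R :=
  ((dotv (e ik.1) (e ik.2))%:E * (\1_(A ik.1 `&` A ik.2) x)%:E)%E.
have indI i k : mu.-integrable setT (fun x => (\1_(A i `&` A k) x : R)%:E).
  apply/integrableP; split; first exact/measurable_EFinP/measurable_indic.
  under eq_integral => x _ do rewrite gee0_abs ?lee_fin//.
  by rewrite integral_indic// setIT.
have fi ik : mu.-integrable setT (f ik).
  by apply: integrableZl.
transitivity (\int[mu]_x (\sum_ik f ik x))%E.
  apply: eq_integral => x _; rewrite enorm_dotv dotv_suml -(pair_big xpredT xpredT (fun i k => f (i, k) x))/=.
  rewrite -sumEFin; apply: eq_bigr => i _; rewrite dotv_sumr -sumEFin; apply: eq_bigr => k _.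
  rewrite /f dotvZl dotvZr -EFinM; congr EFin; rewrite /= indicI /=; ring.
rewrite (integral_sum measurableT fi).
rewrite -sumEFin; under [RHS]eq_bigr do rewrite -sumEFin.
rewrite pair_big/=; apply: eq_bigr => ik _.
rewrite /f integralZl//.
by rewrite integral_indic// setIT muleC EFinM fineK// ge0_fin_numE.
Qed.

End integral_lemmas.

Section right_continuous.
Context (R : realType).

(** Approximation by the value at the right end of the cell, which is at or just after [s]. *)
Lemma right_continuous_measurable (f : R -> R) :
  (forall t, 0 < t -> f s @[s --> t^'+] --> f t) ->
  measurable_fun (`]0, +oo[%classic : set R) f.
Proof.
move=> rf.
have H : measurable_fun (`]0, +oo[ `*` setT : set (measurableTypeR R * measurableTypeR R))
    (fun z => f z.1).
  apply: (@measurable_cell_limit R _ _ (fun n m _ => f (m.+1%:R / n.+1%:R)) (fun s _ => f s)).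
    by move=> n m; exact: measurable_cst.
  move=> s u e s0 e0.
  have [r /= r0 Hr] := (cvgrPdist_lt _ _).1 (rf s s0) e e0.
  exists (Num.truncn r^-1) => n m n0n /andP[ms sm].
  have nr : n.+1%:R^-1 < r.
    rewrite invf_plt ?posrE ?ltr0n//; apply: lt_le_trans (truncnS_gt _) _.
    by rewrite ler_nat ltnS.
  have bE : m.+1%:R / n.+1%:R = m%:R / n.+1%:R + n.+1%:R^-1 :> R.
    by rewrite -[m.+1%:R](natr1 m) mulrDl mul1r.
  have sr : m.+1%:R / n.+1%:R < s + r.
    by rewrite bE; exact: ltrD.
  move: sm; rewrite le_eqVlt => /orP[/eqP <-|sm]; first by rewrite subrr normr0.
  rewrite distrC; apply: Hr => //=; rewrite ltr_distlC; apply/andP; split.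
    by rewrite ltrBlDr (lt_trans sm)// ltrDl.
  exact: sr.
have -> : f = (fun z : measurableTypeR R * measurableTypeR R => f z.1) \o (fun s => (s, 0)) by [].
apply: (measurable_comp _ _ H) => //.
- by apply: measurableX => //; exact: measurable_itv.
- by move=> _ [s s0 <-].
- by apply: measurable_funTS; exact: pair2_measurable.
Qed.

Lemma cadlag_comp_measurable m n (f : R -> 'M[R]_(m, n)) (g : 'M[R]_(m, n) -> R) :
  cadlag f -> continuous g -> measurable_fun (`]0, +oo[%classic : set R) (g \o f).
Proof.
move=> [rf _] cg; apply: right_continuous_measurable => t t0.
exact: (@cvg_comp _ _ _ f g _ (nbhs (f t)) _ (rf t (ltW t0)) (cg (f t))).
Qed.

(** Approximation by the value at the left end of the cell. As cells are left-open, this end is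
    strictly before [s], so the values converge to the left limit even at a jump. *)
Lemma left_limit_measurable (dU : measure_display) (U : measurableType dU) d
    (f : R -> 'cV[R]_d) (c : 'cV[R]_d -> U -> R) :
  cadlag f -> (forall u, continuous (c ^~ u)) -> (forall x, measurable_fun setT (c x)) ->
  measurable_fun (`]0, +oo[ `*` setT : set (measurableTypeR R * U))
    (fun z => c (left_lim f z.1) z.2).
Proof.
move=> cf cc mc.
apply: (@measurable_cell_limit R _ _ (fun n m u => c (f (m%:R / n.+1%:R)) u)
  (fun s u => c (left_lim f s) u)) => //.
move=> s u e s0 e0.
have H : c (f s') u @[s' --> s^'-] --> c (left_lim f s) u.
  exact: (@cvg_comp _ _ _ f (c ^~ u) _ (nbhs (left_lim f s)) _ (cadlag_cvg_left cf s0) (cc u _)).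
have [r /= r0 Hr] := (cvgrPdist_lt _ _).1 H e e0.
exists (Num.truncn r^-1) => n m n0n /andP[ms sm].
have nr : n.+1%:R^-1 < r.
  rewrite invf_plt ?posrE ?ltr0n//; apply: lt_le_trans (truncnS_gt _) _.
  by rewrite ler_nat ltnS.
have bE : m.+1%:R / n.+1%:R = m%:R / n.+1%:R + n.+1%:R^-1 :> R.
  by rewrite -[m.+1%:R](natr1 m) mulrDl mul1r.
have sr : s < m%:R / n.+1%:R + r.
  by apply: (le_lt_trans sm); rewrite bE ltrD2l.
rewrite distrC; apply: Hr => //=; rewrite ltr_distlC; apply/andP; split.
  by rewrite ltrBlDr.
by rewrite (lt_trans ms)// ltrDl.
Qed.

End right_continuous.

(** * Comparison of the grid process with one path of the solution *)

Section pathwise.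
Context (R : realType) (d : nat) (dU : measure_display) (U : measurableType dU).
Variable nu : {sigma_finite_measure set U -> \bar R}.
Context (dO : measure_display) (Omega : measurableType dO).
Variables (W : R -> Omega -> 'cV[R]_d)
  (N : Omega -> {measure set (measurableTypeR R * U) -> \bar R}).
Variables (b : 'cV[R]_d -> 'cV[R]_d) (X : R -> Omega -> 'cV[R]_d) (x v : 'cV[R]_d).
Hypothesis cb : continuous b.
Variables (S : bm_simple R Omega d) (S' : prm_simple R Omega U d).
Hypotheses (lrS : forall i, 0 <= bms_l (b := S) i <= bms_r (b := S) i)
  (lrS' : forall i, 0 <= prms_l (p := S') i <= prms_r (p := S') i)
  (mA : forall i, measurable (prms_mark (p := S') i))
  (nA : forall i, (nu (prms_mark (p := S') i) < +oo)%E).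
Variables (T : R) (w : Omega).
Hypotheses (T0 : 0 <= T) (cX : cadlag (X ^~ w)).
Hypothesis NA : forall i, (N w (`]0%R, T] `*` prms_mark (p := S') i) < +oo)%E.

Definition adapted_grid (t : nat -> R) : Prop :=
  [/\ t 0 = 0, forall j, t j <= t j.+1, forall j, t j <= T,
      forall i, separates t (bms_l (b := S) i) /\ separates t (bms_r (b := S) i)
    & forall i, separates t (prms_l (p := S') i) /\ separates t (prms_r (p := S') i)].

(** The endpoints of the simple integrands are separated by the grid, so both stochastic sums are
    exact; only the drift is discretized. *)
Lemma grid_tubeE (t : nat -> R) (B : R) j : adapted_grid t ->
  grid_tube nu W N b X v S S' t B j w =
  \sum_(i < j) (t i.+1 - t i) *: drift b X v t B i w
  + bm_simple_int W S (t j) w + prm_simple_int nu N S' (t j) w.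
Proof.
move=> [t0 tS tT sS sS'].
have slS i := (sS i).1; have srS i := (sS i).2.
have slS' i := (sS' i).1; have srS' i := (sS' i).2.
elim: j => [|j IH].
  by rewrite big_ord0 t0 bm_simple_int0// prm_simple_int0// !addr0.
rewrite /grid_tube /= -/(grid_tube nu W N b X v S S' t B j w) /stepz IH.
rewrite big_ord_recr/= (bm_simple_int_step tS W lrS slS srS).
rewrite (prm_simple_int_step t0 tS tT lrS' slS' srS' mA nA NA).
have -> : \col_l dW W (t j) (t j.+1) l w = W (t j.+1) w - W (t j) w.
  by apply/matrixP => l k; rewrite !mxE ord1 /dW !mxE.
set A1 := \sum_(i < j) _; set A2 := _ *: drift _ _ _ _ _ _ _; set A3 := bm_simple_int _ _ _ _.
set A4 := prm_simple_int _ _ _ _ _; set A5 := _ *m _; set A6 := \sum_i _.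
by clearbody A1 A2 A3 A4 A5 A6; apply/matrixP => i k; rewrite !mxE; ring.
Qed.

Lemma enorm_le_entries (u : 'cV[R]_d) (m : R) : 0 <= m -> (forall i, `|u i 0| <= m) ->
  enorm u <= d%:R * m.
Proof.
move=> m0 um; rewrite -(@ler_pXn2r _ 2)// ?nnegrE ?enorm_ge0 ?mulr_ge0//.
rewrite enorm_sqr (@le_trans _ _ (\sum_(i < d) m ^+ 2))//.
  apply: ler_sum => i _; rewrite big_ord1 -real_normK ?num_real//.
  by rewrite ler_pXn2r ?nnegrE.
rewrite sumr_const card_ord -[leLHS]mulr_natl exprMn ler_wpM2r ?sqr_ge0//.
by rewrite -natrX ler_nat; case: d => // k; rewrite expnS expn1 leq_pmull.
Qed.

(** Each stochastic integral costs one [delta] and the Riemann sum of the drift a third. The mesh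
    [e0] and the level [B0], beyond which the truncation of the drift is inactive, depend on the
    path. *)
Lemma grid_tube_tracking (I J : R -> Omega -> 'cV[R]_d) (delta : R) : 0 < delta ->
  (forall t, 0 <= t -> X t w = x
     + (\col_i \int[lebesgue_measure]_(s in `[0, t]) (b (X s w) i 0)) + I t w + J t w) ->
  (forall s, 0 <= s <= T -> enorm (bm_simple_int W S s w - I s w) <= delta) ->
  (forall s, 0 <= s <= T -> enorm (prm_simple_int nu N S' s w - J s w) <= delta) ->
  exists (e0 B0 : R), 0 < e0 /\ forall (t : nat -> R) (B : R),
    adapted_grid t -> (forall j, t j.+1 - t j <= e0) -> B0 <= B ->
    (forall j, drift b X v t B j w = b (X (t j) w) - v) /\
    (forall j, enorm (grid_tube nu W N b X v S S' t B j w - (X (t j) w - x - t j *: v))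
       <= 3 * delta).
Proof.
move=> delta0 XE SI S'J.
have [Kx HKx] := cadlag_bounded cX T0.
have [Kb HKb] := @continuous_enorm_bounded _ _ _ _ b Kx cb.
pose K := `|Kb|.
have K0 : 0 <= K by exact: normr_ge0.
have bK s : 0 <= s <= T -> enorm (b (X s w)) <= K.
  by move=> sT; rewrite (le_trans (HKb _ (HKx s sT)))// ler_norm.
pose d' : R := d%:R + 1.
have d'0 : 0 < d' by rewrite /d' ltr_wpDl// ler0n.
(* On steps free of points of [D] the drift oscillates by at most [e], which costs at most [T * e].
   The other steps have total length at most [size D] times [e0] and cost [2 * K] per unit of time.
   Each part is at most [delta / (2 * d')], and [d'] pays for the passage from entries to the
   norm. *)
pose e := delta / (2 * d' * (T + 1)).
have T10 : 0 < T + 1 by rewrite ltr_wpDl.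
have e_gt0 : 0 < e by rewrite divr_gt0// !mulr_gt0.
have [D HD] := cadlag_partition cX cb T0 e_gt0.
pose q : R := 1 + 2 * K * (size D)%:R.
have q0 : 0 < q by rewrite /q ltr_pwDl// !mulr_ge0.
pose e0 := delta / (2 * d' * q).
have e00 : 0 < e0 by rewrite divr_gt0// !mulr_gt0.
exists e0, (K + enorm v); split => // t B gt te KB.
have [t0 tS tT sS sS'] := gt.
have t_ge0 j : 0 <= t j by elim: j => [|j IH]; rewrite ?t0// (le_trans IH).
have driftE j : drift b X v t B j w = b (X (t j) w) - v.
  rewrite /drift ifT//; apply: le_trans (enormD _ _) _; rewrite enormN.
  by apply: le_trans KB; rewrite lerD2r bK// t_ge0 tT.
split => // j.
pose Sb := \sum_(i < j) (t i.+1 - t i) *: b (X (t i) w).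
pose Ib : 'cV[R]_d := \col_i \int[lebesgue_measure]_(s in `[0, t j]) (b (X s w) i 0).
have sumh : \sum_(i < j) (t i.+1 - t i) = t j.
  by elim: j {Sb Ib} => [|j IH]; rewrite ?big_ord0 ?t0// big_ord_recr/= IH addrC subrK.
have Sdrift : \sum_(i < j) (t i.+1 - t i) *: drift b X v t B i w = Sb - t j *: v.
  under eq_bigr do rewrite driftE scalerBr.
  by rewrite big_split/= sumrN -scaler_suml sumh.
have SI' : enorm (Sb - Ib) <= delta.
  pose err i : R := e + (if has (fun p => t i < p <= t i.+1) D then 2 * K else 0).
  have errs : \sum_(i < j) (t i.+1 - t i) * err i <= delta / d'.
    rewrite /err; under eq_bigr do rewrite mulrDr.
    rewrite big_split/= -mulr_suml sumh.
    have -> : \sum_(i < j) (t i.+1 - t i) * (if has (fun p => t i < p <= t i.+1) D then 2 * K else 0)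
        = (\sum_(i < j | has (fun p => t i < p <= t i.+1) D) (t i.+1 - t i)) * (2 * K).
      rewrite mulr_suml [RHS]big_mkcond; apply: eq_bigr => i _.
      by case: ifP => _; rewrite ?mulr0.
    have bad := bad_steps D j tS te (ltW e00).
    have h1 : t j * e <= delta / (2 * d').
      have -> : delta / (2 * d') = (T + 1) * e by rewrite /e; field; rewrite !gt_eqF//; lra.
      by apply: ler_wpM2r; [exact: ltW|have := tT j; lra].
    have h2 : ((size D)%:R * e0) * (2 * K) <= delta / (2 * d').
      have -> : delta / (2 * d') = q * e0 by rewrite /e0; field; rewrite !gt_eqF.
      rewrite mulrAC; apply: ler_wpM2r; first exact: ltW.
      by rewrite /q mulrC; lra.
    have h3 := ler_wpM2r (_ : 0 <= 2 * K) bad; have {}h3 := h3 ltac:(by rewrite mulr_ge0).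
    have -> : delta / d' = delta / (2 * d') + delta / (2 * d') by field; rewrite gt_eqF.
    lra.
  have ent i : `|(Sb - Ib) i 0| <= delta / d'.
    rewrite !mxE distrC summxE; apply: le_trans errs.
    have -> : \sum_(k < j) ((t k.+1 - t k) *: b (X (t k) w)) i 0
        = \sum_(k < j) (t k.+1 - t k) * b (X (t k) w) i 0.
      by apply: eq_bigr => k _; rewrite mxE.
    apply: (@riemann_sum_error R t T t0 tS tT (fun s => b (X s w) i 0)
      (fun k => b (X (t k) w) i 0) err j K).
    - have sub : `]0, T]%classic `<=` (`]0, +oo[%classic : set R).
        by move=> s /=; rewrite !in_itv/= => /andP[-> _].
      apply: (measurable_funS _ sub); first exact: measurable_itv.
      apply: (@cadlag_comp_measurable R _ _ (X ^~ w) (fun y => b y i 0)) => //.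
      move=> y; apply: (@continuous_comp _ _ _ b (fun A => A i 0)); first exact: cb.
      exact: entry_continuous.
    - by move=> s /andP[s0 sT]; rewrite (le_trans (enorm_entry _ _ _))// bK// (ltW s0).
    - move=> k s /andP[ts st].
      have entB : `|b (X s w) i 0 - b (X (t k) w) i 0| <= enorm (b (X (t k) w) - b (X s w)).
        rewrite distrC; have := enorm_entry (b (X (t k) w) - b (X s w)) i 0.
        by rewrite !mxE.
      apply: (le_trans entB); rewrite /err.
      have sT : s <= T by rewrite (le_trans st).
      have [bad|good] := boolP (has _ D).
        apply: le_trans (enormD _ _) _; rewrite enormN.
        have := bK (t k); rewrite t_ge0 tT => /(_ isT).
        have := bK s; rewrite sT (le_trans (t_ge0 k) (ltW ts)) => /(_ isT).
        by have := e_gt0; lra.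
      rewrite addr0; apply: HD => //; first exact: ltW.
      apply: contra good => /hasP[p pD /andP[h1 h2]]; apply/hasP; exists p => //.
      by rewrite h1 (le_trans h2).
  apply: le_trans (enorm_le_entries _ ent) _; first by rewrite divr_ge0// ltW.
  by rewrite mulrCA ler_piMr ?(ltW delta0)// ler_pdivrMr// mul1r /d' lerDl.
rewrite grid_tubeE// Sdrift XE//.
set A3 := bm_simple_int _ _ _ _; set A4 := prm_simple_int _ _ _ _ _.
have -> : Sb - t j *: v + A3 + A4 - (x + Ib + I (t j) w + J (t j) w - x - t j *: v)
   = (Sb - Ib) + (A3 - I (t j) w) + (A4 - J (t j) w).
  by apply/matrixP => i k; rewrite !mxE; ring.
have h1 := enormD (Sb - Ib + (A3 - I (t j) w)) (A4 - J (t j) w).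
have h2 := enormD (Sb - Ib) (A3 - I (t j) w).
have h3 := SI (t j); rewrite t_ge0 tT in h3; have {}h3 := h3 isT.
have h4 := S'J (t j); rewrite t_ge0 tT in h4; have {}h4 := h4 isT.
apply: (le_trans h1); rewrite -/A3 in h3; rewrite -/A4 in h4; lra.
Qed.

End pathwise.

Lemma tonelli_strip (R : realType) (dU : measure_display) (U : measurableType dU)
    (nu : {sigma_finite_measure set U -> \bar R}) (D : set (measurableTypeR R))
    (g : measurableTypeR R * U -> \bar R) :
  measurable D -> measurable_fun (D `*` setT) g -> (forall z, (0 <= g z)%E) ->
  measurable_fun D (fun s => \int[nu]_u g (s, u))%E /\
  (\int[@lebesgue_measure R]_(s in D) \int[nu]_u g (s, u) =
   \int[intensity nu]_(z in D `*` setT) g z)%E.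
Proof.
move=> mD mg g0.
have mDU : measurable (D `*` [set: U]) by exact: measurableX.
have mr : measurable_fun setT (g \_ (D `*` [set: U])) by have := (measurable_restrictT g mDU).1 mg.
have r0 z : (0 <= (g \_ (D `*` [set: U])) z)%E by rewrite patchE; case: ifP.
have E : fubini_F nu (g \_ (D `*` [set: U])) = (fun s => \int[nu]_u g (s, u))%E \_ D.
  apply/funext => s; rewrite /fubini_F patchE; case: ifPn => sD.
    apply: eq_integral => u _; rewrite patchE ifT//.
    by apply/mem_set; split => //; exact: set_mem.
  rewrite -[RHS](integral0 nu setT); apply: eq_integral => u _; rewrite patchE ifF//.
  by apply/negbTE; apply: contra sD => /set_mem[/= Ds _]; exact/mem_set.
split.
  apply/(measurable_restrictT _ mD); rewrite -E.
  exact: measurable_fun_fubini_tonelli_F.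
rewrite integral_mkcond -E [RHS]integral_mkcond; apply/esym.
exact: fubini_tonelli1.
Qed.

Section no_stopping.
Context (R : realType) (d : nat) (dU : measure_display) (U : measurableType dU).
Variable nu : {sigma_finite_measure set U -> \bar R}.
Context (dO : measure_display) (Omega : measurableType dO).
Variables (W : R -> Omega -> 'cV[R]_d)
  (N : Omega -> {measure set (measurableTypeR R * U) -> \bar R}).
Variables (b : 'cV[R]_d -> 'cV[R]_d) (sigma : 'cV[R]_d -> 'M[R]_d)
  (c : 'cV[R]_d -> U -> 'cV[R]_d).
Variables (X : R -> Omega -> 'cV[R]_d) (x v : 'cV[R]_d).
Hypotheses (csigma : continuous sigma) (cc : forall u, continuous (c ^~ u))
  (mc : forall y i, measurable_fun setT (fun u => c y u i 0)).
Variables (S : bm_simple R Omega d) (S' : prm_simple R Omega U d).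
Hypotheses (mA : forall i, measurable (prms_mark (p := S') i))
  (nA : forall i, (nu (prms_mark (p := S') i) < +oo)%E).
Variables (T : R) (w : Omega).
Hypotheses (T0 : 0 <= T) (cX : cadlag (X ^~ w)).

Let Tpos := (`]0, T]%classic : set (measurableTypeR R)).
Let Tpos_sub : Tpos `<=` (`]0, +oo[%classic : set R).
Proof. by move=> s; rewrite /Tpos /= !in_itv/= => /andP[-> _]. Qed.
Let mTpos : measurable Tpos. Proof. exact: measurable_itv. Qed.

Let phi1 (s : R) : R := enorm (bm_simple_fun S s w - sigma (X s w)) ^+ 2.
Let g (z : measurableTypeR R * U) : R :=
  enorm (prm_simple_fun S' z.1 z.2 w - c (left_lim (X ^~ w) z.1) z.2) ^+ 2.
Let phi2 (s : R) : \bar R := (\int[nu]_u (g (s, u))%:E)%E.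

Let mphi1 : measurable_fun Tpos phi1.
Proof.
rewrite /phi1; under eq_fun do rewrite enorm_sqr.
apply: measurable_sum => i; apply: measurable_sum => k; apply: measurable_funX.
under eq_fun do rewrite mxE [X in _ + X]mxE summxE.
apply: measurable_funB.
  apply: measurable_sum => l; under eq_fun do rewrite mxE.
  apply: measurable_funM => //; apply: measurable_indic; exact: measurable_itv.
apply: (measurable_funS _ Tpos_sub); first exact: measurable_itv.
apply: (@cadlag_comp_measurable R _ _ (X ^~ w) (fun y => sigma y i k)) => //.
move=> y; apply: (@continuous_comp _ _ _ sigma (fun A => A i k)); first exact: csigma.
exact: entry_continuous.
Qed.

Let mg : measurable_fun (Tpos `*` setT) g.
Proof.
rewrite /g; under eq_fun do rewrite enorm_sqr.
apply: measurable_sum => i; apply: measurable_sum => k; apply: measurable_funX.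
under eq_fun do rewrite mxE [X in _ + X]mxE summxE.
apply: measurable_funB.
  apply: measurable_sum => l; under eq_fun do rewrite mxE.
  apply: measurable_funTS; apply: measurable_funM => //; apply: measurable_funM.
    by apply: measurableT_comp => //; apply: measurable_indic; exact: measurable_itv.
  by apply: measurableT_comp => //; exact: measurable_indic.
have sub : Tpos `*` setT `<=` (`]0, +oo[ `*` setT : set (measurableTypeR R * U)).
  by move=> [s u] /= [/Tpos_sub].
apply: (measurable_funS _ sub); first by apply: measurableX => //; exact: measurable_itv.
rewrite (ord1 k).
apply: (@left_limit_measurable R _ _ _ (X ^~ w) (fun y u => c y u i 0)) => // u y.
by apply: (@continuous_comp _ _ _ (c ^~ u) (fun A => A i 0)); [exact: cc|exact: entry_continuous].
Qed.

Let phi2_tonelli : measurable_fun Tpos phi2 /\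
  (\int[@lebesgue_measure R]_(s in Tpos) phi2 s =
   \int[intensity nu]_(z in Tpos `*` setT) (g z)%:E)%E.
Proof.
apply: (@tonelli_strip R _ _ nu Tpos (EFin \o g)) => //.
  exact/measurable_EFinP.
by move=> z; rewrite /= lee_fin sqr_ge0.
Qed.

Let fin_sq (f : U -> 'cV[R]_d) : (\int[nu]_u (enorm (f u) ^+ 2)%:E < +oo)%E ->
  (\int[nu]_u (enorm (f u) ^+ 2)%:E)%E \is a fin_num.
Proof.
move=> h; rewrite ge0_fin_numE//; apply: integral_ge0 => u _.
by rewrite lee_fin sqr_ge0.
Qed.

(** The left side is the integral of [|h|^2], and [|h|^2 <= 2 |c|^2 + 2 |h - c|^2] pointwise. This
    is the hypothesis on [e] in [bracketP]. *)
Lemma mark_quadratic_le (eta : 'I_(prms_size S') -> 'cV[R]_d) (y : 'cV[R]_d) (K : R) :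
  let h u := \sum_i (\1_(prms_mark (p := S') i) u : R) *: eta i in
  (\int[nu]_u (enorm (c y u) ^+ 2)%:E <= K%:E)%E ->
  (\int[nu]_u (enorm (h u - c y u) ^+ 2)%:E < +oo)%E ->
  \sum_i \sum_k mark_cov nu i k * dotv (eta i) (eta k) <=
  2 * fine (\int[nu]_u (enorm (c y u) ^+ 2)%:E)%E
  + 2 * fine (\int[nu]_u (enorm (h u - c y u) ^+ 2)%:E)%E.
Proof.
move=> h cK hc.
rewrite -lee_fin -integral_simple_quadratic// -/(h _).
have mh i : measurable_fun setT (fun u => h u i 0).
  rewrite /h; under eq_fun do rewrite summxE; apply: measurable_sum => l.
  by under eq_fun do rewrite mxE; apply: measurable_funM => //; exact: measurable_indic.
have me (f : U -> 'cV[R]_d) : (forall i, measurable_fun setT (fun u => f u i 0)) ->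
    measurable_fun setT (fun u => (enorm (f u) ^+ 2)%:E).
  move=> mf; apply/measurable_EFinP; under eq_fun do rewrite enorm_sqr.
  apply: measurable_sum => i; apply: measurable_sum => k; rewrite (ord1 k).
  exact: measurable_funX.
have m1 : measurable_fun setT (fun u => (enorm (c y u) ^+ 2)%:E) by exact: me.
have m2 : measurable_fun setT (fun u => (enorm (h u - c y u) ^+ 2)%:E).
  apply: me => i; under eq_fun do rewrite mxE [X in _ + X]mxE.
  exact: measurable_funB.
have p2 (f : U -> 'cV[R]_d) u : (0 <= (enorm (f u) ^+ 2)%:E)%E by rewrite lee_fin sqr_ge0.
rewrite EFinD 2!EFinM (fineK (fin_sq hc)) (fineK (fin_sq (le_lt_trans cK (ltry _)))).
rewrite -ge0_integralZl_EFin//; try by (move=> u _; rewrite lee_fin sqr_ge0).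
rewrite -ge0_integralZl_EFin//; try by (move=> u _; rewrite lee_fin sqr_ge0).
rewrite -ge0_integralD//; last first.
- exact: measurable_funeM.
- by move=> u _; apply: mule_ge0; rewrite lee_fin ?sqr_ge0.
- exact: measurable_funeM.
- by move=> u _; apply: mule_ge0; rewrite lee_fin ?sqr_ge0.
apply: ge0_le_integral => //.
- by move=> u _; rewrite lee_fin sqr_ge0.
- exact: (me h mh).
- by apply: emeasurable_funD; exact: measurable_funeM.
move=> u _; rewrite -2!EFinM -EFinD lee_fin addrC.
by have := enorm_sqrD (h u - c y u) (c y u); rewrite subrK.
Qed.

Variables (r la L C kap rho delta e' eps K1 K2 : R).
Hypotheses (r0 : 0 < r) (delta0 : 0 <= delta) (L0 : 0 <= L) (C0 : 0 <= C) (eps0 : 0 < eps).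
Hypothesis rho_ge : r + 3 * delta + enorm x + T * enorm v + 3 <= rho.
Hypothesis bracketP : forall (z be : 'cV[R]_d) (xi sg : 'M[R]_d) (e e' c2 : R),
  let s := r ^+ 2 - dotv z z in
  0 < s -> enorm be <= L -> enorm sg ^+ 2 <= L ->
  la * enorm z ^+ 2 <= enorm (sg^T *m z) ^+ 2 ->
  e <= 2 * c2 + 2 * e' -> c2 <= L -> 0 <= e' ->
  - C * (enorm (xi - sg) ^+ 2 + e') <=
  - 6 * s ^+ 2 * dotv z be - 3 * s ^+ 2 * (nmom R 1 * enorm xi ^+ 2 + e)
   + 12 * nmom R 1 * s * enorm (xi^T *m z) ^+ 2 + kap * s ^+ 3.
Hypothesis coefL : forall y, enorm y <= rho -> [/\ enorm (b y - v) <= L,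
  enorm (sigma y) ^+ 2 <= L & (\int[nu]_u (enorm (c y u) ^+ 2)%:E <= L%:E)%E].
Hypothesis ellip : forall y z : 'cV[R]_d, la * enorm z ^+ 2 <= enorm ((sigma y)^T *m z) ^+ 2.
Hypotheses (bmK : forall t j, enorm (bm_step t S j w) <= K1)
  (prmK : forall t j i, enorm (prm_step t (S := S') j w i) <= K2).
Hypothesis d1 : (\int[@lebesgue_measure R]_(s in `[0%R, T])
  (enorm (bm_simple_fun S s w - sigma (X s w)) ^+ 2)%:E <= e'%:E)%E.
Hypothesis d2 : (\int[intensity nu]_(z in `[0%R, T] `*` setT)
  (enorm (prm_simple_fun S' z.1 z.2 w - c (left_lim (X ^~ w) z.1) z.2) ^+ 2)%:E <= e'%:E)%E.
Hypothesis eps_ge : 4 * (C + 1) * e' <= eps.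

Let sum_phi : (\int[@lebesgue_measure R]_(s in Tpos) ((phi1 s)%:E + phi2 s) <= (2 * e')%:E)%E.
Proof.
have [m2 E2] := phi2_tonelli.
rewrite ge0_integralD//; last first.
- by move=> s _; apply: integral_ge0 => u _; rewrite lee_fin sqr_ge0.
- exact/measurable_EFinP.
- by move=> s _; rewrite lee_fin sqr_ge0.
have -> : (2 * e')%:E = (e'%:E + e'%:E)%E by rewrite -EFinD mulr2n mulrDl mul1r.
apply: leeD.
  apply: le_trans d1; apply: ge0_integral_domain_mono => [s|s /=]; first by rewrite lee_fin sqr_ge0.
  by rewrite /Tpos /= !in_itv/= => /andP[/ltW -> ->].
rewrite E2; apply: le_trans d2; apply: ge0_integral_domain_mono => [s|[s u] /= [+ _]].
  by rewrite lee_fin sqr_ge0.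
by rewrite /Tpos /= !in_itv/= => /andP[/ltW -> ->].
Qed.

(** Steps are bad if they contain a point of the finite set [D] outside which the path moves by at
    most 1. Bad steps have small total length and a bounded deficit rate. On a good step the rate is
    at most a constant times the squared distance between integrands and coefficients at every time
    of the step, hence is controlled by the integral of that distance. Each kind receives half of
    [eps]. *)
Lemma grid_deficit_small : exists2 e0 : R, 0 < e0 & forall (t : nat -> R) (B : R),
  adapted_grid S S' T t -> (forall j, t j.+1 - t j <= e0) ->
  (forall j, drift b X v t B j w = b (X (t j) w) - v) ->
  (forall j, enorm (grid_tube nu W N b X v S S' t B j w - (X (t j) w - x - t j *: v))
     <= 3 * delta) ->
  forall M, \sum_(j < M) grid_deficit nu W N b X v S S' r kap t B j w <= eps.
Proof.
have [D HD] := cadlag_partition cX (fun y => @cvg_id _ (nbhs y)) T0 (@ltr01 R).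
pose E := \sum_i \sum_k `|@mark_cov _ _ _ _ nu _ _ S' i k| * K2 ^+ 2.
pose Cb := C * (2 * K1 ^+ 2 + 2 * L + E).
have E0 : 0 <= E by apply: sumr_ge0 => i _; apply: sumr_ge0 => k _; rewrite mulr_ge0 ?sqr_ge0.
have Cb0 : 0 <= Cb by apply: mulr_ge0 => //; apply: addr_ge0 => //; apply: addr_ge0; rewrite mulr_ge0 ?sqr_ge0.
pose q : R := 2 * (1 + (size D)%:R * Cb).
have q0 : 0 < q by rewrite /q mulr_gt0// ltr_pwDl// mulr_ge0.
exists (eps / q); first by rewrite divr_gt0.
move=> t B [t0 tS tT sS sS'] te driftE tubeE M.
have t_ge0 j : 0 <= t j by elim: j => [|j IH]; rewrite ?t0// (le_trans IH).
pose z j := grid_tube nu W N b X v S S' t B j w.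
pose s j := r ^+ 2 - dotv (z j) (z j).
pose e j := \sum_i \sum_k mark_cov nu i k * dotv (prm_step t (S := S') j w i) (prm_step t j w k).
pose br j := bracket r (nmom R 1) (mark_cov nu (S' := S')) (z j) (drift b X v t B j w)
  (bm_step t S j w) (prm_step t j w).
pose m j := posp (- (br j + kap * s j ^+ 3)).
pose bad j := has (fun p => t j < p <= t j.+1) D.
have defE j : grid_deficit nu W N b X v S S' r kap t B j w =
    if 0 < s j then (t j.+1 - t j) * m j else 0 by [].
(* While the tube is in the ball, tracking confines [X (t j) w] to the ball of radius [rho - 3]. The
   margin leaves room for the motion within a good step and for the passage to a left limit. *)
have Xt j : 0 < s j -> enorm (X (t j) w) <= rho - 3.
  move=> sj0; have zr : enorm (z j) <= r.
    rewrite -(@ler_pXn2r _ 2)// ?nnegrE ?enorm_ge0 ?(ltW r0)// enorm_dotv.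
    by move: sj0; rewrite /s; lra.
  have -> : X (t j) w = (z j - (z j - (X (t j) w - x - t j *: v))) + (x + t j *: v).
    by apply/matrixP => i k; rewrite !mxE; ring.
  apply: le_trans (enormD _ _) _.
  have h1 := enormD (z j) (- (z j - (X (t j) w - x - t j *: v))).
  have h2 := enormD x (t j *: v).
  rewrite enormN in h1; rewrite enormZ ger0_norm// in h2.
  have h3 := tubeE j; rewrite -/(z j) in h3.
  have h4 : t j * enorm v <= T * enorm v by rewrite ler_wpM2r ?enorm_ge0.
  by have := rho_ge; move: zr h1 h2 h3 h4; lra.
have Xle (u y : 'cV[R]_d) : enorm u <= rho - 3 -> enorm (u - y) <= 2 -> enorm y <= rho.
  move=> ur uy; have := enormD (- (u - y)) u; rewrite enormN opprB subrK.
  by move: ur uy; lra.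
have e_le j : e j <= E.
  apply: ler_sum => i _; apply: ler_sum => k _; apply: le_trans (ler_norm _) _.
  rewrite normrM ler_wpM2l//; apply: le_trans (dotv_le _ _) _.
  by rewrite expr2 ler_pM ?enorm_ge0.
have m_bad j : 0 < s j -> m j <= Cb.
  move=> sj0; have [bL sL cL] : [/\ enorm (b (X (t j) w) - v) <= L,
      enorm (sigma (X (t j) w)) ^+ 2 <= L
      & (\int[nu]_u (enorm (c (X (t j) w) u) ^+ 2)%:E <= L%:E)%E].
    by apply: coefL; apply: le_trans (Xt j sj0) _; rewrite lerBlDr lerDl.
  (* Only a crude bound is wanted on a bad step: [c2] is taken to be 0 and the bound [E] of the
     quadratic form plays the role of the distance. *)
  have := @bracketP (z j) (drift b X v t B j w) (bm_step t S j w) (sigma (X (t j) w)) (e j) E 0 sj0.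
  rewrite driftE => /(_ bL sL (ellip _ _)).
  have -> : e j <= 2 * 0 + 2 * E by have := e_le j; move: E0; lra.
  move=> /(_ isT L0 E0) H.
  apply: posp_le => //; rewrite lerNl; apply: le_trans; last first.
    by move: H; rewrite /br /bracket driftE -/(s j) -/(e j); apply.
  rewrite /Cb mulNr lerN2 ler_wpM2l// lerD2r.
  apply: le_trans (enorm_sqrD _ _) _; rewrite enormN lerD//.
    rewrite ler_wpM2l// ler_pXn2r ?nnegrE ?enorm_ge0//.
    exact: le_trans (enorm_ge0 _) (bmK t j).
  by rewrite ler_wpM2l.
pose C1 := C + 1.
have C10 : 0 < C1 by rewrite /C1 ltr_wpDl.
have m_ge0 j : 0 <= m j by exact: posp_ge0.
(* The integrands are compared with [sigma] and [c] at the same time [u], so no modulus of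
   continuity of these enters, while [z j] and the drift stay at the start of the step. Since
   ellipticity is uniform, [bracketP] accepts [sigma] at any point of the ball of radius [rho]. *)
have m_good j u : 0 < s j -> ~~ bad j -> t j < u <= t j.+1 ->
    ((m j / C1)%:E <= (phi1 u)%:E + phi2 u)%E.
  move=> sj0 gj /andP[tu ut].
  have uT : u <= T by rewrite (le_trans ut).
  have u0 : 0 < u by exact: le_lt_trans tu.
  have near_t u' : t j <= u' -> u' <= t j.+1 -> enorm (X (t j) w - X u' w) <= 1.
    move=> h1 h2; apply: HD => //; first exact: le_trans (tT j.+1).
    apply: contra gj => /hasP[p pD /andP[a1 a2]]; apply/hasP; exists p => //.
    by rewrite a1 (le_trans a2).
  have Xu : enorm (X u w) <= rho.
    apply: (Xle _ _ (Xt j sj0)); apply: le_trans (near_t u (ltW tu) ut) _.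
    by rewrite ler1n.
  have Xll : enorm (left_lim (X ^~ w) u) <= rho.
    apply: (Xle _ _ (Xt j sj0)).
    have nr : \forall u' \near u^'-, enorm (X u' w - left_lim (X ^~ w) u) < 1.
      apply: (@near_enorm R _ _ _ _ (X ^~ w)) => //; exact: cadlag_cvg_left.
    have nl : \forall u' \near u^'-, t j < u' by exact: nbhs_left_gt.
    have nlt : \forall u' \near u^'-, u' < u by exact: nbhs_left_lt.
    have [u' [[h1 h2] h3]] : exists u',
        (enorm (X u' w - left_lim (X ^~ w) u) < 1 /\ t j < u') /\ u' < u.
      by apply: (@filter_ex _ (u^'-)); exact: (filterI (filterI nr nl) nlt).
    apply: le_trans (enorm_dist _ (X u' w) _) _.
    have := near_t u' (ltW h2) (le_trans (ltW h3) ut).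
    by move: h1; lra.
  have [_ sL _] := coefL Xu; have [_ _ cL] := coefL Xll.
  have [bL _ _] : [/\ enorm (b (X (t j) w) - v) <= L,
      enorm (sigma (X (t j) w)) ^+ 2 <= L
      & (\int[nu]_u (enorm (c (X (t j) w) u) ^+ 2)%:E <= L%:E)%E].
    by apply: coefL; apply: le_trans (Xt j sj0) _; rewrite lerBlDr lerDl.
  have phi20 : (0 <= phi2 u)%E by apply: integral_ge0 => y _; rewrite lee_fin sqr_ge0.
  (* Only the time integral of [phi2] is known to be finite; at an exceptional time the claim is
     trivial. *)
  have [->|p2] := eqVneq (phi2 u) +oo%E; first by rewrite addey// leey.
  have p2fin : (phi2 u < +oo)%E by rewrite lt_neqAle p2 leey.
  have p2E : phi2 u = (\int[nu]_y (enorm (\sum_i (\1_(prms_mark (p := S') i) y : R)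
      *: prm_step t (S := S') j w i - c (left_lim (X ^~ w) u) y) ^+ 2)%:E)%E.
    apply: eq_integral => y _; rewrite /g/= (@prm_simple_fun_step _ _ _ _ t _ _ S' _ _ j)//.
    - by move=> i; case: (sS' i).
    - by move=> i; case: (sS' i).
    - by rewrite tu.
  have eq := @mark_quadratic_le (prm_step t (S := S') j w) (left_lim (X ^~ w) u) L cL.
  rewrite -p2E in eq; have {}eq := eq p2fin.
  have c2L : fine (\int[nu]_y (enorm (c (left_lim (X ^~ w) u) y) ^+ 2)%:E)%E <= L.
    rewrite -lee_fin fineK; first exact: cL.
    by apply: fin_sq; apply: (le_lt_trans cL); exact: ltry.
  have f20 : 0 <= fine (phi2 u) by rewrite fine_ge0.
  have := @bracketP (z j) (drift b X v t B j w) (bm_step t S j w) (sigma (X u w)) (e j)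
    (fine (phi2 u)) _ sj0.
  rewrite driftE => /(_ _ bL sL (ellip _ _) eq c2L f20) H.
  rewrite -(@fineK _ (phi2 u)); last by rewrite ge0_fin_numE.
  rewrite -EFinD lee_fin ler_pdivrMr; last exact: C10.
  have phi1E : enorm (bm_step t S j w - sigma (X u w)) ^+ 2 = phi1 u.
    have tuj : t j < u <= t j.+1 by rewrite tu.
    by rewrite /phi1 (bm_simple_fun_step (fun i => (sS i).1) (fun i => (sS i).2) w tuj).
  rewrite phi1E in H.
  have p10 : 0 <= phi1 u by exact: sqr_ge0.
  apply: posp_le; first by rewrite mulr_ge0 ?addr_ge0// ltW.
  rewrite lerNl; apply: le_trans; last first.
    by move: H; rewrite /br /bracket driftE -/(s j) -/(e j); apply.
  rewrite mulNr lerN2 [leLHS]mulrC; apply: ler_wpM2l; first exact: addr_ge0.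
  by rewrite /C1 lerDl.
pose mu j := if (0 < s j) && ~~ bad j then m j / C1 else 0.
have mu0 j : 0 <= mu j by rewrite /mu; case: ifP => // _; rewrite divr_ge0// ltW.
have phi_ge0 u : (0 <= (phi1 u)%:E + phi2 u)%E.
  apply: adde_ge0; first by rewrite lee_fin sqr_ge0.
  by apply: integral_ge0 => y _; rewrite lee_fin sqr_ge0.
have good_sum : \sum_(j < M) (t j.+1 - t j) * mu j <= 2 * e'.
  rewrite -lee_fin; apply: le_trans sum_phi.
  apply: (step_sum_le_integral t0 tS tT) => //.
    by apply: emeasurable_funD; [exact/measurable_EFinP|case: phi2_tonelli].
  move=> j u tu; rewrite /mu; case: ifP => [/andP[sj gj]|_]; last exact: phi_ge0.
  exact: m_good.
have bad_sum := bad_steps D M tS te (ltW (divr_gt0 eps0 q0)).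
have step j : grid_deficit nu W N b X v S S' r kap t B j w <=
    C1 * ((t j.+1 - t j) * mu j) + (if bad j then (t j.+1 - t j) * Cb else 0).
  have hj : 0 <= t j.+1 - t j by rewrite subr_ge0.
  rewrite defE /mu; have [sj0|sj0] := ltP 0 (s j); last first.
    rewrite mulr0 mulr0 add0r; case: ifP => // _; exact: mulr_ge0.
  case: ifPn => [gj|]; last first.
    by rewrite negbK mulr0 mulr0 add0r => ->; rewrite ler_wpM2l// m_bad.
  move: gj => /= gj; rewrite (negbTE gj) addr0.
  have -> : C1 * ((t j.+1 - t j) * (m j / C1)) = (t j.+1 - t j) * m j.
    by field; rewrite gt_eqF.
  exact: lexx.
apply: (@le_trans _ _ (\sum_(j < M) (C1 * ((t j.+1 - t j) * mu j)
    + (if bad j then (t j.+1 - t j) * Cb else 0)))).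
  by apply: ler_sum => j _; exact: step.
rewrite big_split/= -mulr_sumr -big_mkcond/= -mulr_suml.
have h1 : C1 * \sum_(j < M) (t j.+1 - t j) * mu j <= eps / 2.
  apply: le_trans (ler_wpM2l (ltW C10) good_sum) _.
  by have := eps_ge; rewrite /C1; lra.
have h2 : (\sum_(j < M | bad j) (t j.+1 - t j)) * Cb <= eps / 2.
  apply: le_trans (ler_wpM2r Cb0 bad_sum) _.
  have -> : eps / 2 = (1 + (size D)%:R * Cb) * (eps / q).
    by rewrite /q; field; rewrite gt_eqF// ltr_pwDl// mulr_ge0.
  rewrite mulrAC ler_wpM2r ?lerDr//.
  by rewrite divr_ge0 ?ltW.
lra.
Qed.

End no_stopping.

(** * Hitting the ball *)

Section events.
Context (R : realType) (d : measure_display) (T : measurableType d).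
Variable P : probability T R.

(** Continuity from below along the increasing events where [A j] holds for all [j >= k]. It turns a
    threshold that depends on the outcome into a single index. *)
Lemma eventually_prob_ge (A : nat -> set T) (G : set T) (theta : R) (k1 : nat) :
  (forall k, measurable (A k)) -> measurable G -> 0 < theta ->
  {ae P, forall w, G w -> exists k0, forall k, (k0 <= k)%N -> A k w} ->
  exists2 k, (k1 <= k)%N & (P G <= P (A k) + theta%:E)%E.
Proof.
move=> mA mG theta0 [Z [mZ PZ sZ]].
pose B k := \bigcap_(j in [set j | (k <= j)%N]) A j.
have mB k : measurable (B k) by exact: bigcap_measurableType.
have mUB : measurable (\bigcup_k B k) by exact: bigcup_measurable.
have ndB : nondecreasing_seq B.
  by move=> i j ij; apply/subsetPset => w Bw l /= jl; apply: Bw; exact: leq_trans jl.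
have cB := @nondecreasing_cvg_mu _ _ _ P B mB mUB ndB.
have finB : P (\bigcup_k B k) \is a fin_num by exact: fin_num_measure.
rewrite -[X in _ --> X](fineK finB) in cB.
have [k0 _ Hk] := (cvgrPdist_lt _ _).1 (fine_cvg cB) theta theta0.
pose k := maxn k0 k1; exists k; first exact: leq_maxr.
have /= := Hk k (leq_maxl _ _); rewrite ltr_norml => /andP[_ lt].
have GB : (P G <= P (\bigcup_k B k))%E.
  have -> : P (\bigcup_k B k) = (P (\bigcup_k B k) + P Z)%E by rewrite PZ adde0.
  apply: le_trans (measureU2 _ mUB mZ); rewrite le_measure ?inE//; first exact: measurableU.
  move=> w Gw; have [Zw|nZw] := pselect (Z w); [by right|left].
  have : G w -> exists k0, forall k, (k0 <= k)%N -> A k w.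
    by apply: contrapT => h; apply: nZw; exact: sZ.
  by move=> /(_ Gw)[k2 Hk2]; exists k2 => // j /=; exact: Hk2.
apply: (le_trans GB); apply: (@le_trans _ _ (P (B k) + theta%:E)%E).
  rewrite -(fineK finB) -(@fineK _ (P (B k))); last exact: fin_num_measure.
  by rewrite -EFinD lee_fin; lra.
apply: leeD => //; apply: le_measure; rewrite ?inE; [exact: mB|exact: mA|].
by move=> w Bw; apply: (Bw k) => /=.
Qed.

Lemma cvg_in_prob0_eventually (Y : nat -> T -> \bar R) (e theta : R) :
  cvg_in_prob0 P Y -> 0 < e -> 0 < theta ->
  \forall n \near \oo, (P [set w | (e%:E < Y n w)%E] < theta%:E)%E.
Proof.
move=> cY e0 theta0; have [mY cv] := cY e e0.
have [n0 _ H] := (cvgrPdist_lt _ _).1 (fine_cvg cv) theta theta0.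
exists n0 => // n nn; have := H n nn; rewrite /= sub0r normrN ger0_norm ?fine_ge0// => lt.
by rewrite -(@fineK _ (P _)) ?lte_fin//; exact: fin_num_measure.
Qed.

End events.

Section hitting.
Context (R : realType) (d : nat) (dU : measure_display) (U : measurableType dU).
Variable nu : {sigma_finite_measure set U -> \bar R}.
Variables (b : 'cV[R]_d -> 'cV[R]_d) (sigma : 'cV[R]_d -> 'M[R]_d)
  (c : 'cV[R]_d -> U -> 'cV[R]_d).
Hypotheses (cb : continuous b) (csigma : continuous sigma)
  (cc : forall u, continuous (c ^~ u))
  (mc : forall y i, measurable_fun setT (fun u => c y u i 0))
  (c2_fin : forall x, (\int[nu]_u (enorm (c x u) ^+ 2)%:E < +oo)%E)
  (c2_cont : continuous (fun x => fine (\int[nu]_u (enorm (c x u) ^+ 2)%:E)%E)).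

Lemma coefficients_bounded (v : 'cV[R]_d) (rho : R) : exists2 L : R, 0 <= L &
  forall y, enorm y <= rho -> [/\ enorm (b y - v) <= L,
    enorm (sigma y) ^+ 2 <= L & (\int[nu]_u (enorm (c y u) ^+ 2)%:E <= L%:E)%E].
Proof.
have [Kb HKb] := @continuous_enorm_bounded _ _ _ _ b rho cb.
have [Ks HKs] := @continuous_enorm_bounded _ _ _ _ sigma rho csigma.
have [Kc HKc] := continuous_bounded_ball rho c2_cont.
have kb := normr_ge0 Kb; have kc := normr_ge0 Kc; have ks := sqr_ge0 Ks.
have v0 := enorm_ge0 v.
exists (`|Kb| + enorm v + Ks ^+ 2 + `|Kc|); first by lra.
move=> y yr; split.
- have := enormD (b y) (- v); rewrite enormN.
  by have := HKb y yr; have := ler_norm Kb; lra.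
- apply: (@le_trans _ _ (Ks ^+ 2)); last by lra.
  rewrite ler_pXn2r ?nnegrE ?enorm_ge0//; first exact: HKs.
  by apply: le_trans (HKs y yr); exact: enorm_ge0.
- have fin : (\int[nu]_u (enorm (c y u) ^+ 2)%:E)%E \is a fin_num.
    by rewrite ge0_fin_numE//; apply: integral_ge0 => u _; rewrite lee_fin sqr_ge0.
  rewrite -(fineK fin) lee_fin; have := HKc y yr; have := ler_norm Kc.
  have := ler_norm (fine (\int[nu]_u (enorm (c y u) ^+ 2)%:E)%E); lra.
Qed.

Context (dO : measure_display) (Omega : measurableType dO).
Variables (P : probability Omega R) (F : R -> set (set Omega)).
Hypothesis F_usual : usual_filtration P F.
Variables (W : R -> Omega -> 'cV[R]_d)
  (N : Omega -> {measure set (measurableTypeR R * U) -> \bar R}).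
Hypothesis WN : driving_noises P F nu W N.
Variable la : R.
Hypotheses (la0 : 0 < la)
  (ellip : forall y z : 'cV[R]_d, la * enorm z ^+ 2 <= enorm ((sigma y)^T *m z) ^+ 2).

Lemma ball_hit (x y : 'cV[R]_d) (X : R -> Omega -> 'cV[R]_d) (T r : R) :
  sde_solution P F nu W N b sigma c x X -> 0 < T -> 0 < r ->
  ~ {ae P, forall w, 3 * r <= enorm (X T w - y)}.
Proof.
have final_ineq (q1 q2 q3 q4 q5 q6 q7 : R) : q1 <= q7 * (1 - q3) -> q7 * (1 - q3) <= q7 * q6 ->
    q7 * (1 - q2) <= q7 * q6 -> q4 <= q5 ->
    q1 + 2 * q7 * (1 - q2) + q5 + q4 <= 3 * q7 * q6 + 2 * q5.
  by move=> *; lra.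
move=> [adX cX [I [J [[S [okS SI]] [S' [okS' SJ]] XE]]]] T0 r0 far.
have T0' : 0 <= T by exact: ltW.
pose v : 'cV[R]_d := T^-1 *: (y - x).
pose delta := r / 3.
have delta0 : 0 < delta by rewrite divr_gt0.
pose rho := r + 3 * delta + enorm x + T * enorm v + 3.
have [L L0 coefL] := coefficients_bounded v rho.
have [kap [Cb [kap0 Cb0 bracketP]]] := @bracket_lb R d r L la (nmom R 1) r0 L0 la0 (nmom1_gt0 R).
pose Q := expR (2 * kap * T).
have Q1 : 1 <= Q.
  by apply: le_trans (expR_ge1Dx _); rewrite lerDl !mulr_ge0.
have Q0 : 0 < Q by rewrite (lt_le_trans _ Q1).
pose a := r ^+ 6.
have a0 : 0 < a by exact: exprn_gt0.
(* The budget of the final contradiction: after multiplication by [Q], the three terms [a * theta]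
   amount to [a / 4], and [eps] and the discretization error to [a / 4] each. The total is [3 / 4]
   of [a]. *)
pose eps := a / (4 * Q).
have eps0 : 0 < eps by rewrite divr_gt0// mulr_gt0.
pose e' := eps / (4 * (Cb + 1)).
have Cb1 : 0 < Cb + 1 by rewrite ltr_wpDl.
have e'0 : 0 < e' by rewrite divr_gt0// mulr_gt0.
pose theta : R := (12 * Q)^-1.
have theta0 : 0 < theta by rewrite invr_gt0 mulr_gt0.
have th8 : 0 < theta / 8 by rewrite divr_gt0.
have [SI1 SI2] := SI T T0'; have [SJ1 SJ2] := SJ T T0'.
(* One pair of simple integrands serves from here on. Outside [Bad], of probability at most
   [theta / 2], both integrands are close in [L^2] and both integrals uniformly close. *)
have [n [[n1 n2] [n3 n4]]] := filter_ex (filterI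
  (filterI (cvg_in_prob0_eventually SI1 e'0 th8) (cvg_in_prob0_eventually SI2 delta0 th8))
  (filterI (cvg_in_prob0_eventually SJ1 e'0 th8) (cvg_in_prob0_eventually SJ2 delta0 th8))).
have m1 := (SI1 e' e'0).1 n; have m2 := (SI2 delta delta0).1 n.
have m3 := (SJ1 e' e'0).1 n; have m4 := (SJ2 delta delta0).1 n.
set B1 := [set w | _] in n1 m1; set B2 := [set w | _] in n2 m2.
set B3 := [set w | _] in n3 m3; set B4 := [set w | _] in n4 m4.
pose Bad := (B1 `|` B2) `|` (B3 `|` B4).
have mBad : measurable Bad by do 2 apply: measurableU => //; exact: measurableU.
have PBad : (P Bad <= (theta / 2)%:E)%E.
  apply: le_trans (measureU2 _ (measurableU _ _ m1 m2) (measurableU _ _ m3 m4)) _.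
  have -> : (theta / 2)%:E = ((theta / 8)%:E + (theta / 8)%:E + ((theta / 8)%:E + (theta / 8)%:E))%E.
    by rewrite -!EFinD; congr EFin; field.
  by apply: leeD; [apply: le_trans (measureU2 _ m1 m2) _|apply: le_trans (measureU2 _ m3 m4) _];
    apply: leeD; [exact: (ltW n1)|exact: (ltW n2)|exact: (ltW n3)|exact: (ltW n4)].
have okSn := okS n; have okS'n := okS' n.
have [K1 HK1] := bm_step_bounded okSn; have [K2 HK2] := prm_step_bounded okS'n.
have lrS i : 0 <= bms_l (b := S n) i <= bms_r (b := S n) i.
  by case: (okSn i) => -> ->.
have lrS' i : 0 <= prms_l (p := S' n) i <= prms_r (p := S' n) i.
  by case: (okS'n i) => -[-> ->].
have mA i : measurable (prms_mark (p := S' n) i) by case: (okS'n i).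
have nA i : (nu (prms_mark (p := S' n) i) < +oo)%E by case: (okS'n i).
have [Cg Cg0 gridP] := grid_bound F_usual WN v cb adX okSn okS'n r0.
pose Bk (k : nat) : R := k.+1%:R.
have Bk1 k : 1 <= Bk k by rewrite /Bk ler1n.
have Bk0 k : 0 < Bk k by rewrite (lt_le_trans _ (Bk1 k)).
(* A mesh that ensures both [h * B ^+ 4 <= 1] and [kap * h <= 1 / 2]. *)
pose ek k := ((2 * kap + 1) * Bk k ^+ 4)^-1.
have ek_gt0 k : 0 < ek k.
  by rewrite invr_gt0 mulr_gt0 ?exprn_gt0// ltr_wpDl// mulr_ge0.
pose ends : seq R := [seq bms_l (b := S n) i | i <- enum 'I_(bms_size (S n))]
  ++ [seq bms_r (b := S n) i | i <- enum 'I_(bms_size (S n))]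
  ++ [seq prms_l (p := S' n) i | i <- enum 'I_(prms_size (S' n))]
  ++ [seq prms_r (p := S' n) i | i <- enum 'I_(prms_size (S' n))].
have /choice[tM HtM] : forall k, exists tM : (nat -> R) * nat,
    [/\ tM.1 0 = 0, forall j, tM.1 j <= tM.1 j.+1, tM.1 tM.2 = T, forall j, tM.1 j <= T
      & (forall j, tM.1 j.+1 - tM.1 j <= ek k) /\ forall p, p \in ends -> separates tM.1 p].
  by move=> k; have [t [M H]] := grid_exists ends T0' (ek_gt0 k); exists (t, M).
pose t k := (tM k).1; pose M k := (tM k).2.
have tgrid k : adapted_grid (S n) (S' n) T (t k).
  have [h1 h2 _ h3 [_ h4]] := HtM k.
  split => // i; split; apply: h4; rewrite !mem_cat; apply/or4P.
  - by apply: Or41; apply: map_f; rewrite mem_enum.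
  - by apply: Or42; apply: map_f; rewrite mem_enum.
  - by apply: Or43; apply: map_f; rewrite mem_enum.
  - by apply: Or44; apply: map_f; rewrite mem_enum.
pose z k := grid_tube nu W N b X v (S n) (S' n) (t k) (Bk k) (M k).
pose al k := grid_alive nu W N b X v (S n) (S' n) r kap eps (t k) (Bk k) (M k).
have t0 k : t k 0 = 0 by case: (HtM k).
have tS k j : t k j <= t k j.+1 by have [_ h _ _ _] := HtM k; exact: h.
have mz k i : measurable_fun setT (fun w => z k w i 0).
  exact: (measurable_grid_tube F_usual WN v cb adX okSn okS'n (t0 k) (tS k) (ltW (Bk0 k))).
have mal k : measurable_fun setT (al k).
  exact: (measurable_grid_alive F_usual WN v cb adX okSn okS'n (t0 k) (tS k) (ltW (Bk0 k))).
have mF k : measurable_fun setT (fun w => barrier r (z k w)).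
  apply: measurable_funX; apply: measurable_maxr => //; apply: measurable_funB => //.
  by apply: measurable_sum => i; exact: measurable_funM.
(* Here the path is alive and the tube ends outside the open ball, so the outcome contributes
   nothing to the expectation that the grid bound keeps away from 0. *)
pose A k := (al k @^-1` [set 1]) `&` ((fun w => barrier r (z k w)) @^-1` [set 0]).
have mA' k : measurable (A k).
  apply: measurableI; rewrite -[X in measurable X]setTI; [exact: mal|exact: mF].
have far_ae := far.
have Nfin : {ae P, forall w i, (N w (`]0%R, T] `*` prms_mark (p := S' n) i) < +oo)%E}.
  apply: filter_forall => i.
  apply: filterS (N_ae_nat F_usual WN (lexx 0) T0 (mA i) (nA i)) => w [k ->].
  exact: ltry.
have conv : {ae P, forall w, (~` Bad) w -> exists k0, forall k, (k0 <= k)%N -> A k w}.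
  apply: filterS3 (filterI cX XE) Nfin far => w [cw Xw] Nw farw nBad.
  have nB (B : set Omega) : B `<=` Bad -> ~ B w by move=> BB Bw; exact/nBad/BB.
  have /negP := nB B1 (subset_trans (@subsetUl _ _ _) (@subsetUl _ _ _)).
  rewrite -leNgt => d1.
  have /negP := nB B2 (subset_trans (@subsetUr _ _ _) (@subsetUl _ _ _)).
  rewrite -leNgt => dI.
  have /negP := nB B3 (subset_trans (@subsetUl _ _ _) (@subsetUr _ _ _)).
  rewrite -leNgt => d2.
  have /negP := nB B4 (subset_trans (@subsetUr _ _ _) (@subsetUr _ _ _)).
  rewrite -leNgt => dJ.
  have SIw s : 0 <= s <= T -> enorm (bm_simple_int W (S n) s w - I s w) <= delta.
    move=> sT; rewrite -lee_fin; apply: le_trans dI; apply: ereal_sup_ubound.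
    by exists s => //=; rewrite in_itv.
  have SJw s : 0 <= s <= T -> enorm (prm_simple_int nu N (S' n) s w - J s w) <= delta.
    move=> sT; rewrite -lee_fin; apply: le_trans dJ; apply: ereal_sup_ubound.
    by exists s => //=; rewrite in_itv.
  have [e1 [B0 [e1_gt0 track]]] := grid_tube_tracking v cb lrS lrS' mA nA T0' cw Nw delta0 Xw SIw SJw.
  have eps_ge : 4 * (Cb + 1) * e' <= eps.
    by rewrite /e' le_eqVlt; apply/orP; left; apply/eqP; field; rewrite gt_eqF.
  have [e2 e2_gt0 small] := @grid_deficit_small R d dU U nu dO Omega W N b sigma c X x v
    csigma cc mc (S n) (S' n) mA nA T w T0' cw r la L Cb kap rho delta e' eps K1 K2
    r0 L0 Cb0 eps0 (lexx _) bracketP coefL ellip (fun t j => HK1 t j w)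
    (fun t j i => HK2 t j w i) d1 d2 eps_ge.
  pose K := `|B0| + e1^-1 + e2^-1.
  exists (Num.truncn K) => k Kk.
  have BK : K < Bk k by rewrite /Bk; apply: lt_le_trans (truncnS_gt _) _; rewrite ler_nat ltnS.
  have e1i : 0 < e1^-1 by rewrite invr_gt0.
  have e2i : 0 < e2^-1 by rewrite invr_gt0.
  have B0n := normr_ge0 B0.
  have ekB : ek k <= (Bk k)^-1.
    rewrite lef_pV2 ?posrE ?mulr_gt0 ?exprn_gt0//; last by rewrite ltr_wpDl// mulr_ge0.
    have b3 : 1 <= Bk k ^+ 3 by rewrite exprn_ege1.
    have b4 : Bk k <= Bk k ^+ 4 by rewrite exprS ler_peMr// ltW.
    apply: (le_trans b4); rewrite ler_peMl ?exprn_ge0 ?(ltW (Bk0 k))//.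
    by rewrite lerDr mulr_ge0.
  have ek1 : ek k <= e1.
    by apply: (le_trans ekB); rewrite -[e1]invrK lef_pV2 ?posrE//; move: BK B0n e1i e2i; rewrite /K; goal_lra.
  have ek2 : ek k <= e2.
    by apply: (le_trans ekB); rewrite -[e2]invrK lef_pV2 ?posrE//; move: BK B0n e1i e2i; rewrite /K; goal_lra.
  have BkB0 : B0 <= Bk k by have := ler_norm B0; move: BK B0n e1i e2i; rewrite /K; goal_lra.
  have [_ _ tMT _ [tek _]] := HtM k.
  have [driftE trackE] := track (t k) (Bk k) (tgrid k)
    (fun j => le_trans (tek j) ek1) BkB0.
  have sumD := small (t k) (Bk k) (tgrid k) (fun j => le_trans (tek j) ek2) driftE trackE.
  split => /=.
    by rewrite /al /grid_alive /alive ifT//; exact: sumD.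
  have trM := trackE (M k); rewrite -/(z k w) in trM.
  have tM' : t k (M k) = T by exact: tMT.
  rewrite tM' in trM.
  have XvE : X T w - x - T *: v = X T w - y.
    by rewrite /v scalerA mulfV ?gt_eqF// scale1r opprB addrA subrK.
  rewrite XvE in trM.
  (* [X T w] is at distance at least [3 * r] from [y], and the tracking error is at most
     [3 * delta = r]. *)
  have zge : r <= enorm (z k w).
    have := enorm_dist (X T w) (X T w - z k w) y.
    have -> : X T w - (X T w - z k w) = z k w by rewrite opprB addrC subrK.
    have -> : X T w - z k w - y = - (z k w - (X T w - y)) by rewrite opprB addrAC.
    by rewrite enormN; move: r0 farw trM; rewrite /delta; goal_lra.
  rewrite /barrier posp0 ?expr0n// -enorm_dotv subr_le0.
  by rewrite ler_pXn2r ?nnegrE ?enorm_ge0// ltW.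
have mG : measurable (~` Bad) by exact: measurableC.
(* Beyond this index the discretization error [Cg * (T / Bk k)] is at most [a / (4 * Q)]; [Cg]
   depends on the simple integrands, so this choice has to come after theirs. *)
pose k1 := Num.truncn (4 * Cg * T * Q / a).
have th2 : 0 < theta / 2 by rewrite divr_gt0.
have [k kk1 PA] := eventually_prob_ge k1 mA' mG th2 conv.
have PAge : 1 - theta <= fine (P (A k)).
  rewrite probability_setC// in PA.
  have fA : P (A k) \is a fin_num by exact: fin_num_measure.
  have fB : P Bad \is a fin_num by exact: fin_num_measure.
  move: PA PBad; rewrite -(fineK fA) -(fineK fB) -EFinB -EFinD !lee_fin; goal_lra.
have [_ _ tMT _ [tek _]] := HtM k.
have hB j : (t k j.+1 - t k j) * Bk k ^+ 4 <= 1.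
  apply: le_trans (ler_wpM2r _ (tek j)) _; first exact/exprn_ge0/ltW.
  rewrite /ek invfM -mulrA mulVf ?mulr1; last by rewrite gt_eqF// exprn_gt0.
  by rewrite invf_le1 ?lerDr ?mulr_ge0// ltr_wpDl// mulr_ge0.
have hkap j : kap * (t k j.+1 - t k j) <= 2^-1.
  apply: le_trans (ler_wpM2l kap0 (tek j)) _.
  rewrite /ek ler_pdivrMr; last by rewrite mulr_gt0 ?exprn_gt0// ltr_wpDl// mulr_ge0.
  have b4 : 1 <= Bk k ^+ 4 by rewrite exprn_ege1.
  have : (2 * kap + 1) * 1 <= (2 * kap + 1) * Bk k ^+ 4.
    by rewrite ler_wpM2l// addr_ge0// mulr_ge0.
  by move: kap0; goal_lra.
have main := gridP (t k) (Bk k) kap eps (M k) (t0 k) (tS k) (Bk1 k) hB kap0 hkap (ltW eps0).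
have tMT' : t k (M k) = T by exact: tMT.
rewrite tMT' -/Q -/a in main.
have al01 w : al k w = 0 \/ al k w = 1.
  by rewrite /al /grid_alive /alive; case: ifP; [right|left].
have al_L1 : L1 P (al k).
  apply: (L1_bounded _ (mal k) (M := 1)) => w.
  by case: (al01 w) => ->; rewrite ?normr0 ?normr1.
have alF_L1 : L1 P (fun w => al k w * barrier r (z k w)).
  apply: (L1_bounded _ (measurable_funM (mal k) (mF k)) (M := r ^+ 6)) => w.
  have F0 := barrier_ge0 r (z k w); have F1 := barrier_le r (z k w).
  by rewrite /=; case: (al01 w) => ->; rewrite ?mul0r ?mul1r ?normr0 ?exprn_ge0 ?ger0_norm// ltW.
have Eal : fine (P (A k)) <= Ex P (al k).
  rewrite -Ex_indic//; apply: Ex_le => //; first exact: L1_indic.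
  move=> w; rewrite indicE; case: (boolP (w \in A k)) => [/set_mem[/= -> _]//|_] /=.
  by case: (al01 w) => ->.
(* The barrier is at most [a] and the integrand vanishes on [A k]. *)
have EalF : Ex P (fun w => al k w * barrier r (z k w)) <= a * (1 - fine (P (A k))).
  rewrite -Ex_indic// mulrBr mulr1 -(Ex_cst P a) -ExZ; last exact: L1_indic.
  rewrite Ex_cst -[X in X - _](Ex_cst P a) -ExB; [|exact: L1_cst|by apply: L1Z; exact: L1_indic].
  apply: Ex_le => //.
    by apply: L1B; [exact: L1_cst|apply: L1Z; exact: L1_indic].
  move=> w; rewrite indicE; case: (boolP (w \in A k)) => [/set_mem[/= _ ->]|_] /=.
    by rewrite mulr0 mulr1 subrr.
  rewrite mulr0 subr0; have F1 := barrier_le r (z k w).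
  by case: (al01 w) => ->; rewrite ?mul0r ?mul1r// ltW.
have CT : Cg * (T / Bk k) <= a / (4 * Q).
  have : 4 * Cg * T * Q / a < Bk k.
    by rewrite /Bk; apply: lt_le_trans (truncnS_gt _) _; rewrite ler_nat ltnS.
  rewrite ltr_pdivrMr// => /ltW h.
  rewrite mulrA ler_pdivrMr// mulrAC ler_pdivlMr ?mulr_gt0//.
  by move: h; goal_lra.
move: main; rewrite -/(al k) -/(z k).
have main' : a <= Q * (3 * a * theta + 2 * (a / (4 * Q))) -> False.
  have -> : Q * (3 * a * theta + 2 * (a / (4 * Q))) = a * (3 / 4).
    by rewrite /theta; field; rewrite gt_eqF.
  by move: a0; goal_lra.
move=> main; apply: main'; apply: (le_trans main); apply: ler_wpM2l; first exact: ltW.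
have h1 : a * (1 - fine (P (A k))) <= a * theta by rewrite ler_pM2l//; move: PAge; goal_lra.
have h2 : a * (1 - Ex P (al k)) <= a * theta by rewrite ler_pM2l//; move: PAge Eal; goal_lra.
have fi := final_ineq _ _ _ _ eps _ _ EalF h1 h2 CT.
exact: fi.
Qed.

End hitting.

Theorem lemma6p1 (R : realType) (d : nat) (hd : (2 <= d)%N)
  (dU : measure_display) (U : measurableType dU)
  (nu : {sigma_finite_measure set U -> \bar R})
  (b : 'cV[R]_d -> 'cV[R]_d) (sigma : 'cV[R]_d -> 'M[R]_d)
  (c : 'cV[R]_d -> U -> 'cV[R]_d)
  (b_meas : measurable_fun [set: borel 'cV[R]_d]
     (b : borel 'cV[R]_d -> borel 'cV[R]_d))
  (sigma_meas : measurable_fun [set: borel 'cV[R]_d]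
     (sigma : borel 'cV[R]_d -> borel 'M[R]_d))
  (c_meas : measurable_fun [set: borel 'cV[R]_d * U]
     ((fun z => c z.1 z.2) : borel 'cV[R]_d * U -> borel 'cV[R]_d))
  (b_cont : continuous b) (sigma_cont : continuous sigma)
  (c_cont : forall u, continuous (c ^~ u))
  (c2_fin : forall x, (\int[nu]_u (enorm (c x u) ^+ 2)%:E < +oo)%E)
  (c2_cont : continuous
     (fun x => fine (\int[nu]_u (enorm (c x u) ^+ 2)%:E)%E))
  (dO : measure_display) (Omega : measurableType dO)
  (P : probability Omega R) (F : R -> set (set Omega))
  (F_usual : usual_filtration P F)
  (W : R -> Omega -> 'cV[R]_d)
  (N : Omega -> {measure set (measurableTypeR R * U) -> \bar R})
  (WN : driving_noises P F nu W N)
  (X : 'cV[R]_d -> R -> Omega -> 'cV[R]_d)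
  (X_sol : forall x, sde_solution P F nu W N b sigma c x (X x))
  (growth : exists2 kappa : R, 0 < kappa & forall x,
     ((2 * dotv x (b x) + enorm (sigma x) ^+ 2)%:E
       + \int[nu]_u (enorm (c x u) ^+ 2)%:E
       <= (kappa * (enorm x ^+ 2 + 1))%:E)%E)
  (local_cond : exists (delta0 : R) (rho : R -> R),
     [/\ 0 < delta0,
         (forall r, 0 <= r -> 0 <= rho r)
           /\ (forall r s, 0 <= r -> r <= s -> rho r <= rho s)
           /\ concave_on_nonneg rho,
         forall r, 0 < r ->
           0 < rho r /\ rho r <= (1 + r) ^+ 2 * rho (r / (1 + r)),
         forall e, 0 < e ->
           (\int[lebesgue_measure]_(r in `]0%R, e]) ((rho r)^-1)%:E = +oo)%E
       & forall K : R, 0 < K -> exists2 kappaK : R, 0 < kappaK &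
           forall x z, Num.max (enorm x) (enorm z) <= K ->
             enorm (x - z) <= delta0 ->
             ((2 * dotv (x - z) (b x - b z)
                 + enorm (sigma x - sigma z) ^+ 2)%:E
               + \int[nu]_u (enorm (c x u - c z u) ^+ 2)%:E
               <= (kappaK * rho (enorm (x - z) ^+ 2))%:E)%E])
  (elliptic : exists2 lambda0 : R, 0 < lambda0 & forall x y,
     lambda0 * enorm y ^+ 2 <= dotv y ((sigma x *m (sigma x)^T) *m y)) :
  irreducible (transition P X).
Proof.
move=> T x T0 B oB [y By].
have [adX _ _] := X_sol x.
have mB : measurable [set w | B (X x T w)].
  case: F_usual => FS _ _ _; apply: (FS T (ltW T0)).2; apply: (adX T (ltW T0)).
  by exists B => //; exact: sub_sigma_algebra.
rewrite /transition lt_neqAle measure_ge0 andbT; apply/negP => /eqP P0.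
have [q q0 Hq] := nbhs_enorm (open_nbhs_nbhs (conj oB By)).
have q3 : 0 < q / 3 by rewrite divr_gt0.
have [la la0 Hla] := elliptic.
have ellip (y' z : 'cV[R]_d) : la * enorm z ^+ 2 <= enorm ((sigma y')^T *m z) ^+ 2.
  by apply: le_trans (Hla y' z) _; rewrite -mulmxA dotv_mulmx enorm_dotv.
have mc (y' : 'cV[R]_d) (i : 'I_d) : measurable_fun setT (fun u => c y' u i 0).
  have h1 := continuous_borel_measurable (@entry_continuous R d 1 i 0).
  have h2 : measurable_fun setT (fun u : U => (y' : borel 'cV[R]_d, u)) by exact: pair1_measurable.
  exact: (measurableT_comp h1 (measurableT_comp c_meas h2)).
apply: (ball_hit b_cont sigma_cont c_cont mc c2_fin c2_cont F_usual WN la0 ellip (X_sol x) T0 q3 (y := y)).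
(* If this event were null, [X x T] would almost surely stay at distance at least [q] from [y],
   which [ball_hit] excludes for the radius [q / 3]. *)
exists [set w | B (X x T w)]; split => //.
move=> w /= /negP; rewrite -ltNge => h; apply: Hq; move: h; lra.
Qed.
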